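(* Let $X:[0,1]^k\times\Omega\to\mathbb{R}^n$ be a centered Gaussian random field over a probability space $(\Omega,\mathcal{F},\mathbb{P})$ with $X(0)=0$ $\mathbb{P}$-a.s., and let $\varphi:[0,1]^k\to\mathbb{R}^n$ be a bounded Borel function. Suppose that for $\mathcal{L}^{2k}$-a.e. $(s,t)\in[0,1]^{2k}$ the covariance matrix $\sigma^2(s,t):=\mathrm{Cov}(X(t)-X(s))$ of $X(t)-X(s)$ has a positive determinant, and that $X$ is locally nondeterministic. If $0<\alpha<n$ and there is some $\delta>0$ such that $$\operatorname*{ess\,sup}_{s\in[0,1]^k}\int_{[0,1]^k}\frac{dt}{|\det\sigma^2(s,t)|^{\frac{n-\alpha}{2n}+\delta}}<+\infty,$$ then $G^\alpha\mu_{X+\varphi}$ is locally H\''older continuous on $\mathbb{R}^n$ $\mathbb{P}$-a.s.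
   Context: The random field $X$ is assumed jointly measurable. For a Borel function $Y:[0,1]^k\to\mathbb{R}^n$ its occupation measure is $\mu_Y(B)=\mathcal{L}^k(\{t\in[0,1]^k:Y(t)\in B\})$; $\mu_{X+\varphi}$ is the (random) occupation measure of $t\mapsto X(t,\omega)+\varphi(t)$. The Bessel kernel $g_\alpha$ of order $\alpha>0$ on $\mathbb{R}^n$ is determined by its Fourier transform $\hat g_\alpha(\xi)=(1+|\xi|^2)^{-\alpha/2}$, with the convention $\hat\mu(\xi)=\int_{\mathbb{R}^n}e^{i\langle x,\xi\rangle}\mu(dx)$, and the Bessel potential of a measure $\mu$ is $G^\alpha\mu(x)=\int_{\mathbb{R}^n}g_\alpha(x-y)\mu(dy)$. $X$ is called locally nondeterministic if for any integer $\ell\ge2$ there are constants $c_\ell>0$ and $\varepsilon_\ell>0$ such that $$\mathrm{Var}\Big(\sum_{j=1}^\ell\big\langle u_j,\sigma_j^{-1}(X(t_j)-X(t_{j-1}))\big\rangle\Big)\ge c_\ell\sum_{j=1}^\ell|u_j|^2$$ for all $u_1,\dots,u_\ell\in\mathbb{R}^n$ and $\mathcal{L}^{k\ell}$-a.e. $(t_1,\dots,t_\ell)\in([0,1]^k)^\ell$ with all $t_j$ lying in a single subcube of $[0,1]^k$ of side length $\varepsilon_\ell$ and such that $|t_{j+1}-t_j|\le|t_{j+1}-t_i|$ for $1\le i\le j<\ell$. Here $t_0:=0$, $\sigma_j^2=\mathrm{Cov}(X(t_j)-X(t_{j-1}))$ is the covariance matrix of the increment, $\sigma_j$ is its root (that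 is, $\sigma_j\sigma_j^T=\sigma_j^2$) and $\sigma_j^{-1}$ is the inverse of $\sigma_j$. *)

(* Defs.v *)
From HB Require Import structures.
From mathcomp Require Import all_boot all_order all_algebra.
From mathcomp Require Import all_classical all_reals all_analysis.

Set Implicit Arguments.
Unset Strict Implicit.
Unset Printing Implicit Defensive.

Import Order.TTheory GRing.Theory Num.Theory.
Import numFieldNormedType.Exports.

Local Open Scope classical_set_scope.
Local Open Scope ring_scope.

Section cons_measure.
Context d (T : measurableType d) (R : realType).
Variable mu : {sigma_finite_measure set T -> \bar R}.
Variable n : nat.
Variable nu : {sigma_finite_measure set (n.-tuple T) -> \bar R}.

Definition tuple_of_pair (p : T * n.-tuple T) : n.+1.-tuple T :=
  [tuple of p.1 :: p.2].

Definition cons_measure : set (n.+1.-tuple T) -> \bar R :=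
  pushforward (mu \x nu)%E tuple_of_pair.

Lemma measurable_tuple_of_pair : measurable_fun setT tuple_of_pair.
Proof. exact: (measurable_cons measurable_fst measurable_snd). Qed.

Let M : {measure set (n.+1.-tuple T) -> \bar R} :=
  measure_function_pushforward__canonical__measure_function_Measure
    (mu \x nu)%E measurable_tuple_of_pair.

Let cons_measure0 : cons_measure set0 = 0%E.
Proof. exact: (measure0 M). Qed.

Let cons_measure_ge0 A : (0 <= cons_measure A)%E.
Proof. exact: (measure_ge0 M). Qed.

Let cons_measure_sigma_additive : semi_sigma_additive cons_measure.
Proof. exact: (@measure_semi_sigma_additive _ _ _ M). Qed.

HB.instance Definition _ := isMeasure.Build _ _ _ cons_measure
  cons_measure0 cons_measure_ge0 cons_measure_sigma_additive.

Let cons_measure_sigma_finite : sigma_finite setT cons_measure.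
Proof.
have /sigma_finiteP[F [TF ndF Foo]] := sigma_finiteT mu.
have /sigma_finiteP[G [TG ndG Goo]] := sigma_finiteT nu.
exists (fun i => (fun t : n.+1.-tuple T => tnth t ord0) @^-1` F i `&`
    (fun t : n.+1.-tuple T => [tuple of behead t]) @^-1` G i).
  apply/esym; rewrite -subTset => t _.
  have [i _ Fi] : (\bigcup_i F i) (tnth t ord0) by rewrite -TF.
  have [j _ Gj] : (\bigcup_i G i) [tuple of behead t] by rewrite -TG.
  exists (maxn i j) => //; split => /=.
    by move: Fi; exact/subsetPset/ndF/leq_maxl.
  by move: Gj; exact/subsetPset/ndG/leq_maxr.
move=> i; have [mF Fi] := Foo i; have [mG Gi] := Goo i; split.
  apply: measurableI.
    by rewrite -[X in measurable X]setTI; exact: measurable_tnth.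
  by rewrite -[X in measurable X]setTI; exact: measurable_behead.
rewrite /cons_measure /pushforward.
rewrite [X in (mu \x nu)%E X](_ : _ = F i `*` G i).
  by rewrite product_measure1E// lte_mul_pinfty// ge0_fin_numE.
have E x (t : n.-tuple T) :
    [tuple of behead (tuple_of_pair (x, t))] = t :> n.-tuple T.
  exact: val_inj.
by apply/seteqP; split=> -[x t] /= [Fx Gt]; split; rewrite ?E//; move: Gt;
  rewrite E.
Qed.

HB.instance Definition _ := Measure_isSigmaFinite.Build _ _ _ cons_measure
  cons_measure_sigma_finite.

End cons_measure.

Fixpoint tuple_measure d (T : measurableType d) (R : realType)
    (mu : {sigma_finite_measure set T -> \bar R}) (m : nat) :
    {sigma_finite_measure set (m.-tuple T) -> \bar R} :=
  match m with
  | 0 => \d_([tuple] : 0.-tuple T)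
  | m'.+1 => cons_measure mu (tuple_measure mu m')
  end.

(* Points of R^m are tuples, which carry the product (= Borel) sigma-algebra;
   linear algebra and topology are done on the associated column vectors. *)
Notation Rn R m := (m.-tuple (measurableTypeR R)).

Definition lebesgue_Rn (R : realType) (m : nat) :
    {sigma_finite_measure set (Rn R m) -> \bar R} :=
  tuple_measure (@lebesgue_measure R) m.

Section euclidean.
Context (R : realType).

Definition colv m (x : Rn R m) : 'cV[R]_m := \col_i (tnth x i : R).

Definition dotv m (u v : 'cV[R]_m) : R := \sum_i u i 0 * v i 0.

(* Euclidean norm; the library's norm on matrices is the sup norm. *)
Definition enorm m (u : 'cV[R]_m) : R := Num.sqrt (\sum_i u i 0 ^+ 2).

Definition origin m : Rn R m := [tuple of nseq m 0].

Arguments origin m : clear implicits.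

Definition unit_cube m : set (Rn R m) :=
  [set t | forall i, 0 <= (tnth t i : R) <= 1].

Arguments unit_cube m : clear implicits.

Lemma measurable_unit_cube m : measurable (unit_cube m).
Proof.
have -> : unit_cube m = \bigcap_i ((fun t : Rn R m => tnth t i) @^-1`
    ([set` `[0, 1]] : set (measurableTypeR R))).
  apply/seteqP; split=> t /=; first by move=> h i _ /=; rewrite in_itv /= h.
  by move=> h i; have := h i I; rewrite /= in_itv.
apply: fin_bigcap_measurable => [|i _]; first exact: finite_finset.
rewrite -[X in measurable X]setTI.
by apply: measurable_tnth => //; exact: measurable_itv.
Qed.

End euclidean.
Arguments origin R m : clear implicits.
Arguments unit_cube R m : clear implicits.
Arguments measurable_unit_cube R m : clear implicits.

Section bessel.
Context (R : realType) (n : nat).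

(* The Fourier transform only determines g almost everywhere, whereas the
   potential of a singular measure depends on all values of g.  As usual g is
   the version that is continuous on R^n with values in [0, +oo]; its value at
   0 is +oo exactly when alpha <= n.  The Fourier integral is split into its
   real and imaginary parts. *)
Definition is_bessel_kernel (alpha : R) (g : 'cV[R]_n -> \bar R) : Prop :=
  [/\ continuous g,
      forall x, (0 <= g x)%E,
      (lebesgue_Rn R n).-integrable setT (g \o @colv R n),
      forall xi : 'cV[R]_n,
        (\int[lebesgue_Rn R n]_x ((cos (dotv (colv x) xi))%:E * g (colv x))
         = ((1 + enorm xi ^+ 2) `^ (- (alpha / 2)))%:E)%E &
      forall xi : 'cV[R]_n,
        (\int[lebesgue_Rn R n]_x ((sin (dotv (colv x) xi))%:E * g (colv x))
         = 0)%E].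

Definition potential (g : 'cV[R]_n -> \bar R) (mu : set (Rn R n) -> \bar R)
    (x : 'cV[R]_n) : \bar R :=
  (\int[mu]_y g (x - colv y)%R)%E.

Definition locally_hoelder (f : 'cV[R]_n -> \bar R) : Prop :=
  (forall x, f x \is a fin_num) /\
  exists2 gamma : R, 0 < gamma <= 1 &
    forall K : set 'cV[R]_n, compact K ->
      exists C : R, forall x y, K x -> K y ->
        `|fine (f x) - fine (f y)| <= C * enorm (x - y) `^ gamma.

End bessel.

Definition occupation_measure (R : realType) (k n : nat)
    (Y : Rn R k -> Rn R n) : set (Rn R n) -> \bar R :=
  fun B => lebesgue_Rn R k (unit_cube R k `&` Y @^-1` B).

Section random_field.
Context (R : realType) (d : measure_display) (Omega : measurableType d).
Variables (P : probability Omega R) (k n : nat).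
Implicit Type X : Rn R k -> Omega -> Rn R n.

(* normal_prob is not the Dirac mass when the standard deviation is 0, so the
   degenerate case is separate. *)
Definition centered_gaussian (Z : Omega -> R) : Prop :=
  measurable_fun setT Z /\
  exists s : R, forall A : set (measurableTypeR R), measurable A ->
    P (Z @^-1` A) = if s == 0 then \d_(0 : measurableTypeR R) A
                    else normal_prob 0 s A.

Definition centered_gaussian_field X : Prop :=
  forall (m : nat) (t : 'I_m -> Rn R k) (u : 'I_m -> 'cV[R]_n),
    (forall j, unit_cube R k (t j)) ->
    centered_gaussian (fun w => \sum_j dotv (u j) (colv (X (t j) w))).

Definition increment X (s t : Rn R k) (w : Omega) : 'cV[R]_n :=
  colv (X t w) - colv (X s w).

Definition increment_cov X (s t : Rn R k) : 'M[R]_n :=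
  \matrix_(i, j) fine (covariance P (fun w => increment X s t w i 0)
                                    (fun w => increment X s t w j 0)).

(* t_j, where t lists t_1, ..., t_l and t_0 = 0 *)
Definition time l (t : l.-tuple (Rn R k)) (j : nat) : Rn R k :=
  nth (origin R k) (origin R k :: t) j.

Definition in_subcube (eps : R) l (t : l.-tuple (Rn R k)) : Prop :=
  exists a : Rn R k,
    (forall i, 0 <= (tnth a i : R) /\ (tnth a i : R) + eps <= 1) /\
    (forall (j : 'I_l) i,
       (tnth a i : R) <= tnth (tnth t j) i <= (tnth a i : R) + eps).

Definition nearest_ordered l (t : l.-tuple (Rn R k)) : Prop :=
  forall i j, (1 <= i <= j)%N -> (j < l)%N ->
    enorm (colv (time t j.+1) - colv (time t j)) <=
    enorm (colv (time t j.+1) - colv (time t i)).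

(* Without eps <= 1 the cube [0,1]^k would have no subcube of side length eps
   and the condition would hold vacuously.  The indices of u and sigma are
   shifted: u j and sigma j stand for u_(j+1) and sigma_(j+1).  Two roots of the
   same invertible covariance differ by a right orthogonal factor, which can be
   absorbed in u, so all roots may be considered at once.  Since invmx is the
   identity on singular matrices, the invertibility of the roots is explicit. *)
Definition locally_nondeterministic X : Prop :=
  forall l : nat, (2 <= l)%N ->
    exists c eps : R, [/\ 0 < c, 0 < eps <= 1 &
      forall u : 'I_l -> 'cV[R]_n,
      {ae tuple_measure (lebesgue_Rn R k) l, forall t : l.-tuple (Rn R k),
        in_subcube eps t -> nearest_ordered t ->
        forall sigma : 'I_l -> 'M[R]_n,
          (forall j : 'I_l, sigma j *m (sigma j)^T =
                            increment_cov X (time t j) (time t j.+1)) ->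
          (forall j, sigma j \in unitmx) /\
          ((c * \sum_j enorm (u j) ^+ 2)%R%:E <=
           'V_P[fun w => (\sum_(j < l) dotv (u j)
                  (invmx (sigma j) *m
                   increment X (time t j) (time t j.+1) w))%R])%E}].

End random_field.

(* Main.v *)
Require Import Defs.
From HB Require Import structures.
From mathcomp Require Import all_boot all_order all_algebra all_fingroup.
From mathcomp Require Import all_classical all_reals all_analysis.
From mathcomp Require Import ess_sup_inf measurable_realfun.
From mathcomp Require Import ring lra zify.

(** The [m]-th moment of the time that [X + phi] spends in a box of radius [r]
    is the integral over [m] times of a Gaussian small-ball probability.  The
    times can be reordered so that each one has its predecessor as its nearest
    earlier point; local nondeterminism then bounds the probability by
    [r ^ q] times a power [- q / (2 n)] of the determinant for each increment
    but the first, where [q = min (n, n - alpha + 2 n delta)].  Markov's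
    inequality with a large [m] on dyadic grids gives, almost surely, the
    Frostman bound [mu (B (x, r)) <= C r ^ q1] locally uniformly in [x], for
    every [q1 < q].

    A Bessel kernel is identified with its mixture of heat kernels only after
    mollification by a Gaussian of width [e]; the bounds
    [g z <= K |z| ^ - p] and
    [g z <= g z' + K |z - z'| ^ gamma |z| ^ - p], with [p > n - alpha + gamma],
    are uniform in [e] and pass to the limit by continuity of [g].  Since
    [n - alpha < q], one can take [p < q1], and then integrating the second bound
    against the occupation measure gives the Hoelder estimate.

    Fourier integrals are computed with [1 + cos] in place of the complex
    exponential, so that all integrands are nonnegative. *)

Set Implicit Arguments.
Unset Strict Implicit.
Unset Printing Implicit Defensive.
Import Order.TTheory GRing.Theory Num.Theory.
Import numFieldNormedType.Exports.
Local Open Scope classical_set_scope.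
Local Open Scope ring_scope.

(** * Normal distributions *)

Section density.
Local Open Scope ereal_scope.
Context d (T : measurableType d) (R : realType).
Variables (mu nu : {measure set T -> \bar R}) (h : T -> R).
Hypothesis mh : measurable_fun setT h.
Hypothesis h0 : forall x, (0 <= h x)%R.
Hypothesis nuE : forall A, measurable A -> nu A = \int[mu]_(x in A) (h x)%:E.

Import HBNNSimple.

Lemma ge0_integral_density (f : T -> \bar R) : measurable_fun setT f ->
  (forall x, 0 <= f x) -> \int[nu]_x f x = \int[mu]_x (f x * (h x)%:E).
Proof.
move=> mf f0.
pose f_ := nnsfun_approx measurableT mf.
have ndf x : {homo (fun n => (f_ n x)%:E) : m n / (m <= n)%N >-> m <= n}.
  by move=> m n mn; rewrite lee_fin; exact/lefP/nd_nnsfun_approx.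
have cf x : (f_ n x)%:E @[n --> \oo] --> f x by apply: cvg_nnsfun_approx.
have -> : \int[nu]_x f x = limn (fun n => \int[nu]_x (f_ n x)%:E).
  rewrite -monotone_convergence//.
  - by apply: eq_integral => x _; apply/esym/cvg_lim => //; exact: cf.
  - by move=> n; exact/measurable_EFinP.
  - by move=> n x _; rewrite lee_fin.
have -> : \int[mu]_x (f x * (h x)%:E) =
    limn (fun n => \int[mu]_x ((f_ n x)%:E * (h x)%:E)).
  rewrite -monotone_convergence//.
  - apply: eq_integral => x _; apply/esym/cvg_lim => //.
    by apply: cvgeZr => //; exact: cf.
  - by move=> n; apply: emeasurable_funM; exact/measurable_EFinP.
  - by move=> n x _; rewrite mule_ge0// lee_fin.
  - by move=> x _ m n mn; rewrite lee_wpmul2r ?lee_fin//; exact/lefP/nd_nnsfun_approx.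
congr (limn _); apply/funext => n.
have mpre r : measurable (f_ n @^-1` [set r]) by [].
transitivity (\sum_(k \in range (f_ n)) \int[nu]_x (k * \1_(f_ n @^-1` [set k]) x)%:E).
  under eq_integral do rewrite fimfunE -fsumEFin//.
  rewrite ge0_integral_fsum//.
  - by move=> r; exact/measurable_EFinP/measurable_funM.
  - by move=> r x _; rewrite nnfun_muleindic_ge0.
transitivity (\sum_(k \in range (f_ n))
    \int[mu]_x ((k * \1_(f_ n @^-1` [set k]) x)%:E * (h x)%:E)); last first.
  rewrite -ge0_integral_fsum//.
  - apply: eq_integral => x _.
    rewrite [in RHS]fimfunE -fsumEFin// ge0_mule_fsuml//.
    by move=> k; rewrite nnfun_muleindic_ge0.
  - move=> r; apply: emeasurable_funM; last exact/measurable_EFinP.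
    by exact/measurable_EFinP/measurable_funM.
  - by move=> r x _; rewrite mule_ge0// ?lee_fin// -?lee_fin nnfun_muleindic_ge0.
apply: eq_fsbigr => r rf.
have r0 : (0 <= r)%R by move: rf; rewrite inE => -[x _ <-].
under eq_integral do rewrite EFinM.
rewrite ge0_integralZl//; last by exact/measurable_EFinP.
under [RHS]eq_integral do rewrite EFinM -muleA.
rewrite ge0_integralZl//; last 2 first.
  - by apply: emeasurable_funM; exact/measurable_EFinP.
  - by move=> x _; rewrite mule_ge0// lee_fin.
congr (_ * _).
rewrite integral_indic// setIT nuE// integral_mkcond/=.
apply: eq_integral => x _.
by rewrite patchE indicE; case: (x \in _); rewrite ?mul1e ?mul0e.
Qed.

End density.

Section gaussian_transform.
Context (R : realType).
Local Notation leb := (@lebesgue_measure R).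

Lemma integral_derivative_eq0 (f F w : R -> R) :
  continuous f -> (forall x, is_derive x (1 : R) F (f x)) ->
  leb.-integrable setT (EFin \o w) ->
  (forall x, `|f x| <= w x) ->
  F n%:R @[n --> \oo] --> (0 : R) -> F (- n%:R) @[n --> \oo] --> (0 : R) ->
  (\int[leb]_x (f x)%:E = 0)%E.
Proof.
move=> cf dF iw fw Fy FNy.
have mf : measurable_fun setT f by exact: continuous_measurable_fun.
pose f_ n x := (f x * \1_(`[(- n%:R), (n%:R)]%classic : set R) x)%:E.
have mf_ n : measurable_fun setT (f_ n).
  by apply/measurable_EFinP; apply: measurable_funM => //; exact: measurable_indic.
have cvf : {ae leb, forall x, setT x -> f_ ^~ x @ \oo --> (EFin \o f) x}.
  apply: aeW => x _; apply: cvg_near_cst; near=> n.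
  rewrite /f_ indicE mem_set ?mulr1//= in_itv/= -ler_norml.
  by near: n; exact: nbhs_infty_ger.
have domf : {ae leb, forall x n, setT x -> (`|f_ n x| <= (EFin \o w) x)%E}.
  apply: aeW => x n _; rewrite /f_ lee_fin indicE.
  case: (x \in _); rewrite ?mulr1 ?mulr0 ?normr0 ?fw//.
  by rewrite (le_trans _ (fw x)).
have [_ _ H] := @dominated_convergence _ _ _ leb setT measurableT f_ (EFin \o f) (EFin \o w) mf_
  ((proj2 (measurable_EFinP _ _)) mf) cvf iw domf.
apply: cvg_unique H _ => //.
have Fn : forall n, (0 < n)%N -> (\int[leb]_x f_ n x = (F n%:R - F (- n%:R))%:E)%E.
  move=> n n0; rewrite EFinB.
  rewrite -(@continuous_FTC2 R f F (- n%:R) n%:R); first last.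
  - by move=> x _; rewrite derive1E; exact: (@derive_val _ _ _ _ _ _ _ (dF x)).
  - have cF : continuous F.
      move=> x; apply/differentiable_continuous/derivable1_diffP.
      by have := dF x => -[].
    split.
    + by move=> x _; have := dF x => -[].
    + exact/cvg_at_right_filter/cF.
    + exact/cvg_at_left_filter/cF.
  - exact: continuous_subspaceT.
  - have h : 0 < n%:R :> R by rewrite ltr0n.
    by lra.
  rewrite [RHS]integral_mkcond; apply: eq_integral => x _.
  by rewrite /f_ patchE indicE; case: (x \in _); rewrite ?mulr1 ?mulr0.
apply: cvg_trans (_ : (F n%:R - F (- n%:R))%:E @[n --> \oo] --> 0%E).
  apply: near_eq_cvg; near=> n; rewrite /= Fn//.
  by near: n; exact: nbhs_infty_gt.
apply: cvg_EFin; first exact: nearW.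
by rewrite -[X in _ --> X]subr0; apply: cvgB.
Unshelve. all: by end_near. Qed.

Section normal_transform.
Variable s : R.
Hypothesis s0 : s != 0.
Local Notation p := (normal_pdf 0 s).
Local Notation w := (normal_pdf 0 (2 * s)).

Let s2 : 2 * s != 0. Proof. by rewrite mulf_neq0// pnatr_eq0. Qed.
Let ss0 : 0 < s ^+ 2. Proof. by rewrite exprn_even_gt0. Qed.

Lemma normal_pdf0E (t x : R) : t != 0 ->
  normal_pdf 0 t x = normal_peak t * expR (- x ^+ 2 / (2 * t ^+ 2)).
Proof.
by move=> t0; rewrite normal_pdfE// /normal_fun subr0 -[_ *+ 2]mulr_natl.
Qed.

Lemma is_derive_normal_pdf x : is_derive x (1 : R) p (- (x / s ^+ 2) * p x).
Proof.
have -> : p = (fun x => normal_peak s * expR (- (2 * s ^+ 2)^-1 * x ^+ 2)).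
  by apply/funext => y; rewrite normal_pdf0E//; congr (_ * expR _); ring.
apply: is_derive_eq.
rewrite -[LHS]/(normal_peak s * (expR (- (2 * s ^+ 2)^-1 * x ^+ 2) * _)) /=.
rewrite /GRing.scale/=.
have := ss0; set e := expR _; move=> h.
field.
by rewrite s0.
Qed.

Lemma sqr_normal_pdf_le : exists2 K : R, 0 <= K &
  forall x, (1 + x ^+ 2) * p x <= K * w x.
Proof.
exists ((1 + 8 * s ^+ 2 / 3) * (normal_peak s / normal_peak (2 * s))).
  rewrite mulr_ge0// ?divr_ge0 ?normal_peak_ge0//.
  by have := ltW ss0; lra.
move=> x; rewrite !normal_pdf0E//.
have pk : normal_peak (2 * s) != 0 by rewrite gt_eqF// normal_peak_gt0.
set E2 := expR (- x ^+ 2 / (2 * (2 * s) ^+ 2)).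
have -> : expR (- x ^+ 2 / (2 * s ^+ 2)) = E2 * expR (- (3 * x ^+ 2 / (8 * s ^+ 2))).
  by rewrite -expRD; congr expR; field.
have E20 : 0 <= E2 by exact: expR_ge0.
set y := 3 * x ^+ 2 / (8 * s ^+ 2).
have y0 : 0 <= y by rewrite /y divr_ge0// mulr_ge0// sqr_ge0.
rewrite -mulrA [leRHS](_ : _ = (1 + 8 * s ^+ 2 / 3) * (normal_peak s * E2)); last first.
  by field.
rewrite [leLHS](_ : _ = ((1 + x ^+ 2) * expR (- y)) * (normal_peak s * E2)); last by ring.
rewrite ler_wpM2r ?mulr_ge0 ?normal_peak_ge0//.
rewrite expRN ler_pdivrMr ?expR_gt0//.
apply: (@le_trans _ _ ((1 + 8 * s ^+ 2 / 3) * (1 + y))); last first.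
  rewrite ler_wpM2l ?expR_ge1Dx//.
  by have := ltW ss0; lra.
have -> : x ^+ 2 = 8 * s ^+ 2 / 3 * y by rewrite /y; field.
have : 0 <= 8 * s ^+ 2 / 3 by have := ltW ss0; lra.
by move: (8 * s ^+ 2 / 3) => a a0; nra.
Qed.

Let expRN_le (y : R) : 0 <= y -> expR (- y) <= (1 + y)^-1.
Proof.
move=> y0; rewrite expRN lef_pV2 ?posrE ?expR_gt0//; last by lra.
exact: expR_ge1Dx.
Qed.

Lemma cvg_normal_pdf : w n%:R @[n --> \oo] --> (0 : R).
Proof.
pose a := 8 * s ^+ 2.
have a0 : 0 < a by rewrite /a; have := ss0; lra.
have h n : 0 <= w n%:R <= (normal_peak (2 * s) * (2 * (a + 1))) * n.+1%:R^-1.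
  rewrite normal_pdf_ge0/= normal_pdf0E// -mulrA ler_wpM2l ?normal_peak_ge0//.
  have -> : - n%:R ^+ 2 / (2 * (2 * s) ^+ 2) = - (n%:R ^+ 2 / a).
    by rewrite /a; field.
  apply: (le_trans (expRN_le _)); first by rewrite divr_ge0 ?sqr_ge0// ltW.
  rewrite -natr1; set N := n%:R; have N0 : 0 <= N by rewrite ler0n.
  rewrite ler_pdivlMr; last by lra.
  rewrite mulrC ler_pdivrMr; last first.
    by rewrite ltr_pwDl// divr_ge0 ?sqr_ge0// ltW.
  have -> : 2 * (a + 1) * (1 + N ^+ 2 / a) = 2 * (a + 1 + N ^+ 2 + N ^+ 2 / a).
    by field; rewrite gt_eqF.
  have : 0 <= N ^+ 2 / a by rewrite divr_ge0 ?sqr_ge0// ltW.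
  by nra.
apply: (@squeeze_cvgr _ _ _ _ (fun=> 0)).
- by apply: nearW => n; exact: h.
- exact: cvg_cst.
- rewrite -[X in _ --> X](mulr0 (normal_peak (2 * s) * (2 * (a + 1)))).
  apply: cvgM; first exact: cvg_cst.
  exact: cvg_harmonic.
Qed.

Lemma normal_pdfN (x : R) : w (- x) = w x.
Proof. by rewrite !normal_pdf0E// sqrrN. Qed.

(* The derivative [h' - x h / s^2] of [h] times the density integrates to 0. *)
Lemma gaussian_integration_by_parts (h h' : R -> R) (C : R) :
  (forall x, is_derive x (1 : R) h (h' x)) -> continuous h' ->
  (forall x, `|h x| <= C * (1 + `|x|)) -> (forall x, `|h' x| <= C) ->
  (\int[leb]_x (h' x * p x - x * h x * p x / s ^+ 2)%:E = 0)%E.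
Proof.
move=> dh ch' hC h'C.
have C0 : 0 <= C by rewrite (le_trans _ (h'C 0)).
have [K K0 Kp] := sqr_normal_pdf_le.
pose L := 2 * C * (1 + (s ^+ 2)^-1) * K.
have x1 x : 1 + `|x| <= 2 * (1 + x ^+ 2) :> R.
  by rewrite -(real_normK (num_real x)); have := normr_ge0 x; nra.
have x2 x : `|x| * (1 + `|x|) <= 2 * (1 + x ^+ 2) :> R.
  by rewrite -(real_normK (num_real x)); have := normr_ge0 x; nra.
have ch : continuous h.
  move=> x; apply/differentiable_continuous/derivable1_diffP.
  by have := dh x => -[].
have p0 x : 0 <= p x by exact: normal_pdf_ge0.
have hp x : `|h x * p x| <= L * w x.
  rewrite normrM (ger0_norm (p0 x)).
  apply: (@le_trans _ _ (2 * C * ((1 + x ^+ 2) * p x))).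
    rewrite mulrA ler_wpM2r// (le_trans (hC x))// mulrAC mulrC -mulrA mulrCA.
    by rewrite [leRHS](_ : _ = 2 * (1 + x ^+ 2) * C) ?ler_wpM2r//; ring.
  rewrite -[leRHS](mulrA) /L -!mulrA 2?(mulrA 2) ler_wpM2l ?mulr_ge0//.
  rewrite (le_trans (Kp x))// ler_peMl// ?mulr_ge0// ?normal_pdf_ge0//.
  by rewrite lerDl invr_ge0 ltW.
have hz : L * w n%:R @[n --> \oo] --> (0 : R).
  by rewrite -[X in _ --> X](mulr0 L); apply: cvgM; [exact: cvg_cst|exact: cvg_normal_pdf].
apply: (@integral_derivative_eq0 _ (fun x => h x * p x) (fun x => L * w x)).
- move=> x; apply: cvgB; first apply: cvgM; first exact: ch'.
  + exact: continuous_normal_pdf.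
  + apply: cvgM; last exact: cvg_cst.
    apply: cvgM; last exact: continuous_normal_pdf.
    by apply: cvgM; [exact: cvg_id|exact: ch].
- move=> x; have dp := is_derive_normal_pdf x; have dhx := dh x.
  apply: is_derive_eq; rewrite /GRing.scale/=; ring.
- rewrite [X in _.-integrable _ X](_ : _ = fun x => (L%:E * (w x)%:E)%E).
    by apply: integrableZl => //; exact: integrable_normal_pdf.
  by apply/funext => x /=; rewrite EFinM.
- move=> x; rewrite (le_trans (ler_normB _ _))// !normrM (ger0_norm (p0 x)).
  rewrite normrV ?unitfE ?gt_eqF// (ger0_norm (ltW ss0)).
  apply: (@le_trans _ _ (2 * C * (1 + (s ^+ 2)^-1) * ((1 + x ^+ 2) * p x))).
    rewrite mulrDr mulrDl mulr1; apply: lerD.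
      rewrite mulrA ler_wpM2r// (le_trans (h'C x))//.
      have := sqr_ge0 x; nra.
    rewrite [leLHS](_ : _ = `|x| * `|h x| * (p x / s ^+ 2)); last by ring.
    rewrite [leRHS](_ : _ = 2 * C * (1 + x ^+ 2) * (p x / s ^+ 2)); last by ring.
    rewrite ler_wpM2r ?divr_ge0 ?(ltW ss0)//.
    rewrite (le_trans (ler_wpM2l (normr_ge0 x) (hC x)))// mulrCA.
    by rewrite [leRHS](_ : _ = C * (2 * (1 + x ^+ 2))) ?ler_wpM2l//; ring.
  rewrite /L -[leRHS]mulrA ler_wpM2l// mulr_ge0// ?mulr_ge0//.
  by rewrite addr_ge0// invr_ge0 ltW.
- apply: norm_cvg0; apply: (squeeze_cvgr _ (cvg_cst 0) hz).
  by apply: nearW => n /=; rewrite normr_ge0 hp.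
- apply: norm_cvg0; apply: (squeeze_cvgr _ (cvg_cst 0) hz).
  by apply: nearW => n /=; rewrite normr_ge0 -normal_pdfN hp.
Qed.

Lemma integral_sqr_normal_pdf :
  (\int[leb]_x (x ^+ 2 * p x)%:E = (s ^+ 2)%:E)%E.
Proof.
have ip := integrable_normal_pdf 0 s.
have mx2 : measurable_fun setT (fun x : R => x ^+ 2 * p x).
  by apply: measurable_funM; [exact: exprn_measurable|exact: measurable_normal_pdf].
have ix : leb.-integrable setT (fun x => (x ^+ 2 * p x)%:E).
  have [K K0 Kp] := sqr_normal_pdf_le.
  apply: (@le_integrable _ _ _ leb _ _ _ (fun x => (K%:E * (w x)%:E)%E)) => //.
  - exact/measurable_EFinP.
  - move=> x _; have p0 := normal_pdf_ge0 0 s x; have w0 := normal_pdf_ge0 0 (2 * s) x.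
    rewrite lee_fin ger0_norm ?(mulr_ge0 (sqr_ge0 x))// ger0_norm; last exact: mulr_ge0.
    apply: le_trans (Kp x); rewrite ler_wpM2r ?normal_pdf_ge0//; lra.
  - by apply: integrableZl => //; exact: integrable_normal_pdf.
have := @gaussian_integration_by_parts id (fun=> 1) 1.
move=> /(_ _ _ _ _)/wrap[].
- by move=> x; exact: cvg_cst.
- by move=> x; lra.
- by move=> x; rewrite normr1.
under eq_integral => x _ do
  rewrite mul1r -expr2 EFinB (mulrC (_ * _)) (EFinM (s ^+ 2)^-1).
rewrite integralB//; last exact: integrableZl.
rewrite integralZl// integral_normal_pdf => /eqP.
have : (\int[leb]_x (x ^+ 2 * p x)%:E)%E \is a fin_num by exact: integrable_fin_num.
case: (\int[leb]_x (x ^+ 2 * p x)%:E)%E => //= r _.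
rewrite -[1%E]/(1%:E)%E -EFinD eqe subr_eq0 => /eqP h; congr EFin.
by rewrite -[RHS]mulr1 h mulVKf// expf_neq0.
Qed.

Let bounded_integrable (f : R -> R) (C : R) : measurable_fun setT f ->
  (forall x, `|f x| <= C * (1 + x ^+ 2)) ->
  leb.-integrable setT (fun x => (f x * p x)%:E).
Proof.
move=> mf fC; have [K K0 Kp] := sqr_normal_pdf_le.
have C0 : 0 <= C.
  by have := fC 0; rewrite expr0n/= addr0 mulr1; exact: le_trans.
apply: (@le_integrable _ _ _ leb _ _ _ (fun x => ((C * K)%:E * (w x)%:E)%E)) => //.
- apply/measurable_EFinP; apply: measurable_funM => //.
  exact: measurable_normal_pdf.
- move=> x _; have p0 := normal_pdf_ge0 0 s x; have w0 := normal_pdf_ge0 0 (2 * s) x.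
  rewrite -EFinM /= lee_fin normrM (ger0_norm p0) (ger0_norm (mulr_ge0 (mulr_ge0 C0 K0) w0)).
  apply: (le_trans (ler_wpM2r p0 (fC x))).
  by rewrite -!mulrA ler_wpM2l.
- by apply: integrableZl => //; exact: integrable_normal_pdf.
Qed.

Let mcos (a b : R) : measurable_fun setT (fun x : R => cos (a * x + b)).
Proof.
apply: continuous_measurable_fun => x.
apply: (cvg_comp (fun x => a * x + b) cos); last exact: continuous_cos.
by apply: cvgD; [apply: cvgM; [exact: cvg_cst|exact: cvg_id]|exact: cvg_cst].
Qed.

Let mxsin (a b : R) : measurable_fun setT (fun x : R => - x * sin (a * x + b)).
Proof.
apply: continuous_measurable_fun => x.
apply: cvgM; first by apply: cvgN; exact: cvg_id.
apply: (cvg_comp (fun x => a * x + b) sin); last exact: continuous_sin.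
by apply: cvgD; [apply: cvgM; [exact: cvg_cst|exact: cvg_id]|exact: cvg_cst].
Qed.

Lemma Rintegral_cos_normal_pdf (y b : R) :
  \int[leb]_x (cos (y * x + b) * p x) = cos b * expR (- (s * y) ^+ 2 / 2).
Proof.
pose f y x := cos (y * x + b) * p x.
pose F y := \int[leb]_x f y x.
have fint z : leb.-integrable setT (EFin \o f z).
  apply: (@bounded_integrable _ 1) => // x.
  by rewrite mul1r (le_trans (cos_max _))// lerDl sqr_ge0.
have sint z : leb.-integrable setT (fun x => (- x * sin (z * x + b) * p x)%:E).
  apply: (@bounded_integrable _ 1) => // x.
  rewrite mul1r normrM normrN (le_trans (ler_wpM2l (normr_ge0 _) (sin_max _)))//.
  by rewrite mulr1 -(real_normK (num_real x)); have := normr_ge0 x; nra.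
have d1f z x : is_derive z (1 : R) (f ^~ x) (- x * sin (z * x + b) * p x).
  apply: is_derive_eq; rewrite /GRing.scale/=; ring.
have dF z : is_derive z (1 : R) F (- (s ^+ 2 * z) * F z).
  have zI : (`]z - 1, z + 1[%classic : set R) z by rewrite /= in_itv/=; apply/andP; split; lra.
  have gint : leb.-integrable setT (EFin \o (fun x => `|x| * p x)).
    apply: (@bounded_integrable _ 1) => //.
    move=> x; rewrite mul1r normr_id.
    by rewrite -(real_normK (num_real x)); have := normr_ge0 x; nra.
  have g0 x : 0 <= `|x| * p x by rewrite mulr_ge0// normal_pdf_ge0.
  have H1 u v : derivable (f ^~ v) u 1 by have := d1f u v => -[].
  have d1E u v : partial1of2 f u v = - v * sin (u * v + b) * p v.
    by rewrite partial1of2E; apply: derive_val.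
  have H2 u v : `|partial1of2 f u v| <= `|v| * p v.
    rewrite d1E !normrM normrN (ger0_norm (normal_pdf_ge0 0 s v)).
    rewrite ler_wpM2r ?normal_pdf_ge0// ler_piMr//; exact: sin_max.
  have dd := @derivable_under_integral R _ _ leb f setT measurableT z (z - 1) (z + 1) zI
    (fun x _ => fint x) (fun x y _ _ => H1 x y) _ g0 gint (fun x y _ _ => H2 x y).
  have de := @differentiation_under_integral R _ _ leb f setT measurableT z (z - 1) (z + 1) zI
    (fun x _ => fint x) (fun x y _ _ => H1 x y) _ g0 gint (fun x y _ _ => H2 x y).
  apply: DeriveDef => //; rewrite -derive1E de.
  under eq_Rintegral do rewrite d1E.
  have := @gaussian_integration_by_parts (fun x => sin (z * x + b))
    (fun x => z * cos (z * x + b)) (1 + `|z|).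
  move=> /(_ _ _ _ _)/wrap[].
  - by move=> x; apply: is_derive_eq; rewrite /GRing.scale/=; ring.
  - move=> x; apply: cvgM; first exact: cvg_cst.
    apply: (cvg_comp (fun x => z * x + b) cos); last exact: continuous_cos.
    by apply: cvgD; [apply: cvgM; [exact: cvg_cst|exact: cvg_id]|exact: cvg_cst].
  - move=> x; rewrite (le_trans (sin_max _))//.
    by have := normr_ge0 x; have := normr_ge0 z; nra.
  - move=> x; rewrite normrM (le_trans (ler_wpM2l (normr_ge0 _) (cos_max _)))//.
    by rewrite mulr1 lerDr.
  under eq_integral => x _.
    rewrite (_ : _ - _ = z * f z x + (s ^+ 2)^-1 * (- x * sin (z * x + b) * p x)); last first.
      by rewrite /f; ring.
    rewrite EFinD (EFinM z) (EFinM (s ^+ 2)^-1).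
    over.
  rewrite integralD//; [|apply: integrableZl => //; exact: fint|apply: integrableZl => //; exact: sint].
  rewrite (integralZl measurableT (fint z)).
  rewrite (integralZl measurableT (sint z)).
  rewrite /F /Rintegral.
  have := integrable_fin_num measurableT (fint z).
  have := integrable_fin_num measurableT (sint z).
  rewrite /comp.
  case: (\int[leb]_x (f z x)%:E)%E => // r1; case: (\int[leb]_x (- x * _ * _)%:E)%E => // r2 _ _.
  rewrite -!EFinM -EFinD => -[h] /=.
  have -> : r2 = s ^+ 2 * (z * r1 + s ^- 2 * r2) - s ^+ 2 * z * r1 by field.
  by rewrite h mulr0 add0r mulNr.
pose G z := F z * expR ((s ^+ 2 / 2) * z ^+ 2).
have dG z : is_derive z (1 : R) G 0.
  by have dFz := dF z; apply: is_derive_eq; rewrite /GRing.scale/=; field.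
have : G y = G 0 by apply: is_derive_0_is_cst.
rewrite /G expr0n/= mulr0 expR0 mulr1 => h.
have -> : cos b = F 0.
  rewrite /F /f.
  under eq_Rintegral do rewrite mul0r add0r.
  rewrite RintegralZl//; last exact: integrable_normal_pdf.
  by rewrite /Rintegral integral_normal_pdf/= mulr1.
rewrite -[LHS]/(F y) -h -(mulrA (F y)) -expRD [X in expR X](_ : _ = 0) ?expR0 ?mulr1//.
by field.
Qed.

Lemma integral_1cos_normal_prob (y b : R) :
  (\int[normal_prob 0 s]_x (1 + cos (y * x + b))%:E =
   (1 + cos b * expR (- (s * y) ^+ 2 / 2))%:E)%E.
Proof.
rewrite (@ge0_integral_density _ _ _ leb _ p); first last.
- by move=> x; rewrite lee_fin -lerBlDl sub0r; have /ler_normlP[] := cos_max (y * x + b); rewrite lerNl.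
- by apply/measurable_EFinP; apply: measurable_funD => //; exact: mcos.
- by [].
- by move=> x; exact: normal_pdf_ge0.
- exact: measurable_normal_pdf.
have ci : leb.-integrable setT (fun x => (cos (y * x + b) * p x)%:E).
  apply: (@bounded_integrable _ 1) => // x.
  by rewrite mul1r (le_trans (cos_max _))// lerDl sqr_ge0.
under eq_integral do rewrite -EFinM mulrDl mul1r EFinD.
rewrite integralD//; last exact: integrable_normal_pdf.
rewrite integral_normal_pdf EFinD -Rintegral_cos_normal_pdf /Rintegral fineK//.
exact: integrable_fin_num.
Qed.

Lemma integral_sqr_normal_prob :
  (\int[normal_prob 0 s]_x (x ^+ 2)%:E = (s ^+ 2)%:E)%E.
Proof.
rewrite (@ge0_integral_density _ _ _ leb _ p).
- by under eq_integral do rewrite -EFinM; exact: integral_sqr_normal_pdf.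
- exact: measurable_normal_pdf.
- by move=> x; exact: normal_pdf_ge0.
- by [].
- by apply/measurable_EFinP; exact: exprn_measurable.
- by move=> x; rewrite lee_fin sqr_ge0.
Qed.

End normal_transform.

End gaussian_transform.

(** * Product measures on tuples *)

Section tuple_measure_theory.
Local Open Scope ereal_scope.
Context d (T : measurableType d) (R : realType).
Variable mu : {sigma_finite_measure set T -> \bar R}.
Local Notation tm := (tuple_measure mu).

Lemma ge0_integral_tuple0 (f : 0.-tuple T -> \bar R) :
  measurable_fun setT f -> \int[tm 0]_t f t = f [tuple].
Proof. by move=> mf; rewrite /= integral_dirac// diracT mul1e. Qed.

Lemma measurable_consr n : measurable_fun setT
  (fun p : T * n.-tuple T => [tuple of p.1 :: p.2]).
Proof. exact: (measurable_cons measurable_fst measurable_snd). Qed.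

Lemma measurable_cons_fixed n x : measurable_fun setT
  (fun t : n.-tuple T => [tuple of x :: t]).
Proof. exact: (measurable_cons (measurable_cst x) (@measurable_id _ _ setT)). Qed.

Section cons.
Variables (n : nat) (f : n.+1.-tuple T -> \bar R).
Hypothesis mf : measurable_fun setT f.
Hypothesis f0 : forall t, 0 <= f t.

Let g (p : T * n.-tuple T) := f [tuple of p.1 :: p.2].

Let mg : measurable_fun setT g.
Proof. exact: (measurableT_comp mf (@measurable_consr n)). Qed.

Let g0 p : 0 <= g p. Proof. exact: f0. Qed.

Let tmS : \int[tm n.+1]_t f t = \int[mu \x tm n]_p g p.
Proof.
have := @ge0_integral_pushforward _ _ _ _ R (@tuple_of_pair _ T n)
  (@measurable_tuple_of_pair _ T n) (mu \x tm n) setT f measurableT mf.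
by move=> /(_ (fun y _ => f0 y)).
Qed.

Lemma ge0_integral_tupleS :
  \int[tm n.+1]_t f t = \int[mu]_x \int[tm n]_t f [tuple of x :: t].
Proof. by rewrite tmS fubini_tonelli1. Qed.

Lemma ge0_integral_tupleSr :
  \int[tm n.+1]_t f t = \int[tm n]_t \int[mu]_x f [tuple of x :: t].
Proof. by rewrite tmS fubini_tonelli2. Qed.

Lemma measurable_integral_tuple_behead :
  measurable_fun setT (fun x => \int[tm n]_t f [tuple of x :: t]).
Proof. exact: (@measurable_fun_fubini_tonelli_F _ _ _ _ _ (tm n) g mg g0). Qed.

Lemma measurable_integral_tuple_head :
  measurable_fun setT (fun t : n.-tuple T => \int[mu]_x f [tuple of x :: t]).
Proof. exact: (@measurable_fun_fubini_tonelli_G _ _ _ _ _ mu g mg g0). Qed.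

End cons.

Lemma emeasurable_prod d' (U : measurableType d') n (f : 'I_n -> U -> \bar R) :
  (forall i, measurable_fun setT (f i)) ->
  measurable_fun setT (fun x => \big[mule/1]_(i < n) f i x).
Proof.
elim: n f => [|n IH] f mf.
  by under eq_fun do rewrite big_ord0; exact: measurable_cst.
under eq_fun do rewrite big_ord_recl.
by apply: emeasurable_funM => //; exact: IH.
Qed.

Lemma prode_ge0 (I : Type) (r : seq I) (Q : pred I) (f : I -> \bar R) :
  (forall i, Q i -> 0 <= f i) -> 0 <= \big[mule/1]_(i <- r | Q i) f i.
Proof. by move=> f0; elim/big_ind : _ => //; exact: mule_ge0. Qed.

Lemma ge0_integral_tuple_prod n (f : 'I_n -> T -> \bar R) :
  (forall i, measurable_fun setT (f i)) -> (forall i x, 0 <= f i x) ->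
  \int[tm n]_t \big[mule/1]_(i < n) f i (tnth t i) =
  \big[mule/1]_(i < n) \int[mu]_x f i x.
Proof.
elim: n f => [|n IH] f mf f0.
  rewrite ge0_integral_tuple0; first by rewrite !big_ord0.
  by apply: (@emeasurable_prod _ (0.-tuple T) 0 (fun i t => f i (tnth t i))) => -[].
have mft i : measurable_fun setT (fun t : n.+1.-tuple T => f i (tnth t i)).
  exact: (measurableT_comp (mf i) (measurable_tnth i)).
rewrite ge0_integral_tupleS; last 2 first.
- exact: (@emeasurable_prod _ _ n.+1 (fun i t => f i (tnth t i))).
- by move=> t; apply: prode_ge0.
have E x : \int[tm n]_t \big[mule/1]_(i < n.+1) f i (tnth [tuple of x :: t] i) =
    f ord0 x * \big[mule/1]_(i < n) \int[mu]_x f (lift ord0 i) x.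
  under eq_integral do rewrite big_ord_recl tnth0.
  rewrite ge0_integralZl//; last 2 first.
  - under eq_fun do under eq_bigr do rewrite tnthS.
    apply: (@emeasurable_prod _ _ n (fun i t => f (lift ord0 i) (tnth t i))) => i.
    exact: (measurableT_comp (mf _) (measurable_tnth i)).
  - by move=> t _; apply: prode_ge0.
  under eq_integral do under eq_bigr do rewrite tnthS.
  by rewrite (IH (fun i => f (lift ord0 i))).
under eq_integral do rewrite E.
rewrite ge0_integralZr//; first by rewrite big_ord_recl.
by apply: prode_ge0 => i _; apply: integral_ge0.
Qed.

Lemma prodEFin (I : Type) (r : seq I) (Q : pred I) (f : I -> R) :
  \big[mule/1]_(i <- r | Q i) (f i)%:E = (\prod_(i <- r | Q i) f i)%:E.
Proof. by rewrite (big_morph EFin EFinM erefl). Qed.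

Lemma ge0_integral_tuple_prodR n (f : 'I_n -> T -> R) (c : 'I_n -> R) :
  (forall i, measurable_fun setT (f i)) -> (forall i x, (0 <= f i x)%R) ->
  (forall i, \int[mu]_x (f i x)%:E = (c i)%:E) ->
  \int[tm n]_t (\prod_(i < n) f i (tnth t i))%:E = (\prod_(i < n) c i)%:E.
Proof.
move=> mf f0 fc; under eq_integral do rewrite -prodEFin.
rewrite (@ge0_integral_tuple_prod n (fun i x => (f i x)%:E)).
- by rewrite -prodEFin; apply: eq_bigr => i _; rewrite fc.
- by move=> i; exact/measurable_EFinP.
- by move=> i x; rewrite lee_fin.
Qed.

Definition rectangle n (A : 'I_n -> set T) : set (n.-tuple T) :=
  [set t | forall i, A i (tnth t i)].

Lemma measurable_rectangle n (A : 'I_n -> set T) :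
  (forall i, measurable (A i)) -> measurable (rectangle A).
Proof.
move=> mA; have -> : rectangle A = \bigcap_i ((fun t => tnth t i) @^-1` A i).
  by apply/seteqP; split=> t /= h i; [move=> _; exact: h|exact: (h i I)].
apply: fin_bigcap_measurable => [|i _]; first exact: finite_finset.
rewrite -[X in measurable X]setTI.
exact: measurable_tnth.
Qed.

Lemma tuple_measure_rectangle n (A : 'I_n -> set T) :
  (forall i, measurable (A i)) ->
  tm n (rectangle A) = \big[mule/1]_(i < n) mu (A i).
Proof.
move=> mA; rewrite -[LHS]mul1e -(setIT (rectangle A)) -integral_cst; last first.
  by rewrite setIT; exact: measurable_rectangle.
rewrite setIT integral_mkcond.
rewrite (eq_integral (fun t => \big[mule/1]_(i < n) ((\1_(A i) (tnth t i))%:E : \bar R))).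
  rewrite (@ge0_integral_tuple_prod n (fun i x => (\1_(A i) x)%:E)).
  - by apply: eq_bigr => i _; rewrite integral_indic// setIT.
  - by move=> i; exact/measurable_EFinP.
  - by move=> i x; rewrite lee_fin.
move=> t _; rewrite patchE; case: ifPn => [/set_mem tA|tA].
  by rewrite big1// => i _; rewrite indicE mem_set//; exact: tA.
have [i] : exists i, ~ A i (tnth t i).
  by apply/existsNP => h; move: tA; rewrite mem_set.
move=> tAi; rewrite (bigD1 i)//= indicE memNset// mul0e//.
Qed.

Definition permute n (s : 'S_n) (t : n.-tuple T) : n.-tuple T :=
  [tuple tnth t (s i) | i < n].

Lemma measurable_permute n (s : 'S_n) : measurable_fun setT (permute s).
Proof.
apply/measurable_fun_tnthP => i.
rewrite (_ : _ \o _ = fun t => tnth t (s i)); last first.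
  by apply/funext => t /=; rewrite tnth_mktuple.
exact: measurable_tnth.
Qed.

Lemma sigma_finite_rectangles n : exists2 g : nat -> 'I_n -> set T,
  (forall k i, measurable (g k i) /\ mu (g k i) < +oo) &
  \bigcup_k rectangle (g k) = setT.
Proof.
have /sigma_finiteP[F [TF ndF Foo]] := sigma_finiteT mu.
exists (fun k _ => F k) => //.
rewrite -subTset => t _.
have h i : exists k, F k (tnth t i).
  have : setT (tnth t i) by [].
  by rewrite TF => -[k _ ?]; exists k.
have [K hK] := choice h.
exists (\max_i K i)%N => // i.
by move: (hK i); apply/subsetPset/ndF/leq_bigmax.
Qed.

Let rects n : set (set (n.-tuple T)) :=
  [set B | exists2 A : 'I_n -> set T, (forall i, measurable (A i)) & B = rectangle A].

Let measurable_rects n : (@measurable _ (n.-tuple T)) = <<s @rects n >>.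
Proof.
apply/seteqP; split; last first.
  apply: smallest_sub; first exact: sigma_algebra_measurable.
  by move=> _ [A mA ->]; exact: measurable_rectangle.
apply: smallest_sub; first exact: smallest_sigma_algebra.
case: n => [|n]; first by rewrite big_ord0.
rewrite -bigcup_mkord_ord; apply: bigcup_sub => i Ii.
move=> _ [B mB <-]; rewrite setTI; apply: sub_sigma_algebra.
exists (fun j => if j == inord i then B else setT) => [j|]; first by case: ifP.
apply/seteqP; split=> t /=; first by move=> h j; case: eqP => [->|].
by move=> /(_ (inord i)); rewrite eqxx.
Qed.

Lemma permute_rectangle n (s : 'S_n) (A : 'I_n -> set T) :
  permute s @^-1` rectangle A = rectangle (fun i => A ((s^-1)%g i)).
Proof.
apply/seteqP; split=> t /= h i.
  by have := h ((s^-1)%g i); rewrite tnth_mktuple permKV.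
by rewrite tnth_mktuple; have := h (s i); rewrite permK.
Qed.

Lemma pushforward_permute n (s : 'S_n) A : measurable A ->
  pushforward (tm n) (permute s) A = tm n A.
Proof.
have [g goo gT] := sigma_finite_rectangles n.
pose m := measure_function_pushforward__canonical__measure_function_Measure
  (tm n) (@measurable_permute n s).
have E B : rects B -> m B = tm n B.
  move=> [C mC ->]; rewrite /m /= /pushforward permute_rectangle.
  rewrite !tuple_measure_rectangle//.
  rewrite (reindex_inj (@perm_inj _ s))/=.
  by apply: eq_bigr => i _; rewrite permK.
apply: (@measure_unique _ R _ (@rects n) (fun k => rectangle (g k)) (@measurable_rects n)
  _ _ gT m (tm n)) => //.
- move=> _ _ [B mB ->] [C mC ->]; exists (fun i => B i `&` C i).
    by move=> i; exact: measurableI.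
  by apply/seteqP; split=> t /= => [[h1 h2] i|h]; split=> // i; have [] := h i.
- by move=> k; exists (g k) => // i; have [] := goo k i.
- move=> k; rewrite E; last by exists (g k) => // i; have [] := goo k i.
  rewrite tuple_measure_rectangle; last by move=> i; have [] := goo k i.
  rewrite (eq_bigr (fun i => (fine (mu (g k i)))%:E)); first by rewrite prodEFin ltry.
  by move=> i _; rewrite fineK// ge0_fin_numE//; have [] := goo k i.
Qed.

Lemma ge0_integral_permute n (s : 'S_n) (f : n.-tuple T -> \bar R) :
  measurable_fun setT f -> (forall t, 0 <= f t) ->
  \int[tm n]_t f (permute s t) = \int[tm n]_t f t.
Proof.
move=> mf f0.
have := @ge0_integral_pushforward _ _ _ _ R (permute s)
  (@measurable_permute n s) (tm n) setT f measurableT mf.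
move=> /(_ (fun y _ => f0 y)) /= <-.
apply: eq_measure_integral => [|mp A mA _]; first exact: measurable_permute.
exact: pushforward_permute.
Qed.

End tuple_measure_theory.

Lemma cos1_ge0 (R : realType) (x : R) : 0 <= 1 + cos x.
Proof. by have := cos_geN1 x; lra. Qed.

Lemma measurable_1cos (R : realType) d (T : measurableType d) (f : T -> R) :
  measurable_fun setT f -> measurable_fun setT (fun x => (1 + cos (f x))%:E).
Proof.
move=> mf; apply/measurable_EFinP; apply: measurable_funD => //.
apply: (measurableT_comp _ mf).
by apply: continuous_measurable_fun; exact: continuous_cos.
Qed.

Section integral_1cos.
Context d (T : measurableType d) (R : realType).
Variable mu : {sigma_finite_measure set T -> \bar R}.
Hypothesis mu1 : mu setT = 1%E.

Lemma tuple_measure_setT m : tuple_measure mu m setT = 1%E.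
Proof.
have -> : [set: m.-tuple T] = rectangle (fun=> setT) by apply/seteqP; split.
by rewrite tuple_measure_rectangle// big1// => i _; rewrite mu1.
Qed.

Lemma integral_1cos_tuple m (L : 'I_m -> T -> R) (e : 'I_m -> R) (b : R) :
  (forall i, measurable_fun setT (L i)) -> (forall i, 0 <= e i <= 1) ->
  (forall i c, \int[mu]_x (1 + cos (L i x + c))%:E = (1 + cos c * e i)%:E)%E ->
  (\int[tuple_measure mu m]_t (1 + cos (\sum_i L i (tnth t i) + b))%:E =
   (1 + cos b * \prod_i e i)%:E)%E.
Proof.
elim: m L e b => [|m IH] L e b mL e01 Le.
  rewrite ge0_integral_tuple0; last first.
    apply: measurable_1cos; apply: measurable_funD => //.
    by under eq_fun do rewrite big_ord0; exact: measurable_cst.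
  by rewrite !big_ord0 add0r mulr1.
have mS (n : nat) (K : 'I_n -> T -> R) c : (forall i, measurable_fun setT (K i)) ->
    measurable_fun setT (fun t : n.-tuple T => \sum_i K i (tnth t i) + c).
  move=> mK; apply: measurable_funD => //; apply: measurable_sum => i.
  exact: (measurableT_comp (mK i) (measurable_tnth i)).
rewrite ge0_integral_tupleS; last 2 first.
- by apply: measurable_1cos; exact: mS.
- by move=> t; rewrite lee_fin cos1_ge0.
set E := \prod_(i < m) e (lift ord0 i).
have E01 : 0 <= E <= 1.
  apply/andP; split; first by apply: prodr_ge0 => i _; case/andP: (e01 (lift ord0 i)).
  by apply: prodr_ile1 => i _; exact: e01.
transitivity (\int[mu]_x ((1 - E)%:E + E%:E * (1 + cos (L ord0 x + b))%:E))%E.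
  apply: eq_integral => x _.
  transitivity (\int[tuple_measure mu m]_t
      (1 + cos (\sum_(i < m) L (lift ord0 i) (tnth t i) + (L ord0 x + b)))%:E)%E.
    apply: eq_integral => t _.
    rewrite big_ord_recl tnth0; congr (1 + cos _)%:E.
    rewrite addrAC addrC; congr (_ + _).
    by apply: eq_bigr => i _; rewrite tnthS.
  rewrite (IH (fun i => L (lift ord0 i)) (fun i => e (lift ord0 i)))//.
  by rewrite -/E -EFinM -EFinD; congr EFin; ring.
have mc : measurable_fun setT (fun x => (1 + cos (L ord0 x + b))%:E).
  by apply: measurable_1cos; apply: measurable_funD.
rewrite ge0_integralD//; last 3 first.
- by move=> x _; rewrite lee_fin subr_ge0; case/andP: E01.
- by move=> x _; rewrite mule_ge0// lee_fin ?cos1_ge0//; case/andP: E01.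
- exact: emeasurable_funM.
rewrite integral_cst// [X in (_ * X + _)%E](_ : _ = 1%E) ?mule1; last exact: mu1.
rewrite ge0_integralZl//; last by rewrite lee_fin; case/andP: E01.
rewrite Le -EFinM -EFinD; congr EFin.
by rewrite big_ord_recl -/E; ring.
Qed.

End integral_1cos.

Section triangular.
Local Open Scope ereal_scope.
Context d (T : measurableType d) (R : realType).
Variable mu : {sigma_finite_measure set T -> \bar R}.

Definition set_coord n (t : n.-tuple T) (i : 'I_n) (x : T) : n.-tuple T :=
  [tuple if k == i then x else tnth t k | k < n].

Lemma set_coord0 n (t : n.-tuple T) x y :
  set_coord [tuple of y :: t] ord0 x = [tuple of x :: t].
Proof.
apply: eq_from_tnth => k; rewrite tnth_mktuple.
by case: (unliftP ord0 k) => [j ->|->]; rewrite ?tnthS// eqxx tnth0.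
Qed.

Lemma set_coordS n (t : n.-tuple T) i x y :
  set_coord [tuple of y :: t] (lift ord0 i) x = [tuple of y :: set_coord t i x].
Proof.
apply: eq_from_tnth => k; rewrite tnth_mktuple.
by case: (unliftP ord0 k) => [j ->|->]; rewrite ?tnth0// !tnthS tnth_mktuple.
Qed.

Lemma integral_triangular_le n (h : 'I_n -> n.-tuple T -> R) (c : 'I_n -> R) :
  (forall i, measurable_fun setT (h i)) -> (forall i t, (0 <= h i t)%R) ->
  (forall (i : 'I_n) t t', (forall k : 'I_n, (i <= k)%N -> tnth t k = tnth t' k) ->
    h i t = h i t') ->
  (forall i t, \int[mu]_x (h i (set_coord t i x))%:E <= (c i)%:E) ->
  (forall i, (0 <= c i)%R) ->
  \int[tuple_measure mu n]_t (\prod_i h i t)%:E <= (\prod_i c i)%:E.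
Proof.
elim: n h c => [|n IH] h c mh h0 dh hc c0.
  rewrite ge0_integral_tuple0 ?big_ord0//.
  by under eq_fun do rewrite big_ord0; exact: measurable_cst.
have mprod (m : nat) (f : 'I_m -> m.-tuple T -> R) : (forall i, measurable_fun setT (f i)) ->
    measurable_fun setT (fun t => (\prod_i f i t)%:E).
  move=> mf; apply/measurable_EFinP.
  by apply: measurable_prod => i _; exact: mf.
have p0 (m : nat) (f : 'I_m -> m.-tuple T -> R) : (forall i t, (0 <= f i t)%R) ->
    forall t, 0 <= (\prod_i f i t)%:E.
  by move=> f0 t; rewrite lee_fin; apply: prodr_ge0 => i _; exact: f0.
rewrite ge0_integral_tupleSr; [|exact: mprod|exact: p0].
pose h' (i : 'I_n) (t : n.-tuple T) := h (lift ord0 i) [tuple of point :: t].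
have h'E i (t : n.-tuple T) x : h (lift ord0 i) [tuple of x :: t] = h' i t.
  by apply: dh => k; case: (unliftP ord0 k) => [j ->|->]//; rewrite !tnthS.
have mh' i : measurable_fun setT (h' i).
  exact: (measurableT_comp (mh _) (@measurable_cons_fixed _ _ n point)).
rewrite big_ord_recl EFinM.
apply: (@le_trans _ _ (\int[tuple_measure mu n]_t ((c ord0)%:E * (\prod_i h' i t)%:E))).
  apply: ge0_le_integral => //.
  - move=> t _; apply: integral_ge0 => x _; exact: p0.
  - by apply: (@measurable_integral_tuple_head _ _ _ _ n (fun t => (\prod_i h i t)%:E)); [exact: mprod|exact: p0].
  - by apply: emeasurable_funM => //; exact: mprod.
  - move=> t _.
    have -> : \int[mu]_x (\prod_i h i [tuple of x :: t])%:E =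
        \int[mu]_x ((h ord0 (set_coord [tuple of point :: t] ord0 x))%:E * (\prod_i h' i t)%:E).
      apply: eq_integral => x _; rewrite set_coord0 -EFinM big_ord_recl; congr (_ * _)%:E.
      by apply: eq_bigr => i _; rewrite h'E.
    rewrite ge0_integralZr//.
    + by rewrite lee_wpmul2r// p0// => i u; exact: h0.
    + under eq_fun do rewrite set_coord0.
      apply/measurable_EFinP; apply: (measurableT_comp (mh _)).
      exact: (measurable_cons (@measurable_id _ _ setT) (measurable_cst t)).
    + by move=> x _; rewrite lee_fin.
    + by apply: p0 => i u; exact: h0.
rewrite ge0_integralZl//.
- rewrite lee_wpmul2l ?lee_fin//; apply: IH => //.
  + by move=> i t; exact: h0.
  + move=> i t t' tt'; apply: dh => k; case: (unliftP ord0 k) => [j ->|->]//.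
    by move=> ij; rewrite !tnthS; exact: tt'.
  + move=> i t; rewrite (le_trans _ (hc (lift ord0 i) [tuple of point :: t]))//.
    by rewrite le_eqVlt; apply/orP; left; apply/eqP; apply: eq_integral => x _; rewrite set_coordS.
- exact: mprod.
- by move=> t _; apply: p0 => i u; exact: h0.
- by rewrite lee_fin.
Qed.

End triangular.

(** * Standard Gaussian integrals *)

Section gaussian_measure.
Context (R : realType).

Definition gauss n : {sigma_finite_measure set (Rn R n) -> \bar R} :=
  tuple_measure (normal_prob (0 : R) 1) n.

Lemma gauss_setT n : gauss n setT = 1%E.
Proof. by apply: tuple_measure_setT; exact: probability_setT. Qed.

Lemma expR_half_le1 (x : R) : 0 <= x -> expR (- x / 2) <= 1.
Proof.
by move=> x0; rewrite -expR0 ler_expR mulNr oppr_le0 divr_ge0.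
Qed.

Lemma integral_1cos_gauss n (a : 'I_n -> R) (b : R) :
  (\int[gauss n]_t (1 + cos (\sum_i a i * tnth t i + b))%:E =
   (1 + cos b * expR (- (\sum_i a i ^+ 2) / 2))%:E)%E.
Proof.
rewrite (@integral_1cos_tuple _ _ _ (normal_prob 0 1) _ n (fun i x => a i * x)
  (fun i => expR (- (a i ^+ 2) / 2))).
- by rewrite -expR_sum -sumrN mulr_suml; do 5 f_equal.
- exact: probability_setT.
- by move=> i; apply: measurable_funM.
- by move=> i; rewrite expR_ge0/= expR_half_le1// sqr_ge0.
- by move=> i c; rewrite integral_1cos_normal_prob ?oner_neq0// mul1r.
Qed.

Lemma integral_1cos_gauss_blocks m n (a : 'I_m -> 'I_n -> R) (b : R) :
  (\int[tuple_measure (gauss n) m]_t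
     (1 + cos (\sum_j \sum_i a j i * tnth (tnth t j) i + b))%:E =
   (1 + cos b * expR (- (\sum_j \sum_i a j i ^+ 2) / 2))%:E)%E.
Proof.
rewrite (@integral_1cos_tuple _ _ _ (gauss n) _ m
  (fun j (x : Rn R n) => \sum_i a j i * tnth x i)
  (fun j => expR (- (\sum_i a j i ^+ 2) / 2))).
- by rewrite -expR_sum -sumrN mulr_suml; do 5 f_equal.
- exact: gauss_setT.
- move=> j; apply: measurable_sum => i.
  by apply: measurable_funM => //; exact: measurable_tnth.
- move=> j; rewrite expR_ge0/= expR_half_le1//.
  by apply: sumr_ge0 => i _; exact: sqr_ge0.
- by move=> j c; rewrite integral_1cos_gauss.
Qed.

Lemma normal_peakV (s : R) : 0 < s -> normal_peak s^-1 = s * normal_peak 1.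
Proof.
move=> s0; rewrite /normal_peak expr1n mul1r exprVn -mulrnAr sqrtrM ?invr_ge0 ?sqr_ge0//.
by rewrite sqrtrV ?sqr_ge0// sqrtr_sqr gtr0_norm// invfM invrK.
Qed.

Lemma integral_gauss_affine_le (s w th : R) : 0 < s -> 0 <= th <= 1 ->
  (\int[normal_prob 0 1]_x (expR (- (s * x + w) ^+ 2 / 2))%:E <=
   (s `^ (- th))%:E)%E.
Proof.
move=> s0 /andP[th0 th1].
have m1 : measurable_fun setT (fun x : R => (expR (- (s * x + w) ^+ 2 / 2))%:E).
  apply/measurable_EFinP; apply: measurableT_comp => //.
  apply: measurable_funM => //; apply: measurableT_comp => //.
  by apply: measurable_funX; apply: measurable_funD => //; apply: measurable_funM.
have h1 : (\int[normal_prob 0 1]_x (expR (- (s * x + w) ^+ 2 / 2))%:E <= 1)%E.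
  apply: (@le_trans _ _ (\int[normal_prob 0 1]_x 1)%E).
    apply: ge0_le_integral => //.
    by move=> x _; rewrite lee_fin expR_half_le1 ?sqr_ge0.
  by rewrite integral_cst// mul1e [X in (X <= _)%E]probability_setT.
have h2 : (\int[normal_prob 0 1]_x (expR (- (s * x + w) ^+ 2 / 2))%:E <= (s^-1)%:E)%E.
  rewrite (@ge0_integral_density _ _ _ (@lebesgue_measure R) _ (normal_pdf 0 1))//; first last.
  - by move=> x; exact: normal_pdf_ge0.
  - exact: measurable_normal_pdf.
  have sV : s^-1 != 0 by rewrite invr_eq0 gt_eqF.
  apply: (@le_trans _ _ (\int[lebesgue_measure]_x (s^-1%:E * (normal_pdf (- (w / s)) s^-1 x)%:E))%E).
    apply: ge0_le_integral => //.
    - by move=> x _; rewrite mule_ge0// lee_fin ?expR_ge0 ?normal_pdf_ge0.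
    - apply: emeasurable_funM => //.
      by apply/measurable_EFinP; exact: measurable_normal_pdf.
    - apply: emeasurable_funM => //.
      by apply/measurable_EFinP; exact: measurable_normal_pdf.
    move=> x _; rewrite -!EFinM lee_fin.
    rewrite [in leRHS]normal_pdfE// normal_peakV// /normal_fun.
    have -> : - (x - - (w / s)) ^+ 2 / (s^-1 ^+ 2 *+ 2) = - (s * x + w) ^+ 2 / 2.
      rewrite -[_ *+ 2]mulr_natr; field; exact: lt0r_neq0.
    rewrite !mulrA mulVf ?gt_eqF// mul1r mulrC ler_wpM2r ?expR_ge0//.
    by apply: normal_pdf_ub; rewrite oner_neq0.
  rewrite ge0_integralZl//; last 3 first.
  - by apply/measurable_EFinP; exact: measurable_normal_pdf.
  - by move=> x _; rewrite lee_fin normal_pdf_ge0.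
  - by rewrite lee_fin invr_ge0 ltW.
  - by rewrite integral_normal_pdf mule1.
have [s1|s1] := leP s 1.
  apply: (le_trans h1); rewrite lee_fin powRN invf_ge1 ?powR_gt0//.
  by rewrite (le_trans (ge0_ler_powR th0 _ _ s1)) ?powR1 ?nnegrE ?(ltW s0).
apply: (le_trans h2); rewrite lee_fin -powR_inv1 ?(ltW s0)//.
by rewrite ler_powR ?(ltW s1)// lerN2.
Qed.

End gaussian_measure.

Section euclidean_norm.
Context (R : realType).

Lemma powR_prod (I : Type) (r : seq I) (Q : pred I) (f : I -> R) (a : R) :
  (forall i, Q i -> 0 <= f i) ->
  (\prod_(i <- r | Q i) f i) `^ a = \prod_(i <- r | Q i) (f i) `^ a.
Proof.
move=> f0; elim: r => [|i r IH]; first by rewrite !big_nil powR1.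
rewrite !big_cons; case: ifP => // Qi.
by rewrite powRM ?IH ?f0// prodr_ge0.
Qed.

Lemma enorm_sqr m (u : 'cV[R]_m) : enorm u ^+ 2 = \sum_i u i 0 ^+ 2.
Proof. by rewrite sqr_sqrtr// sumr_ge0// => i _; exact: sqr_ge0. Qed.

Lemma measurable_enorm_sqr d (T : measurableType d) m (F : T -> 'cV[R]_m) :
  (forall i, measurable_fun setT (fun x => F x i 0)) ->
  measurable_fun setT (fun x => enorm (F x) ^+ 2).
Proof.
move=> mF; under eq_fun do rewrite enorm_sqr.
by apply: measurable_sum => i; exact: measurable_funX.
Qed.

Lemma measurable_mulmx d (T : measurableType d) p m (A : 'M[R]_(p, m)) (F : T -> 'cV[R]_m) :
  (forall i, measurable_fun setT (fun x => F x i 0)) ->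
  forall i, measurable_fun setT (fun x => (A *m F x) i 0).
Proof.
move=> mF i; under eq_fun do rewrite mxE.
by apply: measurable_sum => k; apply: measurable_funM.
Qed.

Lemma measurable_colv m i : measurable_fun setT (fun x : Rn R m => colv x i 0).
Proof. by under eq_fun do rewrite mxE; exact: measurable_tnth. Qed.

Lemma measurable_expRN_half d (T : measurableType d) (f : T -> R) :
  measurable_fun setT f -> measurable_fun setT (fun x => expR (- f x / 2)).
Proof.
move=> mf; apply: measurableT_comp => //.
by apply: measurable_funM => //; apply: measurableT_comp.
Qed.

Lemma integral_gauss_trig_le n (L : 'M[R]_n) (w : 'cV[R]_n) (th : R) :
  is_trig_mx L -> (forall i, 0 < L i i) -> 0 <= th <= 1 ->
  (\int[gauss R n]_x (expR (- enorm (L^T *m (colv x + w)) ^+ 2 / 2))%:E <=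
   ((\det L) `^ (- th))%:E)%E.
Proof.
move=> /is_trig_mxP Ltrig L0 th01.
pose h i (x : Rn R n) := expR (- ((L^T *m (colv x + w)) i 0) ^+ 2 / 2).
have -> : (\det L) `^ (- th) = \prod_i (L i i) `^ (- th).
  rewrite det_trig; last exact/is_trig_mxP.
  by rewrite -powR_prod// => i _; exact: ltW.
under eq_integral => x _.
  rewrite enorm_sqr -sumrN mulr_suml expR_sum; over.
apply: (@integral_triangular_le _ _ _ (normal_prob 0 1) n h (fun i => L i i `^ (- th))).
- move=> i; apply: measurable_expRN_half; apply: measurable_funX.
  apply: measurable_mulmx => k; under eq_fun do rewrite mxE.
  by apply: measurable_funD => //; exact: measurable_colv.
- by move=> i t; exact: expR_ge0.
- move=> i t t' tt'; rewrite /h !mxE; congr (expR (- _ ^+ 2 / 2)).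
  apply: eq_bigr => k _; rewrite !mxE.
  have [ik|ki] := leqP i k; first by rewrite tt'.
  by rewrite Ltrig// !mul0r.
- move=> i t.
  pose W := \sum_(k | k != i) L k i * (tnth t k + w k 0) + L i i * w i 0.
  apply: le_trans (integral_gauss_affine_le W (L0 i) th01).
  rewrite le_eqVlt; apply/orP; left; apply/eqP; apply: eq_integral => x _.
  rewrite /h !mxE; congr (expR (- _ ^+ 2 / 2))%:E.
  rewrite (bigD1 i)//= !mxE tnth_mktuple eqxx /W mulrDr -addrA; congr (_ + _).
  rewrite addrC; congr (_ + _).
  by apply: eq_bigr => k ki; rewrite !mxE tnth_mktuple (negbTE ki).
- by move=> i; exact: powR_ge0.
Qed.

(* The first block is bounded by 1 only: its increment starts at the time 0,
   near which the variance is not controlled. *)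
Lemma integral_gauss_block_drop m n (S : 'I_m -> 'M[R]_n) (th : R) :
  (forall j, is_trig_mx (S j)) -> (forall (j : 'I_m) i, 0 < S j i i) -> 0 <= th <= 1 ->
  (\int[tuple_measure (gauss R n) m]_t
     (expR (- (\sum_(j < m | (0 < j)%N)
        enorm ((S j)^T *m (\sum_(i < m | (j <= i)%N) colv (tnth t i))) ^+ 2) / 2))%:E <=
   (\prod_(j < m | (0 < j)%N) (\det (S j)) `^ (- th))%:E)%E.
Proof.
move=> Strig S0 th01.
pose h (j : 'I_m) (t : m.-tuple (Rn R n)) := if (0 < j)%N then
  expR (- enorm ((S j)^T *m (\sum_(i < m | (j <= i)%N) colv (tnth t i))) ^+ 2 / 2)
  else 1.
under eq_integral => t _.
  rewrite -sumrN mulr_suml expR_sum big_mkcond; over.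
rewrite [in leRHS]big_mkcond.
apply: (@integral_triangular_le _ _ _ (gauss R n) m h (fun j => if (0 < j)%N then
   (\det (S j)) `^ (- th) else 1)).
- move=> j; rewrite /h; case: (0 < j)%N; last exact: measurable_cst.
  apply: measurable_expRN_half; apply: measurable_enorm_sqr; apply: measurable_mulmx => k.
  under eq_fun do rewrite summxE big_mkcond.
  apply: measurable_sum => i; case: (j <= i)%N => //.
  exact: (measurableT_comp (measurable_colv k) (measurable_tnth i)).
- by move=> j t; rewrite /h; case: (0 < j)%N => //; exact: expR_ge0.
- move=> j t t' tt'; rewrite /h; case: (0 < j)%N => //.
  congr (expR (- enorm (_ *m _) ^+ 2 / 2)).
  by apply: eq_bigr => i ji; rewrite tt'.
- move=> j t; rewrite /h; case: (0 < j)%N; last first.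
    by rewrite integral_cst// mul1e [leLHS](_ : _ = 1%E)//; exact: gauss_setT.
  pose w := \sum_(i < m | (j <= i)%N && (i != j)) colv (tnth t i).
  apply: le_trans (integral_gauss_trig_le w (Strig j) (S0 j) th01).
  rewrite le_eqVlt; apply/orP; left; apply/eqP; apply: eq_integral => x _.
  congr (expR (- enorm (_ *m _) ^+ 2 / 2))%:E.
  rewrite (bigD1 j)//= tnth_mktuple eqxx; congr (_ + _).
  by apply: eq_bigr => i /andP[_ ij]; rewrite tnth_mktuple (negbTE ij).
- by move=> j; case: ifP => // _; exact: powR_ge0.
Qed.

End euclidean_norm.

(** * Small-ball probabilities of Gaussian vectors *)

Section cholesky.
Context (R : realType).

Let quad n (A : 'M[R]_n) (u : 'cV[R]_n) : R := (u^T *m A *m u) 0 0.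

Let dotC n (u v : 'cV[R]_n) : (u^T *m v) 0 0 = (v^T *m u) 0 0.
Proof. by rewrite !mxE; apply: eq_bigr => i _; rewrite !mxE mulrC. Qed.

Let quad_block n (a x : R) (b : 'cV[R]_n) (C : 'M[R]_n) (y : 'cV[R]_n) :
  quad (block_mx a%:M b^T b C) (col_mx x%:M y) =
  x ^+ 2 * a + 2 * (x * (b^T *m y) 0 0) + quad C y.
Proof.
have mxD (M N : 'M[R]_1) : (M + N) 0 0 = M 0 0 + N 0 0 by rewrite mxE.
have mxZ c (M : 'M[R]_1) : (c *: M) 0 0 = c * M 0 0 by rewrite mxE.
rewrite /quad tr_col_mx tr_scalar_mx mul_row_block mul_row_col !mulmxDl !mxD.
rewrite -!scalar_mxM mul_mx_scalar mxZ (dotC y) mul_scalar_mx -scalemxAl mxZ.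
rewrite [(_%:M) 0 0]mxE eqxx mulr1n; ring.
Qed.

(* Cholesky's algorithm; a vanishing pivot forces the rest of its column to
   vanish, so dividing by its root (0 / 0 = 0) is harmless. *)
Lemma psd_trig_root n (A : 'M[R]_n) : A^T = A ->
  (forall u : 'cV[R]_n, 0 <= (u^T *m A *m u) 0 0) ->
  exists L : 'M[R]_n,
    [/\ is_trig_mx L, L *m L^T = A & forall i, 0 <= L i i].
Proof.
elim: n A => [|n IH] A symA psdA.
  exists 0; split=> [||[]//]; last by apply/matrixP => -[].
  by apply/is_trig_mxP => -[].
rewrite -[n.+1]/(1 + n)%N in A symA psdA *.
pose a := A 0 0; pose b := dlsubmx A; pose C := drsubmx A.
have AE : A = block_mx a%:M b^T b C.
  rewrite -[LHS]submxK; congr block_mx.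
    by apply/matrixP => i j; rewrite !ord1 !mxE/= /a; congr (A _ _); apply/val_inj.
  by rewrite /b -[in RHS]symA -trmx_ursub trmxK.
have symC : C^T = C by rewrite /C trmx_drsub symA.
have qA x y : 0 <= x ^+ 2 * a + 2 * (x * (b^T *m y) 0 0) + quad C y.
  by rewrite -quad_block -AE; exact: psdA.
have a0 : 0 <= a.
  have := qA 1 0; by rewrite /quad !mulmx0 !mxE !mulr0 !addr0 expr1n mul1r.
have bb : (b^T *m b) 0 0 = \sum_i b i 0 ^+ 2.
  by rewrite mxE; apply: eq_bigr => i _; rewrite mxE.
have b0 : a = 0 -> b = 0.
  move=> az; have h x : 0 <= 2 * (x * (b^T *m b) 0 0) + quad C b.
    by have := qA x b; rewrite az mulr0 add0r.
  have : (b^T *m b) 0 0 = 0.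
    apply/eqP; rewrite eq_le; apply/andP; split; last first.
      by rewrite bb; apply: sumr_ge0 => i _; exact: sqr_ge0.
    rewrite leNgt; apply/negP => s0.
    have := h (- (quad C b + 1) / (b^T *m b) 0 0).
    by rewrite divfK ?gt_eqF//; have := h 0; rewrite mul0r mulr0 add0r; lra.
  rewrite bb => /eqP; rewrite psumr_eq0; last by move=> i _; exact: sqr_ge0.
  move=> /allP bi; apply/colP => i; rewrite [RHS]mxE.
  by have /implyP/(_ isT) := bi i (mem_index_enum _); rewrite sqrf_eq0 => /eqP.
pose S := C - a^-1 *: (b *m b^T).
have symS : S^T = S by rewrite /S !linearB/= linearZ/= trmx_mul trmxK symC.
have psdS y : 0 <= quad S y.
  have -> : quad S y = quad C y - a^-1 * ((b^T *m y) 0 0) ^+ 2.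
    have mxBZ c (M N : 'M[R]_1) : (M - c *: N) 0 0 = M 0 0 - c * N 0 0 by rewrite !mxE.
    rewrite /quad /S mulmxBr mulmxBl -scalemxAr -scalemxAl mxBZ; congr (_ - _ * _).
    rewrite (_ : y^T *m (b *m b^T) *m y = (y^T *m b) *m (b^T *m y)); last by rewrite !mulmxA.
    by rewrite [LHS]mxE big_ord1 dotC expr2.
  have [az|an] := eqVneq a 0.
    by have := qA 0 y; rewrite az invr0 !mul0r !mulr0 subr0 !add0r.
  have := qA (- ((b^T *m y) 0 0) / a) y.
  set be := (b^T *m y) 0 0.
  by rewrite [X in 0 <= X -> _](_ : _ = quad C y - a^-1 * be ^+ 2)//; field.
have [L' [trigL' LL' L'0]] := IH S symS psdS.
pose L : 'M[R]_(1 + n) := block_mx (Num.sqrt a)%:M 0 ((Num.sqrt a)^-1 *: b) L'.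
exists L; split.
- rewrite is_trig_block_mx// eqxx trigL' andbT/=.
  by apply/is_trig_mxP => i j; rewrite !ord1.
- rewrite /L tr_block_mx tr_scalar_mx trmx0 mulmx_block !mul0mx !mulmx0 !addr0 AE.
  have sa : Num.sqrt a * Num.sqrt a = a by rewrite -expr2 sqr_sqrtr.
  have sb : (Num.sqrt a * (Num.sqrt a)^-1) *: b = b.
    have [az|an] := eqVneq a 0; first by rewrite (b0 az) scaler0.
    by rewrite divff ?scale1r// sqrtr_eq0 -ltNge lt_neqAle eq_sym an.
  congr block_mx.
  + by rewrite -scalar_mxM sa.
  + by rewrite linearZ/= mul_scalar_mx scalerA -linearZ/= sb.
  + by rewrite mul_mx_scalar scalerA sb.
  + rewrite LL' linearZ/= -scalemxAl -scalemxAr scalerA -invfM sa.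
    by rewrite /S addrC subrK.
- move=> i; case: (splitP (i : 'I_(1 + n))) => j ij.
    rewrite (_ : i = lshift n j); last exact: val_inj.
    by rewrite /L block_mxEul !ord1 mxE eqxx mulr1n sqrtr_ge0.
  rewrite (_ : i = rshift 1 j); last exact: val_inj.
  by rewrite /L block_mxEdr.
Qed.

End cholesky.

Section centered_gaussian_theory.
Context d (T : measurableType d) (R : realType) (P : probability T R).

Lemma Lfun2P (f : T -> R) : measurable_fun setT f ->
  (\int[P]_w (f w ^+ 2)%:E < +oo)%E -> f \in Lfun P 2%:E.
Proof.
move=> mf f2; rewrite inE; apply/andP; split; rewrite inE//=.
rewrite /finite_norm unlock poweR_lty//.
under eq_integral => x _ do rewrite /= powR_mulrn// real_normK ?num_real//.
exact: f2.
Qed.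

Lemma ge0_integral_centered_gaussian (Z : T -> R) : centered_gaussian P Z ->
  exists s : R, forall f : R -> \bar R, measurable_fun setT f -> (forall x, 0 <= f x)%E ->
    (\int[P]_w f (Z w) = if (s == 0)%R then f 0%R else \int[normal_prob 0 s]_x f x)%E.
Proof.
move=> [mZ [s Ps]]; exists s => f mf f0.
have mZ' : measurable_fun setT (Z : T -> measurableTypeR R) by [].
have := @ge0_integral_pushforward _ _ _ _ R (Z : T -> measurableTypeR R) mZ' P setT f measurableT mf.
move=> /(_ (fun y _ => f0 y)) /= <-.
have [s0|s0] := eqVneq s 0.
  transitivity (\int[\d_(0%R : measurableTypeR R)]_x f x)%E.
    apply: eq_measure_integral => // A mA _.
    by rewrite /= /pushforward Ps// s0 eqxx.
  by rewrite integral_dirac// diracT mul1e.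
apply: eq_measure_integral => // A mA _.
by rewrite /= /pushforward Ps// (negbTE s0).
Qed.

Lemma centered_gaussian_cos (Z : T -> R) : centered_gaussian P Z ->
  exists v : R, [/\ 0 <= v, Z \in Lfun P 2%:E, ('V_P[Z] <= v%:E)%E &
    forall b, (\int[P]_w (1 + cos (Z w + b))%:E = (1 + cos b * expR (- v / 2))%:E)%E].
Proof.
move=> gZ; have [s Es] := ge0_integral_centered_gaussian gZ.
have mZ : measurable_fun setT Z by case: gZ.
have E2 : (\int[P]_w (Z w ^+ 2)%:E = (s ^+ 2)%:E)%E.
  rewrite (Es (fun x => (x ^+ 2)%:E)).
  - case: eqVneq => [->|s0]; first by rewrite expr0n.
    exact: integral_sqr_normal_prob.
  - by apply/measurable_EFinP; exact: exprn_measurable.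
  - by move=> x; rewrite lee_fin sqr_ge0.
have L2 : Z \in Lfun P 2%:E by apply: Lfun2P => //; rewrite E2 ltry.
exists (s ^+ 2); split => //.
- exact: sqr_ge0.
- rewrite varianceE// -E2 unlock.
  have : ('E_P[Z] \is a fin_num)%E.
    by apply: expectation_fin_num; apply: Lfun_subset12 L2; rewrite fin_num_measure.
  rewrite unlock; set e := (\int[P]_w (Z w)%:E)%E => efin.
  rewrite -(fineK efin) -EFin_expe leeBlDr// leeDl// lee_fin sqr_ge0//.
- move=> b; rewrite (Es (fun x => (1 + cos (x + b))%:E)).
  + case: eqVneq => [->|s0].
      by rewrite expr0n/= oppr0 mul0r expR0 mulr1 add0r.
    have := integral_1cos_normal_prob s0 1 b.
    by rewrite mulr1; under eq_integral do rewrite mul1r.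
  + by apply: measurable_1cos; exact: measurable_funD.
  + by move=> x; rewrite lee_fin cos1_ge0.
Qed.

Lemma Lfun_sum (I : Type) (r : seq I) (Y : I -> T -> R) :
  (forall i, Y i \in Lfun P 2%:E) -> (fun w => \sum_(i <- r) Y i w) \in Lfun P 2%:E.
Proof.
move=> LY; elim: r => [|i r IH].
  by under eq_fun do rewrite big_nil; exact: Lfun_cst.
under eq_fun do rewrite big_cons.
have -> : (fun w => Y i w + \sum_(j <- r) Y j w) = Y i + (fun w => \sum_(j <- r) Y j w) by [].
by rewrite rpredD ?lee1n//=.
Qed.

Lemma Lfun2Z (a : R) (Y : T -> R) : Y \in Lfun P 2%:E -> (fun w => a * Y w) \in Lfun P 2%:E.
Proof.
move=> LY; rewrite (_ : (fun w => _) = a \o* Y); first by rewrite Lfun_scale// ler1n.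
by apply/funext => w /=; rewrite mulrC.
Qed.

Lemma covariance2_fin_num (Y Z : T -> R) : Y \in Lfun P 2%:E -> Z \in Lfun P 2%:E ->
  (covariance P Y Z \is a fin_num)%E.
Proof.
move=> Y2 Z2; have Pf : P setT \is a fin_num by rewrite fin_num_measure.
apply: covariance_fin_num; [exact: Lfun_subset12 Y2|exact: Lfun_subset12 Z2|].
exact: Lfun2_mul_Lfun1.
Qed.

Lemma covariance_suml (I : Type) (r : seq I) (a : I -> R) (Y : I -> T -> R) (Z : T -> R) :
  (forall i, Y i \in Lfun P 2%:E) -> Z \in Lfun P 2%:E ->
  covariance P (fun w => \sum_(i <- r) a i * Y i w) Z =
  (\sum_(i <- r) a i * fine (covariance P (Y i) Z))%:E.
Proof.
move=> LY LZ; have Pf : P setT \is a fin_num by rewrite fin_num_measure.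
elim: r => [|i r IH].
  by under eq_fun do rewrite big_nil; rewrite big_nil covariance_cst_l.
under eq_fun do rewrite big_cons.
rewrite (@covarianceDl _ _ _ P (fun w => a i * Y i w) (fun w => \sum_(j <- r) a j * Y j w))//.
- rewrite IH big_cons EFinD EFinM fineK; last exact: covariance2_fin_num.
  congr (_ + _)%E; rewrite -covarianceZl; last 3 first.
  + exact: Lfun_subset12.
  + exact: Lfun_subset12.
  + exact: Lfun2_mul_Lfun1.
  by congr covariance; apply/funext => w /=; rewrite mulrC.
- exact: Lfun2Z.
- by apply: (@Lfun_sum _ r (fun j w => a j * Y j w)) => j; exact: Lfun2Z.
Qed.

Lemma variance_sum (I : Type) (r : seq I) (a : I -> R) (Y : I -> T -> R) :
  (forall i, Y i \in Lfun P 2%:E) ->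
  'V_P[fun w => (\sum_(i <- r) a i * Y i w)%R]%E =
  (\sum_(i <- r) \sum_(j <- r) a i * a j * fine (covariance P (Y i) (Y j)))%:E.
Proof.
move=> LY.
have LS : (fun w => \sum_(i <- r) a i * Y i w) \in Lfun P 2%:E.
  by apply: (@Lfun_sum _ r (fun j w => a j * Y j w)) => j; exact: Lfun2Z.
rewrite /variance covariance_suml//; congr EFin; apply: eq_bigr => i _.
rewrite covarianceC covariance_suml//= mulr_sumr; apply: eq_bigr => j _.
by rewrite covarianceC mulrA.
Qed.

Lemma gaussian_small_ball m n (Z : 'I_m -> 'I_n -> T -> R) (x : 'I_m -> 'I_n -> R) (r : R)
    (Q : m.-tuple (Rn R n) -> R) :
  0 < r -> (forall j i, measurable_fun setT (Z j i)) ->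
  (forall a : 'I_m -> 'I_n -> R, centered_gaussian P (fun w => \sum_j \sum_i a j i * Z j i w)) ->
  measurable_fun setT Q ->
  (forall xi, (Q xi)%:E <=
     'V_P[fun w => (\sum_j \sum_i (tnth (tnth xi j) i / r) * Z j i w)%R])%E ->
  (P [set w | forall j i, (`|Z j i w - x j i| <= r)%R] <=
   (expR ((m * n)%:R / 2))%:E *
   \int[tuple_measure (gauss R n) m]_xi (expR (- Q xi / 2))%:E)%E.
Proof.
move=> r0 mZ gZ mQ QV.
set A := [set w | _].
set G := tuple_measure (gauss R n) m.
have mA : measurable A.
  have -> : A = \bigcap_j \bigcap_i [set w | `|Z j i w - x j i| <= r].
    apply/seteqP; split=> w /=; first by move=> h j _ i _; exact: h.
    by move=> h j i; exact: h.
  apply: fin_bigcap_measurable => [|j _]; first exact: finite_finset.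
  apply: fin_bigcap_measurable => [|i _]; first exact: finite_finset.
  rewrite -[X in measurable X]setTI.
  have -> : [set w | `|Z j i w - x j i| <= r] =
      (fun w => `|Z j i w - x j i|) @^-1` `]-oo, r]%classic.
    by apply/seteqP; split => w; rewrite /= in_itv.
  have mf : measurable_fun setT (fun w => `|Z j i w - x j i|).
    by apply: measurableT_comp => //; exact: measurable_funB.
  exact: mf.
pose F (w : T) (xi : m.-tuple (Rn R n)) : \bar R :=
  (1 + cos (\sum_j \sum_i ((Z j i w - x j i) / r) * tnth (tnth xi j) i + 0))%:E.
pose e : R := expR (- (m * n)%:R / 2).
have e0 : 0 <= e by exact: expR_ge0.
have F0 w xi : (0 <= F w xi)%E by rewrite lee_fin cos1_ge0.
have mF : measurable_fun setT (fun p => F p.1 p.2).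
  apply: measurable_1cos; apply: measurable_funD => //.
  apply: measurable_sum => j; apply: measurable_sum => i; apply: measurable_funM.
    apply: measurable_funM => //; apply: measurable_funB => //.
    by apply: (measurableT_comp (mZ j i)).
  apply: (@measurableT_comp _ _ _ _ _ _ (fun xi : m.-tuple (Rn R n) => tnth (tnth xi j) i : R) _ snd) => //.
  exact: (measurableT_comp (measurable_tnth i) (measurable_tnth j)).
have h1 : (1 + e%:E * P A <= \int[P]_w \int[G]_xi F w xi)%E.
  have -> : (1 + e%:E * P A = \int[P]_w (1 + e%:E * (\1_A w)%:E))%E.
    rewrite ge0_integralD//.
    - rewrite integral_cst// [X in (_ = 1 * X + _)%E]probability_setT mule1.
      rewrite ge0_integralZl//; last exact/measurable_EFinP.
      by rewrite integral_indic// setIT.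
    - by move=> w _; rewrite mule_ge0// lee_fin.
    - by apply: emeasurable_funM => //; exact/measurable_EFinP.
  apply: ge0_le_integral => //.
  - by move=> w _; rewrite adde_ge0// mule_ge0// lee_fin.
  - apply: emeasurable_funD => //; apply: emeasurable_funM => //; exact/measurable_EFinP.
  - exact: (measurable_fun_fubini_tonelli_F (m2 := G) (fun p => F p.1 p.2)).
  - move=> w _; rewrite /F integral_1cos_gauss_blocks cos0 mul1r -EFinM -EFinD lee_fin lerD2l.
    rewrite indicE; case: (boolP (w \in A)) => [/set_mem Aw|_]; last by rewrite mulr0 expR_ge0.
    rewrite mulr1 ler_expR ler_wpM2r// lerN2 natrM.
    apply: (@le_trans _ _ (\sum_(j < m) \sum_(i < n) 1)); last first.
      under eq_bigr do rewrite sumr_const card_ord.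
      by rewrite sumr_const card_ord -[leLHS]mulr_natl.
    apply: ler_sum => j _; apply: ler_sum => i _.
    by rewrite -(real_normK (num_real _)) normrM normfV (gtr0_norm r0)
      expr_le1// ?mulr_ge0 ?invr_ge0 ?(ltW r0)// ler_pdivrMr// mul1r; exact: Aw.
have h2 : (\int[P]_w \int[G]_xi F w xi <= 1 + \int[G]_xi (expR (- Q xi / 2))%:E)%E.
  rewrite (fubini_tonelli (m2 := G) (fun p => F p.1 p.2))//=.
  have mE : measurable_fun setT (fun xi => (expR (- Q xi / 2))%:E).
    by apply/measurable_EFinP; exact: measurable_expRN_half.
  have -> : (1 + \int[G]_xi (expR (- Q xi / 2))%:E = \int[G]_xi (1 + (expR (- Q xi / 2))%:E))%E.
    rewrite ge0_integralD//.
    rewrite integral_cst// mul1e; congr (_ + _)%E; apply/esym.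
    by apply: tuple_measure_setT; exact: gauss_setT.
  apply: ge0_le_integral => //.
  - by move=> xi _; apply: integral_ge0.
  - exact: (measurable_fun_fubini_tonelli_G (m1 := P) (fun p => F p.1 p.2)).
  - exact: emeasurable_funD.
  - move=> xi _.
    have [v [v0 _ Vv Ev]] := centered_gaussian_cos (gZ (fun j i => tnth (tnth xi j) i / r)).
    pose b := - (\sum_j \sum_i tnth (tnth xi j) i / r * x j i).
    rewrite [leLHS](_ : _ = \int[P]_w (1 + cos (\sum_j \sum_i tnth (tnth xi j) i / r * Z j i w + b))%:E)%E; last first.
      apply: eq_integral => w _; rewrite /F addr0 /b -sumrB.
      do 3 f_equal; apply: eq_bigr => j _; rewrite -sumrB.
      by apply: eq_bigr => i _; ring.
    rewrite Ev lee_fin lerD2l.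
    apply: (@le_trans _ _ (expR (- v / 2))).
      by rewrite ler_piMl ?expR_ge0// cos_le1.
    rewrite ler_expR ler_wpM2r// lerN2 -lee_fin.
    exact: le_trans (QV xi) Vv.
have h3 := le_trans h1 h2.
move: h3; rewrite leeD2lE// => h3.
have -> : expR ((m * n)%:R / 2) = e^-1 by rewrite /e mulNr expRN invrK.
have ep : 0 < e by exact: expR_gt0.
rewrite -[leLHS]mul1e -[X in (X%:E * _)%E](mulVf (lt0r_neq0 ep)) EFinM -muleA.
by rewrite lee_wpmul2l// lee_fin invr_ge0.
Qed.

End centered_gaussian_theory.

(** * Consequences of local nondeterminism *)

Section quadratic_form.
Context (R : realType).

(* Rational vectors are dense and quadratic forms are continuous. *)
Lemma quadratic_form_ge0 (I : finType) (M : I -> I -> R) :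
  (forall q : I -> rat, 0 <= \sum_a \sum_b ratr (q a) * ratr (q b) * M a b) ->
  forall u : I -> R, 0 <= \sum_a \sum_b u a * u b * M a b.
Proof.
move=> qM u.
have h (p : nat * I) : exists q : rat, `|u p.2 - ratr q| <= p.1.+1%:R^-1.
  have ab : u p.2 - p.1.+1%:R^-1 < u p.2 + p.1.+1%:R^-1.
    by rewrite ltrD2l gtrN// invr_gt0.
  have [q] := rat_in_itvoo ab; rewrite in_itv/= => /andP[h1 h2].
  by exists q; rewrite ler_distlC (ltW h1) (ltW h2).
have [f hf] := choice h.
have cf a : ratr (f (n, a)) @[n --> \oo] --> u a.
  apply/cvgrPdist_le => /= e e0; near=> n.
  apply: (le_trans (hf (n, a))) => /=.
  by apply: ltW; near: n; exact: (near_infty_natSinv_lt (PosNum e0)).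
have : \sum_a \sum_b ratr (f (n, a)) * ratr (f (n, b)) * M a b @[n --> \oo] -->
    \sum_a \sum_b u a * u b * M a b.
  apply: cvg_big => [|a _]; first exact: add_continuous.
  apply: cvg_big => [|b _]; first exact: add_continuous.
  by apply: cvgM; [apply: cvgM; exact: cf|exact: cvg_cst].
move=> H; rewrite -(cvg_lim _ H)//.
apply: limr_ge; first by apply/cvg_ex; eexists; exact: H.
by apply: nearW => n; exact: (qM (fun a => f (n, a))).
Unshelve. all: by end_near. Qed.

End quadratic_form.

Lemma telescope_sumr_ord (V : zmodType) (f : nat -> V) l (i : 'I_l) :
  \sum_(j < l | (j <= i)%N) (f j.+1 - f j) = f i.+1 - f 0.
Proof.
rewrite -(@telescope_sumr _ 0 i.+1)// big_mkord.
by rewrite (big_ord_widen _ (fun j => f j.+1 - f j) (ltn_ord i)).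
Qed.

Lemma powR_exprN (R : realType) (x a : R) n : 0 < x ->
  (x ^+ n) `^ (- a) = x^-1 `^ (n%:R * a).
Proof.
move=> x0; have x0' := ltW x0.
rewrite -powR_mulrn// -powRrM -(powR_inv1 x0') -powRrM.
by congr (_ `^ _); ring.
Qed.

Section gaussian_field.
Context (R : realType) (d : measure_display) (Omega : measurableType d).
Variables (P : probability Omega R) (k n : nat) (X : Rn R k -> Omega -> Rn R n).
Hypothesis gX : centered_gaussian_field P X.
Local Notation cube := (unit_cube R k).
Local Notation "0_k" := (origin R k).

Lemma origin_in_cube : cube 0_k.
Proof. by move=> i; rewrite tnth_nseq lexx ler01. Qed.

Lemma centered_gaussian_coord t i : cube t ->
  centered_gaussian P (fun w => tnth (X t w) i : R).
Proof.
move=> ct; have := @gX 1 (fun=> t) (fun=> delta_mx i 0) (fun=> ct).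
congr centered_gaussian; apply/funext => w; rewrite big_ord1 /dotv (bigD1 i)//= !mxE !eqxx mul1r.
by rewrite big1 ?addr0// => j ji; rewrite !mxE (negbTE ji) mul0r.
Qed.

Lemma measurable_coord t i : cube t -> measurable_fun setT (fun w => tnth (X t w) i : R).
Proof. by move=> ct; have [] := centered_gaussian_coord i ct. Qed.

Lemma Lfun2_coord t i : cube t -> (fun w => tnth (X t w) i : R) \in Lfun P 2%:E.
Proof. by move=> /(centered_gaussian_coord i)/centered_gaussian_cos[v []]. Qed.

Lemma Lfun2_increment s t i : cube s -> cube t ->
  (fun w => increment X s t w i 0) \in Lfun P 2%:E.
Proof.
move=> cs ct; rewrite (_ : (fun w => _) = (fun w => tnth (X t w) i : R) - (fun w => tnth (X s w) i : R)).
  have hs := Lfun2_coord i cs; have ht := Lfun2_coord i ct.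
  by rewrite rpredB ?lee1n//=.
by apply/funext => w; rewrite !mxE.
Qed.

Lemma increment_cov_sym s t : (increment_cov P X s t)^T = increment_cov P X s t.
Proof. by apply/matrixP => i j; rewrite !mxE covarianceC. Qed.

Lemma increment_cov_psd s t (u : 'cV[R]_n) : cube s -> cube t ->
  0 <= (u^T *m increment_cov P X s t *m u) 0 0.
Proof.
move=> cs ct.
have := @variance_ge0 _ _ _ P (fun w => \sum_i u i 0 * increment X s t w i 0).
rewrite variance_sum => [|i]; last exact: Lfun2_increment.
rewrite lee_fin; congr (0 <= _).
rewrite mxE exchange_big; apply: eq_bigr => i _.
rewrite mxE mulr_suml; apply: eq_bigr => j _; rewrite !mxE; ring.
Qed.

Lemma in_subcube_cube l (t : l.-tuple (Rn R k)) eps j : in_subcube eps t -> cube (tnth t j).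
Proof.
move=> [a [ha hj]] i; have [a0 a1] := ha i; have /andP[h1 h2] := hj j i.
by rewrite (le_trans a0 h1) (le_trans h2 a1).
Qed.

Lemma timeS l (t : l.-tuple (Rn R k)) (j : 'I_l) : time t j.+1 = tnth t j.
Proof. by rewrite /time /= (tnth_nth 0_k). Qed.

Lemma time_cube l (t : l.-tuple (Rn R k)) j : (forall i, cube (tnth t i)) ->
  (j <= l)%N -> cube (time t j).
Proof.
move=> ct; case: j => [_|j jl]; first exact: origin_in_cube.
by rewrite (timeS t (Ordinal jl)).
Qed.

Lemma lnd_ae : locally_nondeterministic P X -> forall l : nat, (2 <= l)%N ->
  exists c eps : R, [/\ 0 < c, 0 < eps <= 1 &
    {ae tuple_measure (lebesgue_Rn R k) l, forall t : l.-tuple (Rn R k),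
      in_subcube eps t -> nearest_ordered t ->
      forall sigma : 'I_l -> 'M[R]_n,
        (forall j : 'I_l, sigma j *m (sigma j)^T =
                          increment_cov P X (time t j) (time t j.+1)) ->
        (forall j, sigma j \in unitmx) /\
        forall u : 'I_l -> 'cV[R]_n,
        ((c * \sum_j enorm (u j) ^+ 2)%R%:E <=
         'V_P[fun w => (\sum_(j < l) dotv (u j)
                (invmx (sigma j) *m
                 increment X (time t j) (time t j.+1) w))%R])%E}].
Proof.
move=> lnd l l2; have [c [eps [c0 eps01 H]]] := lnd l l2.
exists c, eps; split => //.
pose U (q : {ffun 'I_l * 'I_n -> rat}) (j : 'I_l) : 'cV[R]_n := \col_i ratr (q (j, i)).
have HU : {ae tuple_measure (lebesgue_Rn R k) l, forall t : l.-tuple (Rn R k),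
    forall m q, unpickle m = Some q -> in_subcube eps t -> nearest_ordered t ->
      forall sigma : 'I_l -> 'M[R]_n,
        (forall j : 'I_l, sigma j *m (sigma j)^T =
                          increment_cov P X (time t j) (time t j.+1)) ->
        (forall j, sigma j \in unitmx) /\
        ((c * \sum_j enorm (U q j) ^+ 2)%R%:E <=
         'V_P[fun w => (\sum_(j < l) dotv (U q j)
                (invmx (sigma j) *m
                 increment X (time t j) (time t j.+1) w))%R])%E}.
  apply/ae_foralln => m.
  case E : (@unpickle {ffun 'I_l * 'I_n -> rat} m) => [q|]; last by apply: aeW => t q.
  by apply: filterS (H (U q)) => t ht q' [<-].
apply: filterS HU => t ht st no sigma hs.
have {}ht q := ht (pickle q) q (pickleK q) st no sigma hs.
split; first by have [] := ht [ffun=> 0].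
have ct j : cube (tnth t j) := in_subcube_cube j st.
pose Y (a : 'I_l * 'I_n) (w : Omega) : R :=
  (invmx (sigma a.1) *m increment X (time t a.1) (time t a.1.+1) w) a.2 0.
have LY a : Y a \in Lfun P 2%:E.
  rewrite (_ : Y a = fun w => \sum_i (invmx (sigma a.1)) a.2 i *
      increment X (time t a.1) (time t a.1.+1) w i 0).
    apply: (@Lfun_sum _ _ _ P _ _ (fun i w => (invmx (sigma a.1)) a.2 i *
      increment X (time t a.1) (time t a.1.+1) w i 0)) => i.
    apply: Lfun2Z; apply: Lfun2_increment; apply: time_cube => //.
    exact: ltnW.
  by apply/funext => w; rewrite /Y mxE.
have VE (u : 'I_l -> 'cV[R]_n) :
    'V_P[fun w => (\sum_(j < l) dotv (u j)
                (invmx (sigma j) *m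
                 increment X (time t j) (time t j.+1) w))%R]%E =
    (\sum_a \sum_b u a.1 a.2 0 * u b.1 b.2 0 * fine (covariance P (Y a) (Y b)))%:E.
  rewrite -(@variance_sum _ _ _ P _ _ (fun a => u a.1 a.2 0) Y LY).
  congr variance; apply/funext => w; rewrite pair_big/=.
  by apply: eq_bigr => -[j i].
have NE (u : 'I_l -> 'cV[R]_n) : c * \sum_j enorm (u j) ^+ 2 =
    \sum_a \sum_b u a.1 a.2 0 * u b.1 b.2 0 * (c * (a == b)%:R).
  under eq_bigr do rewrite enorm_sqr.
  rewrite pair_big/= mulr_sumr; apply: eq_bigr => a _.
  rewrite [RHS](bigD1 a)//= eqxx big1 ?addr0; first by rewrite /= mulr1; ring.
  by move=> b ba; rewrite eq_sym (negbTE ba) !mulr0.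
move=> u; rewrite VE lee_fin NE -subr_ge0 -sumrB.
under eq_bigr => a _ do (rewrite -sumrB; under eq_bigr do rewrite -mulrBr).
apply: (quadratic_form_ge0 (I := ('I_l * 'I_n)%type)
  (M := fun a b => fine (covariance P (Y a) (Y b)) - c * (a == b)%:R)
  _ (fun a => u a.1 a.2 0)) => q.
have := (ht (finfun q)).2; rewrite VE lee_fin NE -subr_ge0 -sumrB.
under eq_bigr => a _ do (rewrite -sumrB; under eq_bigr do rewrite -mulrBr).
congr (0 <= _); apply: eq_bigr => a _; apply: eq_bigr => b _.
by rewrite !mxE !ffunE -!surjective_pairing.
Qed.

Lemma lnd_small_ball th : locally_nondeterministic P X -> 0 <= th <= 1 ->
  forall l : nat, (2 <= l)%N ->
  exists c eps : R, [/\ 0 < c, 0 < eps <= 1 &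
    {ae tuple_measure (lebesgue_Rn R k) l, forall t : l.-tuple (Rn R k),
      in_subcube eps t -> nearest_ordered t ->
      forall (r : R) (x : 'I_l -> 'I_n -> R), 0 < r ->
      (P [set w | forall j i, (`|tnth (X (tnth t j) w) i - tnth (X 0_k w) i - x j i| <= r)%R] <=
       (expR ((l * n)%:R / 2) *
        \prod_(j < l | (0 < j)%N) ((r / c) `^ (n%:R * th) *
          (\det (increment_cov P X (time t j) (time t j.+1))) `^ (- (th / 2))))%:E)%E}].
Proof.
move=> lnd th01 l l2; have [c [eps [c0 eps01 H]]] := lnd_ae lnd l2.
exists (Num.sqrt c), eps; split => //; first by rewrite sqrtr_gt0.
apply: filterS H => t ht st no r x r0.
have ct j : cube (tnth t j) := in_subcube_cube j st.
have ctm j : (j <= l)%N -> cube (time t j) by move=> jl; exact: time_cube.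
have hS (j : 'I_l) : exists S : 'M[R]_n, [/\ is_trig_mx S,
    S *m S^T = increment_cov P X (time t j) (time t j.+1) & forall i, 0 <= S i i].
  apply: psd_trig_root; first exact: increment_cov_sym.
  by move=> u; apply: increment_cov_psd; apply: ctm => //; exact: ltnW.
have [S SP] := choice hS.
have [uS {}ht] := ht st no S (fun j => let: And3 _ h _ := SP j in h).
have Strig j : is_trig_mx (S j) by have [] := SP j.
have SS j : S j *m (S j)^T = increment_cov P X (time t j) (time t j.+1) by have [] := SP j.
have Sp j i : 0 < S j i i.
  have [_ _ /(_ i)] := SP j; rewrite le_eqVlt => /orP[/eqP S0|//].
  have := uS j; rewrite unitmxE det_trig// unitfE => /prodf_neq0 /(_ i isT).
  by rewrite -S0 eqxx.
pose la := Num.sqrt c / r.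
have la0 : 0 < la by rewrite divr_gt0// sqrtr_gt0.
pose Q (xi : l.-tuple (Rn R n)) := \sum_(j < l | (0 < j)%N)
  enorm ((la *: S j)^T *m (\sum_(i < l | (j <= i)%N) colv (tnth xi i))) ^+ 2.
have detS j : \det (S j) = (\det (increment_cov P X (time t j) (time t j.+1))) `^ 2^-1.
  have dS : 0 <= \det (S j) by rewrite det_trig//; apply: prodr_ge0 => i _; exact: ltW.
  by rewrite -SS det_mulmx det_tr -expr2 -powR_mulrn// -powRrM mulfV// powRr1.
have E (j : 'I_l) : \det (la *: S j) `^ (- th) =
  (r / Num.sqrt c) `^ (n%:R * th) *
  (\det (increment_cov P X (time t j) (time t j.+1))) `^ (- (th / 2)).
  rewrite detZ [LHS]powRM ?exprn_ge0 ?(ltW la0)//; last first.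
    by rewrite det_trig//; apply: prodr_ge0 => i _; exact: ltW.
  congr (_ * _).
    by rewrite powR_exprN// /la invf_div.
  by rewrite detS -powRrM; congr (_ `^ _); ring.
under eq_bigr do rewrite -E.
rewrite EFinM.
apply: le_trans (_ : (_ <= (expR ((l * n)%:R / 2))%:E *
   \int[tuple_measure (gauss R n) l]_xi (expR (- Q xi / 2))%:E)%E) _; last first.
  rewrite lee_wpmul2l ?lee_fin ?expR_ge0//.
  apply: integral_gauss_block_drop => //.
  - by move=> j; apply/is_trig_mxP => a b ab; rewrite mxE (is_trig_mxP (Strig j))// mulr0.
  - by move=> j i; rewrite mxE mulr_gt0.
apply: (@gaussian_small_ball _ _ _ P l n
  (fun j i w => tnth (X (tnth t j) w) i - tnth (X 0_k w) i)) => //.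
- move=> j i; apply: measurable_funB; apply: measurable_coord => //.
  exact: origin_in_cube.
- move=> a.
  pose u' (j : 'I_l.+1) : 'cV[R]_n :=
    if unlift ord0 j is Some j' then \col_i a j' i else - \col_i \sum_j a j i.
  have := @gX l.+1 (fun j => time t j) u' (fun j => ctm j (leq_ord j)).
  congr centered_gaussian; apply/funext => w; rewrite big_ord_recl /u' unlift_none.
  under eq_bigr => j _ do rewrite liftK /dotv.
  rewrite /dotv addrC.
  under [in RHS]eq_bigr => j _ do (under eq_bigr do rewrite mulrBr; rewrite sumrB).
  rewrite sumrB; congr (_ + _).
    by apply: eq_bigr => j _; apply: eq_bigr => i _; rewrite !mxE timeS.
  rewrite exchange_big -sumrN; apply: eq_bigr => i _.
  by rewrite !mxE mulNr mulr_suml.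
- rewrite /Q; under eq_fun do rewrite big_mkcond; apply: measurable_sum => j.
  case: (0 < j)%N => //; apply: measurable_enorm_sqr; apply: measurable_mulmx => i.
  under eq_fun do rewrite summxE big_mkcond.
  apply: measurable_sum => j'; case: (j <= j')%N => //.
  exact: (measurableT_comp (measurable_colv i) (measurable_tnth j')).
move=> xi.
pose eta (j : 'I_l) := \sum_(i < l | (j <= i)%N) colv (tnth xi i).
pose u (j : 'I_l) := r^-1 *: ((S j)^T *m eta j).
have := ht u.
rewrite (_ : (fun w => _) = (fun w => \sum_j \sum_i tnth (tnth xi j) i / r *
   (tnth (X (tnth t j) w) i - tnth (X 0_k w) i))); last first.
  apply/funext => w.
  have E1 (j : 'I_l) : dotv (u j) (invmx (S j) *m increment X (time t j) (time t j.+1) w) =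
      r^-1 * \sum_(i < l | (j <= i)%N) \sum_a tnth (tnth xi i) a *
        (tnth (X (time t j.+1) w) a - tnth (X (time t j) w) a).
    set v := increment _ _ _ _.
    have -> : dotv (u j) (invmx (S j) *m v) = ((u j)^T *m (invmx (S j) *m v)) 0 0.
      by rewrite /dotv mxE; apply: eq_bigr => i _; rewrite !mxE.
    have -> : (u j)^T *m (invmx (S j) *m v) = r^-1 *: ((eta j)^T *m v).
      rewrite /u linearZ/= trmx_mul trmxK -scalemxAl; congr (_ *: _).
      by rewrite mulmxA -(mulmxA _ (S j)) mulmxV// mulmx1.
    rewrite [LHS]mxE; congr (_ * _); rewrite mxE exchange_big; apply: eq_bigr => a _.
    rewrite [X in X * _]mxE /eta summxE mulr_suml; apply: eq_bigr => i _.
    by rewrite !mxE.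
  under eq_bigr do rewrite E1.
  rewrite -mulr_sumr (exchange_big_dep xpredT)//= mulr_sumr; apply: eq_bigr => i _.
  rewrite exchange_big mulr_sumr; apply: eq_bigr => a _ /=.
  rewrite -mulr_sumr (telescope_sumr_ord (fun j => tnth (X (time t j) w) a : R)) timeS.
  by rewrite mulrA [r^-1 * _]mulrC.
apply: le_trans; rewrite lee_fin /Q.
have -> : \sum_(j < l | (0 < j)%N) enorm ((la *: S j)^T *m eta j) ^+ 2 =
    c * \sum_(j < l | (0 < j)%N) enorm (u j) ^+ 2.
  rewrite mulr_sumr; apply: eq_bigr => j _.
  rewrite !enorm_sqr mulr_sumr; apply: eq_bigr => i _.
  rewrite /u linearZ/= -scalemxAl !mxE !exprMn /la exprVn sqr_sqrtr ?(ltW c0)//.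
  ring.
rewrite ler_wpM2l ?(ltW c0)// big_mkcond; apply: ler_sum => j _.
by case: ifP => // _; exact: sqr_ge0.
Qed.

End gaussian_field.

(** * Nearest-neighbour orderings *)

Section greedy.
Context (T : eqType) (R : realType) (dist : T -> T -> R).

Fixpoint greedy (z : seq T) : Prop :=
  if z is x :: z1 then
    (if z1 is y :: _ then forall u, u \in z1 -> dist x y <= dist x u else True) /\
    greedy z1
  else True.

Lemma nearest_exists (x : T) (s : seq T) : s != [::] ->
  exists2 y, y \in s & forall u, u \in s -> dist x y <= dist x u.
Proof.
elim: s => // a s IH _.
have [->|/IH [y ys hy]] := eqVneq s [::].
  by exists a; rewrite ?mem_seq1// => u; rewrite mem_seq1 => /eqP ->.
have [h|h] := leP (dist x a) (dist x y).
  exists a; rewrite ?mem_head// => u; rewrite inE => /predU1P[->//|/hy].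
  exact: le_trans.
exists y; first by rewrite inE ys orbT.
by move=> u; rewrite inE => /predU1P[->|/hy//]; exact: ltW.
Qed.

Lemma greedy_exists (x : T) (s : seq T) :
  exists2 s', perm_eq s' s & greedy (x :: s').
Proof.
move: {2}(size s) (erefl (size s)) => m.
elim: m x s => [|m IH] x s ss.
  by exists s => //; move/size0nil: ss => ->.
have s0 : s != [::] by rewrite -size_eq0 ss.
have [y ys hy] := nearest_exists x s0.
have [|s' s'p gs'] := IH y (rem y s); first by rewrite size_rem// ss.
have p : perm_eq (y :: s') s.
  by rewrite perm_sym (perm_trans (perm_to_rem ys))// perm_cons perm_sym.
exists (y :: s') => //; split => //= u us; apply: hy.
by rewrite -(perm_mem p).
Qed.

Lemma greedy_nth x0 (z : seq T) p j : greedy z -> (p < j)%N -> (j < size z)%N ->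
  dist (nth x0 z p) (nth x0 z p.+1) <= dist (nth x0 z p) (nth x0 z j).
Proof.
elim: z p j => // x z IH [|p] [|j]// [h gz] pj js.
  by case: z h {IH gz} js => // y z h js; apply: (h (nth x0 (y :: z) j)); apply: mem_nth.
exact: IH.
Qed.

End greedy.

Lemma nearest_ordered_permute (R : realType) k l (t : l.-tuple (Rn R k)) :
  exists s : 'S_l, nearest_ordered (permute s t).
Proof.
pose D (a b : Rn R k) := enorm (colv a - colv b).
have [z zp gz] : exists2 z, perm_eq z t & greedy D z.
  case: l t => [|l]; first by move=> t; exists [::] => //; rewrite tuple0.
  case/tupleP => x t; have [s sp gs] := greedy_exists D x t.
  by exists (x :: s) => //; rewrite perm_cons.
have sz : size (rev z) = l by rewrite size_rev (perm_size zp) size_tuple.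
have pr : perm_eq (Tuple (introT eqP sz)) t by rewrite /= perm_rev.
have [s hs] := tuple_permP pr.
exists s; move=> [//|i] [//|j] /andP[_ ij] jl.
rewrite /time /=.
have -> : tval (permute s t) = rev z by rewrite -[RHS]/(tval (Tuple (introT eqP sz))) hs.
have zl : size z = l by rewrite -sz size_rev.
rewrite !nth_rev ?zl//; [|lia|lia].
rewrite (_ : l - j.+1 = (l - j.+2).+1)%N; last by lia.
apply: (@greedy_nth _ _ D) => //; lia.
Qed.

Section measurability.
Context (R : realType) d (T : measurableType d).

Lemma measurable_integral_param d' (S : measurableType d')
    (mu : {sigma_finite_measure set T -> \bar R}) (f : S -> T -> R) :
  measurable_fun setT (fun p : S * T => f p.1 p.2) ->
  measurable_fun setT (fun s => \int[mu]_w (f s w)%:E)%E.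
Proof.
move=> mf; pose F (p : S * T) := (f p.1 p.2)%:E.
have mF : measurable_fun setT F by exact/measurable_EFinP.
under eq_fun do rewrite integralE.
apply: emeasurable_funB.
- rewrite [X in measurable_fun _ X](_ : _ = fubini_F mu F^\+%E).
    exact: measurable_fun_fubini_tonelli_F (measurable_funepos mF) (fun p => funepos_ge0 _ _).
  by apply/funext => s; apply: eq_integral => w _; rewrite !funeposE.
- rewrite [X in measurable_fun _ X](_ : _ = fubini_F mu F^\-%E).
    exact: measurable_fun_fubini_tonelli_F (measurable_funeneg mF) (fun p => funeneg_ge0 _ _).
  by apply/funext => s; apply: eq_integral => w _; rewrite !funenegE.
Qed.

Lemma measurable_det m (A : T -> 'M[R]_m) :
  (forall i j, measurable_fun setT (fun x => A x i j)) ->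
  measurable_fun setT (fun x => \det (A x)).
Proof.
move=> mA; rewrite /determinant; apply: measurable_sum => s.
apply: measurable_funM => //.
by apply: measurable_prod => i _; exact: mA.
Qed.

Lemma measurable_le_set (f : T -> R) (r : R) : measurable_fun setT f ->
  measurable [set w | f w <= r].
Proof.
move=> mf; have -> : [set w | f w <= r] = setT `&` f @^-1` `]-oo, r]%classic.
  by rewrite setTI; apply/seteqP; split => w; rewrite /= in_itv.
exact: mf.
Qed.

Lemma measurable_box_event m n (f : 'I_m -> 'I_n -> T -> R) (r : R) :
  (forall j i, measurable_fun setT (f j i)) ->
  measurable [set w | forall j i, `|f j i w| <= r].
Proof.
move=> mf.
have -> : [set w | forall j i, `|f j i w| <= r] =
    \bigcap_j \bigcap_i [set w | `|f j i w| <= r].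
  apply/seteqP; split=> w /=; first by move=> h j _ i _; exact: h.
  by move=> h j i; exact: h.
apply: fin_bigcap_measurable => [|j _]; first exact: finite_finset.
apply: fin_bigcap_measurable => [|i _]; first exact: finite_finset.
by apply: measurable_le_set; apply: measurableT_comp.
Qed.

End measurability.

Section chain.
Local Open Scope ereal_scope.
Context d (T : measurableType d) (R : realType).
Variable mu : {sigma_finite_measure set T -> \bar R}.
Variables (G : T -> T -> \bar R) (K : R).
Hypothesis G0 : forall s t, 0 <= G s t.
Hypothesis mG : measurable_fun setT (fun p : T * T => G p.1 p.2).
Hypothesis K0 : (0 <= K)%R.
Hypothesis GK : {ae mu, forall s, \int[mu]_t G s t <= K%:E}.

Fixpoint chain (s : T) (z : seq T) : \bar R :=
  if z is x :: z1 then G s x * chain x z1 else 1.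

Lemma chain_ge0 s z : 0 <= chain s z.
Proof. by elim: z s => //= x z IH s; rewrite mule_ge0. Qed.

Lemma measurable_chain m : measurable_fun setT
  (fun p : T * m.-tuple T => chain p.1 p.2).
Proof.
elim: m => [|m IH].
  rewrite [X in measurable_fun _ X](_ : _ = cst 1); first exact: measurable_cst.
  by apply/funext => -[s t] /=; rewrite tuple0.
rewrite [X in measurable_fun _ X](_ : _ = fun p : T * m.+1.-tuple T =>
    G p.1 (tnth p.2 ord0) * chain (tnth p.2 ord0) [tuple of behead p.2]); last first.
  by apply/funext => -[s t] /=; case/tupleP: t => x t; rewrite tnth0.
have m0 : measurable_fun setT (fun p : T * m.+1.-tuple T => tnth p.2 ord0).
  exact: (measurableT_comp (measurable_tnth ord0) measurable_snd).
apply: emeasurable_funM.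
  exact: (measurableT_comp mG (measurable_fun_pair measurable_fst m0)).
apply: (measurableT_comp IH (measurable_fun_pair m0 _)).
exact: (measurableT_comp (@measurable_behead _ _ _) measurable_snd).
Qed.

Lemma ae_integral_chain_le m :
  {ae mu, forall s, \int[tuple_measure mu m]_t chain s t <= (K ^+ m)%:E}.
Proof.
elim: m => [|m IH].
  apply: aeW => s; rewrite ge0_integral_tuple0//.
  rewrite [X in measurable_fun _ X](_ : _ = cst 1); first exact: measurable_cst.
  by apply/funext => t; rewrite tuple0.
apply: filterS GK => s Gs.
have ms m' : measurable_fun setT (fun t : m'.-tuple T => chain s t).
  exact: (measurableT_comp (@measurable_chain m') (measurable_fun_pair (measurable_cst s) (@measurable_id _ _ setT))).
rewrite ge0_integral_tupleS//; last by move=> t; exact: chain_ge0.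
have mG1 : measurable_fun setT (G s).
  exact: (measurableT_comp mG (measurable_fun_pair (measurable_cst s) (@measurable_id _ _ setT))).
have mA : measurable_fun setT (fun x => \int[tuple_measure mu m]_t chain x t).
  have := @measurable_fun_fubini_tonelli_F _ _ _ _ _ (tuple_measure mu m) _
    (@measurable_chain m) (fun p => chain_ge0 _ _).
  exact.
have E x : \int[tuple_measure mu m]_t chain s [tuple of x :: t] =
    G s x * \int[tuple_measure mu m]_t chain x t.
  rewrite /= ge0_integralZl//.
  - exact: (measurableT_comp (@measurable_chain m) (measurable_fun_pair (measurable_cst x) (@measurable_id _ _ setT))).
  - by move=> t _; exact: chain_ge0.
under eq_integral do rewrite E.
apply: (@le_trans _ _ (\int[mu]_x (G s x * (K ^+ m)%:E))).
  apply: ae_ge0_le_integral => //.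
  - by move=> x _; rewrite mule_ge0// integral_ge0// => t _; exact: chain_ge0.
  - exact: emeasurable_funM.
  - by move=> x _; rewrite mule_ge0// lee_fin exprn_ge0.
  - exact: emeasurable_funM.
  - by apply: filterS IH => x hx _; rewrite lee_wpmul2l.
rewrite ge0_integralZr//; last by rewrite lee_fin exprn_ge0.
rewrite exprS EFinM lee_wpmul2r// lee_fin exprn_ge0//.
Qed.

Lemma integral_chain_le m (A : set T) : measurable A ->
  \int[tuple_measure mu m.+1]_t ((\1_A (thead t))%:E * chain (thead t) (behead t)) <=
  mu A * (K ^+ m)%:E.
Proof.
move=> mA.
have mth : measurable_fun setT (fun t : m.+1.-tuple T => thead t).
  exact: measurable_tnth.
rewrite ge0_integral_tupleS; last 2 first.
- apply: emeasurable_funM.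
    apply/measurable_EFinP; exact: (measurableT_comp (measurable_indic mA) mth).
  have := measurableT_comp (@measurable_chain m) (measurable_fun_pair mth (@measurable_behead _ _ _)).
  exact.
- by move=> t; rewrite mule_ge0 ?lee_fin// chain_ge0.
have mc : measurable_fun setT (fun x => \int[tuple_measure mu m]_t chain x t).
  have := @measurable_fun_fubini_tonelli_F _ _ _ _ _ (tuple_measure mu m) _
    (@measurable_chain m) (fun p => chain_ge0 _ _).
  exact.
have mi : measurable_fun setT (fun x => (\1_A x)%:E : \bar R) by exact/measurable_EFinP.
have E x : \int[tuple_measure mu m]_t ((\1_A (thead [tuple of x :: t]))%:E *
    chain (thead [tuple of x :: t]) (behead [tuple of x :: t])) =
    (\1_A x)%:E * \int[tuple_measure mu m]_t chain x t.
  rewrite -ge0_integralZl//.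
  - exact: (measurableT_comp (@measurable_chain m) (measurable_fun_pair (measurable_cst x) (@measurable_id _ _ setT))).
  - by move=> t _; exact: chain_ge0.
under eq_integral do rewrite E.
apply: (@le_trans _ _ (\int[mu]_x ((\1_A x)%:E * (K ^+ m)%:E))).
  apply: ae_ge0_le_integral => //.
  - by move=> x _; rewrite mule_ge0 ?lee_fin// integral_ge0// => t _; exact: chain_ge0.
  - exact: emeasurable_funM.
  - by move=> x _; rewrite mule_ge0// lee_fin// exprn_ge0.
  - exact: emeasurable_funM.
  - by apply: filterS (ae_integral_chain_le m) => x hx _; rewrite lee_wpmul2l// lee_fin.
rewrite ge0_integralZr//; last by rewrite lee_fin exprn_ge0.
by rewrite integral_indic// setIT.
Qed.

End chain.

Lemma ae_permute d (T : measurableType d) (R : realType)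
    (mu : {sigma_finite_measure set T -> \bar R}) n (Q : n.-tuple T -> Prop) :
  {ae tuple_measure mu n, forall t, Q t} ->
  {ae tuple_measure mu n, forall t, forall s : 'S_n, Q (permute s t)}.
Proof.
move=> H.
have Hs (s : 'S_n) : {ae tuple_measure mu n, forall t, Q (permute s t)}.
  case: H => N [mN N0 QN]; exists (permute s @^-1` N); split.
  - by rewrite -[X in measurable X]setTI; exact: measurable_permute.
  - by rewrite -[LHS]/(pushforward (tuple_measure mu n) (permute s) N) pushforward_permute.
  - by move=> t /= h; apply: QN.
have : {ae tuple_measure mu n, forall t, forall m (s : 'S_n), unpickle m = Some s -> Q (permute s t)}.
  apply/ae_foralln => m; case E : (@unpickle 'S_n m) => [s|]; last by apply: aeW => t s.
  by apply: filterS (Hs s) => t ht s' [<-].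
by apply: filterS => t ht s; apply: (ht (pickle s)); rewrite pickleK.
Qed.

(** * Moments of the sojourn time *)

Lemma chain_prod d (T : measurableType d) (R : realType) (G : T -> T -> \bar R) x0 s z :
  chain G s z =
  (\big[mule/1]_(i < size z) G (nth x0 (s :: z) i) (nth x0 (s :: z) i.+1))%E.
Proof.
elim: z s => [|x z IH] s /=; first by rewrite big_ord0.
by rewrite big_ord_recl /= IH.
Qed.

Section lebesgue_cube.
Context (R : realType) (k : nat).

Lemma lebesgue_unit_cube : lebesgue_Rn R k (unit_cube R k) = 1%E.
Proof.
have -> : unit_cube R k = rectangle (fun=> ([set` `[0, 1]] : set (measurableTypeR R))).
  by apply/seteqP; split=> t h i; have := h i; rewrite /= in_itv.
rewrite tuple_measure_rectangle => [|i]; last exact: measurable_itv.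
rewrite big1// => i _; have := lebesgue_measure_itv (`[0, 1] : interval R).
by rewrite /= lte_fin ltr01 sube0.
Qed.

End lebesgue_cube.

Lemma chain_time (R : realType) k (G : Rn R k -> Rn R k -> \bar R) m
    (u : m.+1.-tuple (Rn R k)) :
  chain G (thead u) (behead u) =
  (\big[mule/1]_(i < m) G (time u i.+1) (time u i.+2))%E.
Proof.
case/tupleP: u => x t; rewrite theadE /= (chain_prod _ (origin R k)).
have E i : time [tuple of x :: t] i.+1 = nth (origin R k) (x :: t) i by [].
under [in RHS]eq_bigr do rewrite !E.
by rewrite size_tuple.
Qed.

Section occupation_moments.
Context (R : realType) (d : measure_display) (Omega : measurableType d).
Variables (P : probability Omega R) (k n : nat) (X : Rn R k -> Omega -> Rn R n).
Variable phi : Rn R k -> Rn R n.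
Local Notation cube := (unit_cube R k).
Local Notation "0_k" := (origin R k).
Local Notation leb := (lebesgue_Rn R k).

Hypothesis mX : measurable_fun (cube `*` [set: Omega]) (fun p => X p.1 p.2).
Hypothesis gX : centered_gaussian_field P X.
Hypothesis X0 : {ae P, forall w, X 0_k w = origin R n}.
Hypothesis mphi : measurable_fun cube phi.
Hypothesis lnd : locally_nondeterministic P X.

(* [X] and [phi] are only measurable on the cube; outside of it they are
   replaced by 0. *)
Definition extend_field t w : Rn R n :=
  [tuple if t \in cube then (tnth (X t w) i : R) else 0 | i < n].

Definition extend_fun t : Rn R n :=
  [tuple if t \in cube then (tnth (phi t) i : R) else 0 | i < n].

Lemma extend_fieldE t w : cube t -> extend_field t w = X t w.
Proof. by move=> ct; apply: eq_from_tnth => i; rewrite tnth_mktuple mem_set. Qed.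

Lemma extend_funE t : cube t -> extend_fun t = phi t.
Proof. by move=> ct; apply: eq_from_tnth => i; rewrite tnth_mktuple mem_set. Qed.

Lemma measurable_extend_field i :
  measurable_fun setT (fun p => tnth (extend_field p.1 p.2) i : R).
Proof.
have mC : measurable (cube `*` [set: Omega]).
  by apply: measurableX => //; exact: measurable_unit_cube.
have mf : measurable_fun (cube `*` [set: Omega]) (fun p => tnth (X p.1 p.2) i : R).
  exact: (measurableT_comp (measurable_tnth i) mX).
have /(measurable_restrictT _ mC) := mf.
congr measurable_fun; apply/funext => -[t w]; rewrite patchE tnth_mktuple /=.
congr (if _ then _ else _).
by apply/idP/idP; rewrite !inE/= => // -[].
Qed.

Lemma measurable_extend_fun i : measurable_fun setT (fun t => tnth (extend_fun t) i : R).
Proof.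
have mf : measurable_fun cube (fun t => tnth (phi t) i : R).
  exact: (measurableT_comp (measurable_tnth i) mphi).
have /(measurable_restrictT _ (measurable_unit_cube R k)) := mf.
by congr measurable_fun; apply/funext => t; rewrite patchE tnth_mktuple.
Qed.

Lemma increment_cov_extend s t : cube s -> cube t ->
  increment_cov P extend_field s t = increment_cov P X s t.
Proof.
move=> cs ct; apply/matrixP => i j; rewrite !mxE; congr (fine (covariance P _ _));
  by apply/funext => w; rewrite /increment !extend_fieldE.
Qed.

Lemma measurable_det_cov : measurable_fun setT
  (fun p : Rn R k * Rn R k => \det (increment_cov P extend_field p.1 p.2)).
Proof.
pose inc i (p : Rn R k * Rn R k) w : R := increment extend_field p.1 p.2 w i 0.
have minc i : measurable_fun setT (fun q : (Rn R k * Rn R k) * Omega => inc i q.1 q.2).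
  rewrite /inc; under eq_fun do rewrite !mxE.
  have mp (f : Rn R k * Rn R k -> Rn R k) : measurable_fun setT f -> measurable_fun setT
      (fun q : (Rn R k * Rn R k) * Omega => tnth (extend_field (f q.1) q.2) i : R).
    move=> mf.
    exact: (measurableT_comp (measurable_extend_field i)
      (measurable_fun_pair (measurableT_comp mf measurable_fst) measurable_snd)).
  by apply: measurable_funB; apply: mp.
have mE i : measurable_fun setT (fun p => fine (\int[P]_w (inc i p w)%:E)).
  by apply: measurableT_comp => //; exact: (@measurable_integral_param _ _ _ _ _ P (inc i)).
apply: measurable_det => i j; under eq_fun do rewrite mxE unlock unlock.
apply: measurableT_comp => //.
apply: (@measurable_integral_param _ _ _ _ _ P
  (fun p w => (inc i p w - fine (\int[P]_w (inc i p w)%:E)) *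
              (inc j p w - fine (\int[P]_w (inc j p w)%:E)))).
by apply: measurable_funM; apply: measurable_funB => //;
  exact: (measurableT_comp (mE _) measurable_fst).
Qed.

Definition cov_weight (a : R) (s t : Rn R k) : R :=
  \1_cube s * \1_cube t * (\det (increment_cov P extend_field s t)) `^ (- a).

Lemma cov_weight_ge0 a s t : 0 <= cov_weight a s t.
Proof. by rewrite !mulr_ge0// powR_ge0. Qed.

Lemma measurable_cov_weight a :
  measurable_fun setT (fun p => cov_weight a p.1 p.2).
Proof.
have mi : measurable_fun setT (\1_cube : Rn R k -> R).
  exact: measurable_indic (measurable_unit_cube R k).
apply: measurable_funM; first apply: measurable_funM.
- exact: (measurableT_comp mi measurable_fst).
- exact: (measurableT_comp mi measurable_snd).
- apply: (measurableT_comp (measurable_powR (- a))).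
  exact: measurable_det_cov.
Qed.

Definition hit_set (Q : set (Rn R k)) (x : 'I_n -> R) (r : R) : set (Rn R k * Omega) :=
  [set p | Q p.1 /\ forall i,
    `|(tnth (extend_field p.1 p.2) i : R) + tnth (extend_fun p.1) i - x i| <= r].

Lemma measurable_hit_set Q x r : measurable Q -> measurable (hit_set Q x r).
Proof.
move=> mQ.
pose f (j : 'I_1) i (p : Rn R k * Omega) : R :=
  tnth (extend_field p.1 p.2) i + tnth (extend_fun p.1) i - x i.
have -> : hit_set Q x r = (Q `*` setT) `&` [set p | forall j i, `|f j i p| <= r].
  apply/seteqP; split=> -[t w] /=; first by move=> [h1 h2]; split.
  by move=> [[h1 _] h2]; split => // i; exact: (h2 ord0 i).
apply: measurableI; first exact: measurableX.
apply: measurable_box_event => j i; apply: measurable_funB => //.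
apply: measurable_funD; first exact: measurable_extend_field.
exact: (measurableT_comp (measurable_extend_fun i) measurable_fst).
Qed.

Definition sojourn Q x r (w : Omega) : \bar R :=
  (\int[leb]_t (\1_(hit_set Q x r) (t, w))%:E)%E.

Lemma sojourn_ge0 Q x r w : (0 <= sojourn Q x r w)%E.
Proof. by apply: integral_ge0 => t _; rewrite lee_fin. Qed.

Lemma measurable_hit_swap Q x r : measurable Q -> measurable_fun setT
  (fun p : Omega * Rn R k => \1_(hit_set Q x r) (p.2, p.1) : R).
Proof.
move=> mQ; have mi := measurable_indic (R := R) (D := setT) (measurable_hit_set x r mQ).
exact: (measurableT_comp mi (measurable_fun_pair measurable_snd measurable_fst)).
Qed.

Lemma measurable_hit_time Q x r w : measurable Q ->
  measurable_fun setT (fun t => \1_(hit_set Q x r) (t, w) : R).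
Proof.
move=> mQ; have mi := measurable_indic (R := R) (D := setT) (measurable_hit_set x r mQ).
exact: (measurableT_comp mi (measurable_fun_pair (@measurable_id _ _ setT) (measurable_cst w))).
Qed.

Lemma measurable_sojourn Q x r : measurable Q -> measurable_fun setT (sojourn Q x r).
Proof.
move=> mQ; exact: (@measurable_integral_param _ _ _ _ _ leb
  (fun w t => \1_(hit_set Q x r) (t, w) : R) (measurable_hit_swap x r mQ)).
Qed.

Lemma sojourn_fin_num Q x r w : measurable Q -> Q `<=` cube ->
  sojourn Q x r w \is a fin_num.
Proof.
move=> mQ Qc; rewrite ge0_fin_numE ?sojourn_ge0//.
apply: (@le_lt_trans _ _ (\int[leb]_t (\1_cube t)%:E)%E).
  apply: ge0_le_integral => //.
  - by apply/measurable_EFinP; exact: measurable_hit_time.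
  - by apply/measurable_EFinP; exact: measurable_indic (measurable_unit_cube R k).
  - move=> t _; rewrite lee_fin !indicE ler_nat.
    case: (boolP ((t, w) \in _)) => // /set_mem [/Qc ct _].
    by rewrite mem_set.
rewrite integral_indic ?setIT//; last exact: measurable_unit_cube.
by rewrite [X in (X < _)%E](lebesgue_unit_cube R k) ltry.
Qed.

Variables (th K : R).
Hypotheses (th01 : 0 <= th <= 1) (K0 : 0 <= K).
Hypothesis HK : {ae leb, forall s, (\int[leb]_t (cov_weight (th / 2) s t)%:E <= K%:E)%E}.

Lemma moment_bound (m : nat) : (0 < m)%N ->
  exists eps C : R, [/\ 0 < eps <= 1, 0 <= C &
    forall (Q : set (Rn R k)) (a : Rn R k), measurable Q ->
      (forall i, 0 <= (tnth a i : R) /\ (tnth a i : R) + eps <= 1) ->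
      (forall t, Q t -> forall i, (tnth a i : R) <= tnth t i <= (tnth a i : R) + eps) ->
    forall (x : 'I_n -> R) (r : R), 0 < r ->
      (\int[P]_w ((fine (sojourn Q x r w)) ^+ m.+1)%:E <=
       (C * (r `^ (n%:R * th)) ^+ m)%:E)%E].
Proof.
move=> m0; pose l := m.+1.
have [c [eps [c0 eps01 H]]] := lnd_small_ball gX lnd th01 (l := l) (ltac:(by rewrite /l; lia)).
pose E0 : R := expR ((l * n)%:R / 2).
exists eps, (l`!%:R * E0 * ((c^-1 `^ (n%:R * th)) * K) ^+ m).
split => //.
  by rewrite !mulr_ge0 ?expR_ge0 ?exprn_ge0 ?mulr_ge0 ?powR_ge0.
move=> Q a mQ ha hQ x r r0.
pose rho := (r / c) `^ (n%:R * th).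
have rho0 : 0 <= rho by exact: powR_ge0.
pose G s t : \bar R := (rho * cov_weight (th / 2) s t)%:E.
have G0 s t : (0 <= G s t)%E by rewrite lee_fin mulr_ge0// cov_weight_ge0.
have mw := measurable_cov_weight (th / 2).
have mG : measurable_fun setT (fun p => G p.1 p.2).
  by apply/measurable_EFinP; apply: measurable_funM.
have GK : {ae leb, forall s, (\int[leb]_t G s t <= (rho * K)%:E)%E}.
  apply: filterS HK => s hs; rewrite /G; under eq_integral do rewrite EFinM.
  rewrite ge0_integralZl//.
  - by rewrite EFinM lee_wpmul2l// lee_fin.
  - apply/measurable_EFinP.
    exact: (measurableT_comp mw (measurable_fun_pair (measurable_cst s) (@measurable_id _ _ setT))).
  - by move=> t _; rewrite lee_fin cov_weight_ge0.
pose CH (u : l.-tuple (Rn R k)) := ((\1_cube (thead u))%:E * chain G (thead u) (behead u))%E.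
have CH0 u : (0 <= CH u)%E by rewrite mule_ge0 ?lee_fin// chain_ge0.
have mCH : measurable_fun setT CH.
  apply: emeasurable_funM.
    apply/measurable_EFinP.
    exact: (measurableT_comp (measurable_indic (measurable_unit_cube R k)) (measurable_tnth ord0)).
  have := measurableT_comp (@measurable_chain _ _ _ G mG m)
    (measurable_fun_pair (measurable_tnth ord0) (@measurable_behead _ _ m)).
  exact.
have ICH : (\int[tuple_measure leb l]_u CH u <= ((rho * K) ^+ m)%:E)%E.
  have rK0 : 0 <= rho * K by exact: mulr_ge0.
  have := @integral_chain_le _ _ _ leb G _ G0 mG rK0 GK m _ (measurable_unit_cube R k).
  by rewrite lebesgue_unit_cube mul1e.
pose F (w : Omega) (t : l.-tuple (Rn R k)) : \bar R :=
  (\prod_(j < l) \1_(hit_set Q x r) (tnth t j, w))%:E.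
have F0 w t : (0 <= F w t)%E by rewrite lee_fin; apply: prodr_ge0.
have mF : measurable_fun setT (fun p => F p.1 p.2).
  apply/measurable_EFinP; apply: measurable_prod => j _.
  exact: (measurableT_comp (measurable_hit_swap x r mQ)
    (measurable_fun_pair measurable_fst (measurableT_comp (measurable_tnth j) measurable_snd))).
have Qcube : Q `<=` cube.
  move=> t Qt i; have /andP[h1 h2] := hQ t Qt i; have [h3 h4] := ha i.
  by rewrite (le_trans h3 h1) (le_trans h2 h4).
have -> : (\int[P]_w ((fine (sojourn Q x r w)) ^+ l)%:E =
    \int[P]_w \int[tuple_measure leb l]_t F w t)%E.
  apply: eq_integral => w _.
  rewrite (@ge0_integral_tuple_prodR _ _ _ leb l (fun _ t => \1_(hit_set Q x r) (t, w))
    (fun=> fine (sojourn Q x r w)))//.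
  - by rewrite prodr_const card_ord.
  - by move=> i; exact: measurable_hit_time.
  - by move=> i; rewrite fineK//; exact: sojourn_fin_num.
rewrite (fubini_tonelli (m2 := tuple_measure leb l) (fun p => F p.1 p.2))//=.
apply: (@le_trans _ _ (\int[tuple_measure leb l]_t
    (\sum_(s : 'S_l) E0%:E * CH (permute s t)))%E).
  apply: ae_ge0_le_integral => //.
  - by move=> t _; apply: integral_ge0.
  - exact: (measurable_fun_fubini_tonelli_G (m1 := P) (fun p => F p.1 p.2)).
  - by move=> t _; apply: sume_ge0 => s _; rewrite mule_ge0// lee_fin expR_ge0.
  - apply: emeasurable_sum => s; apply: emeasurable_funM => //.
    exact: (measurableT_comp mCH (@measurable_permute _ _ _ s)).
  apply: filterS (ae_permute H) => t ht _.
  have [Qt|nQt] := pselect (forall j, Q (tnth t j)); last first.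
    rewrite integral0_eq; first by apply: sume_ge0 => s _; rewrite mule_ge0// lee_fin expR_ge0.
    move=> w _; move/existsNP : nQt => [j nQj].
    rewrite /F (bigD1 j)//= indicE memNset ?mul0r//.
    by move=> -[].
  have [s hs] := nearest_ordered_permute t.
  pose u := permute s t.
  have Qu j : Q (tnth u j) by rewrite tnth_mktuple.
  have cu j : cube (tnth u j) := Qcube _ (Qu j).
  have su : in_subcube eps u by exists a; split => // j i; exact: hQ.
  have := ht s su hs r (fun j i => x i - tnth (phi (tnth u j)) i) r0.
  set A := [set w | _]; rewrite -/E0 => PA.
  have mA : measurable A.
    apply: (@measurable_box_event _ _ _ l n (fun j i w =>
      (tnth (X (tnth u j) w) i : R) - tnth (X 0_k w) i - (x i - tnth (phi (tnth u j)) i))) => j i.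
    apply: measurable_funB => //.
    by apply: measurable_funB; apply: (measurable_coord gX) => //; exact: origin_in_cube.
  have FA : (\int[P]_w F w t <= P A)%E.
    rewrite -[leRHS]mul1e -(setIT A) -integral_cst ?setIT// integral_mkcond.
    apply: ae_ge0_le_integral => //.
    - have := measurableT_comp mF (measurable_fun_pair (@measurable_id _ _ setT) (measurable_cst t)).
      exact.
    - by move=> w _; rewrite patchE; case: ifP.
    - by apply/(measurable_restrictT _ mA)/measurable_cst.
    - apply: filterS X0 => w Xw0 _.
      have [h|/existsNP[j hj]] := pselect (forall j, hit_set Q x r (tnth t j, w)); last first.
        rewrite /F (bigD1 j)//= indicE memNset// mul0r.
        by rewrite patchE; case: ifP.
      rewrite patchE mem_set /=.
        by rewrite lee_fin; apply: prodr_ile1 => j _; rewrite indicE; case: (_ \in _); rewrite ?lexx ?ler01.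
      move=> j i; have [_ /(_ i)] := h (s j).
      rewrite /= Xw0 tnth_nseq subr0.
      have -> : tnth t (s j) = tnth u j by rewrite tnth_mktuple.
      by rewrite extend_fieldE// extend_funE// opprB addrA.
  apply: (le_trans FA); apply: (le_trans PA).
  rewrite (bigD1 s)//= -[leLHS]adde0; apply: leeD; last first.
    by apply: sume_ge0 => s' _; rewrite mule_ge0// lee_fin expR_ge0.
  rewrite EFinM lee_wpmul2l ?lee_fin ?expR_ge0// -/u.
  rewrite /CH indicE mem_set ?mul1e; last exact: (cu ord0).
  rewrite chain_time big_mkcond big_ord_recl /= mul1r -prodEFin.
  rewrite le_eqVlt; apply/orP; left; apply/eqP.
  apply: eq_bigr => i _; rewrite /G /bump /= add1n; congr (_ * _)%:E.
  have il := ltn_ord i.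
  have ci j : (j <= l)%N -> cube (time u j) by move=> jl; exact: time_cube.
  have c1 : cube (time u i.+1) by exact: ci i.+1 (leqW il).
  have c2 : cube (time u i.+2) by exact: ci i.+2 il.
  by rewrite /cov_weight !indicE !mem_set// !mul1r increment_cov_extend.
rewrite ge0_integral_sum//; last 2 first.
- move=> s; apply: emeasurable_funM => //.
  exact: (measurableT_comp mCH (@measurable_permute _ _ _ s)).
- by move=> s t _; rewrite mule_ge0// lee_fin expR_ge0.
have E2 (s : 'S_l) : (\int[tuple_measure leb l]_t (E0%:E * CH (permute s t)) <=
    E0%:E * ((rho * K) ^+ m)%:E)%E.
  rewrite ge0_integralZl//; last 2 first.
  - exact: (measurableT_comp mCH (@measurable_permute _ _ _ s)).
  - by rewrite lee_fin expR_ge0.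
  by rewrite ge0_integral_permute// lee_wpmul2l// lee_fin expR_ge0.
apply: (le_trans (lee_sum _ (fun s _ => E2 s))).
rewrite -EFinM sumEFin lee_fin sumr_const card_Sn.
have -> : rho = r `^ (n%:R * th) * c^-1 `^ (n%:R * th).
  by rewrite -powRM ?invr_ge0 ?ltW.
by rewrite -mulr_natl !exprMn; lra.
Qed.

End occupation_moments.

(** * Uniform Frostman bound *)

Lemma powR_expr (R : realType) (x a : R) N : 0 <= x ->
  (x ^+ N) `^ a = (x `^ a) ^+ N.
Proof.
move=> x0; rewrite -(powR_mulrn N x0) -(powR_mulrn N (powR_ge0 x a)).
by rewrite -!powRrM mulrC.
Qed.

Section dyadic_frostman.
Context (R : realType) d (Omega : measurableType d) (P : probability Omega R).
Variables (n l m : nat) (q q1 C : R) (S : ('I_n -> R) -> R -> Omega -> R).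
Hypothesis l0 : (0 < l)%N.
Hypothesis C0 : 0 <= C.
Hypothesis mS : forall x r, measurable_fun setT (S x r).
Hypothesis S0 : forall x r w, 0 <= S x r w.
Hypothesis S_mono : forall x y r r' w,
  (forall i, `|y i - x i| + r <= r') -> S y r w <= S x r' w.
Hypothesis hS : forall x r, 0 < r ->
  (\int[P]_w ((S x r w) ^+ l)%:E <= (C * (r `^ q) ^+ m)%:E)%E.
Hypothesis gap : n%:R + q1 * l%:R < q * m%:R.

Local Notation h N := ((2^-1 : R) ^+ N).

Let h0 N : 0 < h N. Proof. by rewrite exprn_gt0. Qed.

Let grid_size (M N : nat) := (2 * M * 2 ^ N).+1.

Let grid (M N : nat) (v : {ffun 'I_n -> 'I_(grid_size M N)}) (i : 'I_n) : R :=
  - M%:R + (v i)%:R * h N.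

Let grid_near (M N : nat) (y : 'I_n -> R) : (forall i, `|y i| <= M%:R) ->
  exists v : {ffun 'I_n -> 'I_(grid_size M N)}, forall i, `|y i - grid v i| <= h N.
Proof.
move=> yM.
have hex (i : 'I_n) : exists v : 'I_(grid_size M N),
    `|y i - (- M%:R + v%:R * h N)| <= h N.
  have := yM i; rewrite ler_norml => /andP[y1 y2].
  have z0 : 0 <= (y i + M%:R) * 2 ^+ N by rewrite mulr_ge0 ?exprn_ge0//; lra.
  have /andP[t1 t2] := truncn_itv z0.
  set t := Num.truncn _ in t1 t2.
  have hh : 2 ^+ N * h N = 1 by rewrite -exprMn divff ?expr1n.
  have tL : (t < grid_size M N)%N.
    rewrite ltnS -(ler_nat R) (le_trans t1)// natrM natrM natrX ler_wpM2r ?exprn_ge0//.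
    lra.
  exists (Ordinal tL) => /=.
  have e1 : y i = - M%:R + (y i + M%:R) * 2 ^+ N * h N by rewrite -mulrA hh; ring.
  rewrite [X in `|X - _|]e1 opprD addrACA subrr add0r -mulrBl.
  rewrite normrM (ger0_norm (ltW (h0 N))) ler_piMl ?(ltW (h0 N))//.
  by move: t2; rewrite -natr1 => t2; rewrite ger0_norm ?subr_ge0//; lra.
have [f hf] := choice hex.
exists (finfun f) => i; rewrite /grid ffunE; exact: hf.
Qed.

Let W (M N : nat) (w : Omega) : R :=
  \sum_(v : {ffun 'I_n -> 'I_(grid_size M N)})
     (h N `^ (- q1)) ^+ l * (S (grid v) (2 * h N) w) ^+ l.

Let W0 M N w : 0 <= W M N w.
Proof. by apply: sumr_ge0 => v _; rewrite mulr_ge0 ?exprn_ge0 ?powR_ge0. Qed.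

Let mW M N : measurable_fun setT (W M N).
Proof.
by apply: measurable_sum => v; apply: measurable_funM => //; exact: measurable_funX.
Qed.

Let kappa := q * m%:R - (n%:R + q1 * l%:R).

Let W_le M : exists2 B : R, 0 <= B & forall N,
  (\int[P]_w (W M N w)%:E <= (B * (2^-1 `^ kappa) ^+ N)%:E)%E.
Proof.
exists ((2 * M + 1)%:R ^+ n * C * (2 `^ q) ^+ m).
  by rewrite !mulr_ge0 ?exprn_ge0 ?powR_ge0.
move=> N.
under eq_integral do rewrite -sumEFin.
rewrite ge0_integral_sum//; last 2 first.
- move=> v; apply/measurable_EFinP; apply: measurable_funM => //.
  exact: measurable_funX.
- by move=> v w _; rewrite lee_fin mulr_ge0 ?exprn_ge0 ?powR_ge0.
apply: (@le_trans _ _ (\sum_(v : {ffun 'I_n -> 'I_(grid_size M N)})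
    ((h N `^ (- q1)) ^+ l * (C * ((2 * h N) `^ q) ^+ m))%:E)%E).
  apply: lee_sum => v _.
  under eq_integral do rewrite EFinM.
  rewrite ge0_integralZl//; last 2 first.
  - by apply/measurable_EFinP; exact: measurable_funX.
  - by move=> w _; rewrite lee_fin exprn_ge0.
  rewrite [in leRHS]EFinM lee_wpmul2l ?lee_fin ?exprn_ge0 ?powR_ge0//.
  by apply: hS; rewrite mulr_gt0.
rewrite sumEFin lee_fin sumr_const card_ffun !card_ord -[leLHS]mulr_natl.
have hN := h0 N; have hN0 := ltW hN.
have Lle : (grid_size M N ^ n)%:R <= (2 * M + 1)%:R ^+ n * (h N `^ (- n%:R)) :> R.
  rewrite natrX powRN powR_mulrn// -exprVn -exprMn lerXn2r ?nnegrE ?mulr_ge0 ?invr_ge0//.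
  have -> : (grid_size M N)%:R = 2 * M%:R * 2 ^+ N + 1 :> R.
    by rewrite /grid_size -natr1 !natrM natrX.
  have -> : (2 * M + 1)%:R / h N = 2 * M%:R * 2 ^+ N + 2 ^+ N :> R.
    by rewrite exprVn invrK natrD natrM; ring.
  by rewrite lerD2l exprn_ege1// ler1n.
apply: (le_trans (ler_wpM2r _ Lle)).
  by rewrite !mulr_ge0 ?exprn_ge0 ?powR_ge0.
have hp a j : (h N `^ a) ^+ j = h N `^ (a * j%:R).
  by rewrite -(powR_mulrn j (powR_ge0 _ a)) -powRrM.
rewrite (powRM _ _ hN0)// exprMn !hp.
have -> : (2^-1 `^ kappa) ^+ N = h N `^ kappa.
  by rewrite powR_expr ?invr_ge0.
rewrite /kappa.
have -> : q * m%:R - (n%:R + q1 * l%:R) = - n%:R + (- q1 * l%:R + q * m%:R) by ring.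
have hN' : h N != 0 by rewrite gt_eqF.
rewrite !powRD ?hN' ?implybT//.
by rewrite le_eqVlt; apply/orP; left; apply/eqP; ring.
Qed.

Let z := 2^-1 `^ kappa.

Let z01 : 0 <= z < 1.
Proof.
rewrite powR_ge0/= /z; have k0 : 0 < kappa by rewrite subr_gt0.
have := @gt0_ltr_powR R kappa k0 2^-1 1.
by rewrite powR1; apply; rewrite ?nnegrE ?in_itv//=; lra.
Qed.

Let geometric_lty (B : R) : (\sum_(0 <= N <oo) (B * z ^+ N)%:E < +oo)%E.
Proof.
have /andP[z0 z1] := z01.
have zn : `|z| < 1 by rewrite ger0_norm.
have H := @cvg_geometric_series R B z zn.
have -> : (\sum_(0 <= N <oo) (B * z ^+ N)%:E = (B * (1 - z)^-1)%:E)%E; last by rewrite ltry.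
apply/cvg_lim => //.
under eq_fun do rewrite sumEFin.
by apply: cvg_EFin; [exact: nearW|exact: H].
Qed.

Lemma dyadic_frostman (M : nat) : {ae P, forall w, exists2 K : R, 0 <= K &
  forall N (y : 'I_n -> R), (forall i, `|y i| <= M%:R) ->
    S y (h N) w <= K * h N `^ q1}.
Proof.
have [B B0 hB] := W_le M.
pose V w := (\sum_(0 <= N <oo) (W M N w)%:E)%E.
have mV : measurable_fun setT V.
  apply: ge0_emeasurable_sum => [N w _ _|N _]; first by rewrite lee_fin.
  exact/measurable_EFinP.
have V0 w : (0 <= V w)%E by apply: nneseries_ge0 => N _ _; rewrite lee_fin.
have Voo : (\int[P]_w V w < +oo)%E.
  rewrite integral_nneseries//;
    [|by move=> N; exact/measurable_EFinP|by move=> N w _; rewrite lee_fin].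
  apply: le_lt_trans (geometric_lty B); apply: lee_nneseries => // N _.
  by move=> _; apply: integral_ge0 => w _; rewrite lee_fin.
have iV : P.-integrable setT V.
  apply/integrableP; split => //.
  by under eq_integral do rewrite gee0_abs//.
apply: filterS (integrable_ae measurableT iV) => w /(_ I) Vfin.
pose K := fine (V w) + 1.
have Vw0 : 0 <= fine (V w) by rewrite fine_ge0.
exists K => [|N y yM]; first by rewrite /K; lra.
have [v hv] := grid_near N yM.
set a := h N `^ q1.
have a0 : 0 < a by rewrite powR_gt0.
have sS : S y (h N) w <= S (grid v) (2 * h N) w.
  by apply: S_mono => i; rewrite mulr_natl mulr2n lerD2r.
apply: (le_trans sS).
set s := S _ _ _.
have sV : (a^-1) ^+ l * s ^+ l <= fine (V w).
  rewrite -lee_fin fineK//.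
  apply: (@le_trans _ _ (W M N w)%:E).
    rewrite lee_fin /W (bigD1 v)//= -powRN -/a -/s lerDl; apply: sumr_ge0 => v' _.
    by rewrite mulr_ge0 ?exprn_ge0 ?powR_ge0.
  rewrite /V (nneseries_split 0 N.+1); last by move=> k _; rewrite lee_fin.
  rewrite add0n big_nat_recr//= -addeA addeCA leeDl// adde_ge0//.
    by apply: sume_ge0 => k _; rewrite lee_fin.
  by apply: nneseries_ge0 => k _ _; rewrite lee_fin.
have : (s / a) ^+ l <= K ^+ l.
  rewrite exprMn mulrC (le_trans sV)// (le_trans (_ : _ <= K))//; first by rewrite /K; lra.
  by rewrite ler_eXnr// /K; lra.
rewrite ler_pXn2r ?nnegrE ?divr_ge0 ?(ltW a0) ?S0//; last by rewrite /K; lra.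
by rewrite ler_pdivrMr.
Qed.

End dyadic_frostman.

Lemma ae_forall_countable d (T : measurableType d) (R : realType)
    (mu : {measure set T -> \bar R}) (I : countType) (Q : I -> T -> Prop) :
  (forall i, {ae mu, forall x, Q i x}) -> {ae mu, forall x, forall i, Q i x}.
Proof.
move=> H.
have : {ae mu, forall x, forall m i, unpickle m = Some i -> Q i x}.
  apply/ae_foralln => m; case E : (@unpickle I m) => [i|]; last by apply: aeW => x i.
  by apply: filterS (H i) => x hx i' [<-].
by apply: filterS => x hx i; apply: (hx (pickle i)); rewrite pickleK.
Qed.

Section occupation_frostman.
Context (R : realType) (d : measure_display) (Omega : measurableType d).
Variables (P : probability Omega R) (k n : nat) (X : Rn R k -> Omega -> Rn R n).
Variable phi : Rn R k -> Rn R n.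
Local Notation cube := (unit_cube R k).
Local Notation "0_k" := (origin R k).
Local Notation leb := (lebesgue_Rn R k).
Local Notation soj := (sojourn X phi).

Hypothesis mX : measurable_fun (cube `*` [set: Omega]) (fun p => X p.1 p.2).
Hypothesis gX : centered_gaussian_field P X.
Hypothesis X0 : {ae P, forall w, X 0_k w = origin R n}.
Hypothesis mphi : measurable_fun cube phi.
Hypothesis lnd : locally_nondeterministic P X.

Lemma sojourn_mono Q x y r r' w : measurable Q ->
  (forall i, `|y i - x i| + r <= r') -> (soj Q y r w <= soj Q x r' w)%E.
Proof.
move=> mQ h; apply: ge0_le_integral => //.
- by apply/measurable_EFinP; exact: measurable_hit_time.
- by apply/measurable_EFinP; exact: measurable_hit_time.
- move=> t _; rewrite lee_fin !indicE ler_nat.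
  case: (boolP ((t, w) \in hit_set _ _ _ y r)) => // /set_mem [/= Qt ht].
  rewrite mem_set//; split => //= i; have := ht i; have := h i.
  move: (tnth _ i + tnth _ i) => u h1 h2.
  have h3 := ler_normD (u - y i) (y i - x i).
  by rewrite addrA subrK in h3; apply: (le_trans h3); lra.
Qed.

Lemma sojourn_cover (I : finType) (Q : I -> set (Rn R k)) x r w :
  (forall i, measurable (Q i)) -> (forall t, cube t -> exists i, Q i t) ->
  (soj cube x r w <= \sum_i soj (Q i) x r w)%E.
Proof.
move=> mQ cov; rewrite -ge0_integral_sum//; last first.
  by move=> i; apply/measurable_EFinP; exact: measurable_hit_time.
apply: ge0_le_integral => //.
- by apply/measurable_EFinP; apply: measurable_hit_time => //; exact: measurable_unit_cube.
- by apply: emeasurable_sum => i; apply/measurable_EFinP; exact: measurable_hit_time.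
move=> t _; rewrite [X in (X%:E <= _)%E]indicE.
case: (boolP ((t, w) \in hit_set _ _ _ x r)) => [/set_mem [/= ct ht]|_]; last first.
  by apply: sume_ge0 => i _; rewrite lee_fin.
have [i Qi] := cov t ct.
rewrite (bigD1 i)//= indicE mem_set; last by split.
by rewrite leeDl//; apply: sume_ge0 => j _; rewrite lee_fin.
Qed.

Definition cell D (f : {ffun 'I_k -> 'I_D}) : set (Rn R k) :=
  [set t | forall i, (f i)%:R / D%:R <= (tnth t i : R) <= (f i).+1%:R / D%:R].

Lemma measurable_cell D (f : {ffun 'I_k -> 'I_D}) : measurable (cell f).
Proof.
have -> : cell f = rectangle (fun i =>
    ([set` `[(f i)%:R / D%:R, (f i).+1%:R / D%:R]] : set (measurableTypeR R))).
  by apply/seteqP; split=> t h i; have := h i; rewrite /= in_itv.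
by apply: measurable_rectangle => i; exact: measurable_itv.
Qed.

Lemma cell_cover D t : cube t -> exists f : {ffun 'I_k -> 'I_D.+1}, cell f t.
Proof.
move=> ct.
have hex (i : 'I_k) : exists v : 'I_D.+1,
    v%:R / D.+1%:R <= (tnth t i : R) <= v.+1%:R / D.+1%:R.
  have /andP[t0 t1] := ct i.
  have D0 : 0 < D.+1%:R :> R by rewrite ltr0n.
  have z0 : 0 <= (tnth t i : R) * D.+1%:R by rewrite mulr_ge0// ltW.
  have /andP[h1 h2] := truncn_itv z0.
  set v := Num.truncn _ in h1 h2.
  have [vD|vD] := ltnP v D.+1.
    by exists (Ordinal vD) => /=; rewrite ler_pdivrMr// ler_pdivlMr// h1 ltW.
  exists ord_max => /=; rewrite divff ?gt_eqF// t1 andbT.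
  rewrite ler_pdivrMr// (le_trans _ h1)// ler_nat.
  exact: leq_trans (leqnSn D) vD.
have [f hf] := choice hex.
by exists (finfun f) => i; rewrite ffunE.
Qed.

Lemma cell_sub_cube D (f : {ffun 'I_k -> 'I_D.+1}) : cell f `<=` cube.
Proof.
move=> t h i; have /andP[h1 h2] := h i.
rewrite (le_trans _ h1) ?divr_ge0//= (le_trans h2)//.
by rewrite ler_pdivrMr ?ltr0n// mul1r ler_nat ltn_ord.
Qed.

Variables (th K q1 : R).
Hypotheses (th01 : 0 <= th <= 1) (K0 : 0 <= K).
Hypothesis HK : {ae leb, forall s, (\int[leb]_t (cov_weight P X (th / 2) s t)%:E <= K%:E)%E}.
Hypothesis q1th : q1 < n%:R * th.

Lemma ae_frostman : {ae P, forall w, forall M : nat, exists2 C : R, 0 <= C &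
  forall N (y : 'I_n -> R), (forall i, `|y i| <= M%:R) ->
    (soj cube y (2^-1 ^+ N) w <= (C * (2^-1 ^+ N) `^ q1)%:E)%E}.
Proof.
apply: ae_forall_countable => M.
pose q := n%:R * th.
have [m m0 gap] : exists2 m, (0 < m)%N & n%:R + q1 * m.+1%:R < q * m%:R.
  pose z := `|n%:R + q1| / (q - q1).
  have qq : 0 < q - q1 by rewrite subr_gt0.
  have z0 : 0 <= z by rewrite divr_ge0// ltW.
  have /andP[_ h2] := truncn_itv z0.
  exists (Num.truncn z).+1 => //.
  move: h2; rewrite ltr_pdivrMr//.
  rewrite -[(Num.truncn z).+2%:R]natr1; set v := (Num.truncn z).+1%:R => h2.
  have := ler_norm (n%:R + q1) => h3.
  nra.
have [eps [C [/andP[eps0 eps1] C0 H]]] := moment_bound mX gX X0 mphi lnd th01 K0 HK m0.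
pose D := Num.truncn eps^-1.
have Deps : D.+1%:R^-1 <= eps.
  have /andP[_ h2] := @truncn_itv R eps^-1 (ltac:(by rewrite invr_ge0 ltW)).
  by rewrite -[leRHS]invrK lef_pV2 ?posrE ?invr_gt0// ltW.
have D0 : 0 < D.+1%:R :> R by rewrite ltr0n.
have cellH (f : {ffun 'I_k -> 'I_D.+1}) x r : 0 < r ->
    (\int[P]_w ((fine (soj (cell f) x r w)) ^+ m.+1)%:E <=
       (C * (r `^ q) ^+ m)%:E)%E.
  pose a : Rn R k := [tuple Num.min ((f i)%:R / D.+1%:R) (1 - eps) | i < k].
  apply: (H (cell f) a (measurable_cell f)).
    move=> i; rewrite tnth_mktuple; split; last by rewrite -lerBrDr ge_min lexx orbT.
    by rewrite le_min divr_ge0//= subr_ge0.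
  move=> t ht i; rewrite tnth_mktuple; have /andP[h1 h2] := ht i.
  apply/andP; split; first by rewrite ge_min h1.
  rewrite /Num.min; case: ifP => _; last first.
    rewrite subrK (le_trans h2)// ler_pdivrMr// mul1r ler_nat.
    exact: ltn_ord.
  rewrite (le_trans h2)// -natr1 mulrDl mul1r lerD2l//.
have main : {ae P, forall w, forall f : {ffun 'I_k -> 'I_D.+1}, exists2 B : R, 0 <= B &
  forall N (y : 'I_n -> R), (forall i, `|y i| <= M%:R) ->
    fine (soj (cell f) y (2^-1 ^+ N) w) <= B * (2^-1 ^+ N) `^ q1}.
  apply: ae_forall_countable => f.
  have mc := measurable_cell f.
  have fn x r w : soj (cell f) x r w \is a fin_num.
    by apply: sojourn_fin_num => //; exact: cell_sub_cube.
  apply: (@dyadic_frostman _ _ _ P n m.+1 m q q1 C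
    (fun x r w => fine (soj (cell f) x r w))) => //.
  - by move=> x r; apply: measurableT_comp => //; exact: measurable_sojourn.
  - by move=> x r w; rewrite fine_ge0// sojourn_ge0.
  - by move=> x y r r' w h; apply: fine_le => //; exact: sojourn_mono.
  - by move=> x r; exact: cellH.
apply: filterS main => w hw.
have hw' (f : {ffun 'I_k -> 'I_D.+1}) : exists B : R, 0 <= B /\
  forall N (y : 'I_n -> R), (forall i, `|y i| <= M%:R) ->
    fine (soj (cell f) y (2^-1 ^+ N) w) <= B * (2^-1 ^+ N) `^ q1.
  by have [B B0 hB] := hw f; exists B.
have [B hB] := choice hw'.
exists (\sum_f B f); first by apply: sumr_ge0 => f _; have [] := hB f.
move=> N y yM.
apply: (le_trans (sojourn_cover y _ w (@measurable_cell _) (@cell_cover D))).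
rewrite mulr_suml -sumEFin; apply: lee_sum => f _.
rewrite -[leLHS]fineK; last by apply: sojourn_fin_num; [exact: mX|exact: mphi|exact: measurable_cell|exact: cell_sub_cube].
by rewrite lee_fin; have [_] := hB f; apply.
Qed.

End occupation_frostman.

Section covariance_integral.
Context (R : realType) (d : measure_display) (Omega : measurableType d).
Variables (P : probability Omega R) (k n : nat) (X : Rn R k -> Omega -> Rn R n).
Local Notation cube := (unit_cube R k).
Local Notation leb := (lebesgue_Rn R k).
Hypothesis mX : measurable_fun (cube `*` [set: Omega]) (fun p => X p.1 p.2).

Lemma powRN_le (D a a0 : R) : 0 < a <= a0 ->
  ((D `^ (- a))%:E <= 1 + ((`|D| `^ a0)%:E)^-1)%E.
Proof.
move=> /andP[a_gt0 aa0].
have i0 : (0 <= ((`|D| `^ a0)%:E)^-1)%E by rewrite inve_ge0 lee_fin powR_ge0.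
have [D1|D1] := leP (D `^ (- a)) 1.
  by rewrite -[leLHS]adde0; apply: leeD => //; rewrite lee_fin.
have Dp : 0 < D.
  rewrite ltNge; apply/negP => Dn; move: D1.
  rewrite ltNge => /negP; apply; rewrite /powR.
  case: eqP => [_|_]; first by rewrite oppr_eq0 gt_eqF.
  by rewrite ln0// mulr0 expR0.
have Dlt1 : D < 1.
  rewrite ltNge; apply/negP => Dge; move: D1; rewrite ltNge => /negP; apply.
  by rewrite powRN invf_le1 ?powR_gt0// -(powRr0 D) ler_powR// ltW.
rewrite gtr0_norm// inver gt_eqF ?powR_gt0// -powRN -EFinD lee_fin.
apply: (@le_trans _ _ (D `^ (- a0))); last by rewrite lerDr.
have lnD : ln D <= 0 by rewrite ln_le0// ltW.
rewrite /powR gt_eqF// ler_expR !mulNr lerN2.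
by rewrite ler_wnM2r.
Qed.

Lemma cov_weight_integral_bound (a a0 : R) : 0 < a <= a0 ->
  (ess_sup (mrestr leb (measurable_unit_cube R k))
     (fun s => \int[leb]_(t in cube)
        ((`|\det (increment_cov P X s t)| `^ a0)%:E)^-1) < +oo)%E ->
  exists2 K : R, 0 <= K &
    {ae leb, forall s, (\int[leb]_t (cov_weight P X a s t)%:E <= K%:E)%E}.
Proof.
move=> aa0; set f := (X in ess_sup _ X); set L := ess_sup _ _ => Loo.
have [K1 K10 LK] : exists2 K1 : R, 0 <= K1 & (L <= K1%:E)%E.
  case: {+}L Loo => [r||] // _; last by exists 0; rewrite ?leNye.
  by exists `|r|; rewrite ?lee_fin ?ler_norm.
exists (1 + K1); first by lra.
have H : {ae leb, forall s, cube s -> (f s <= K1%:E)%E}.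
  have [N [mN N0 NQ]] := ess_sup_ge (mrestr leb (measurable_unit_cube R k)) f.
  exists (N `&` cube); split.
  - by apply: measurableI => //; exact: measurable_unit_cube.
  - exact: N0.
  - move=> s /= /not_implyP[cs nf]; split => //; apply: NQ => /= h; apply: nf.
    exact: le_trans h LK.
apply: filterS H => s hs.
have [cs|ncs] := pselect (cube s); last first.
  rewrite integral0_eq; first by rewrite lee_fin; lra.
  by move=> t _; rewrite /cov_weight indicE memNset// !mul0r.
have mC := measurable_unit_cube R k.
have mpair : measurable_fun setT (fun t : Rn R k => (s, t)).
  exact: (measurable_fun_pair (measurable_cst s) (@measurable_id _ _ setT)).
have minv : measurable_fun cube
    (fun t => ((`|\det (increment_cov P X s t)| `^ a0)%:E)^-1%E).
  apply: (@eq_measurable_fun _ _ _ _ _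
    (fun t => if `|\det (increment_cov P (extend_field X) s t)| `^ a0 == 0 then +oo%E
      else (`|\det (increment_cov P (extend_field X) s t)| `^ (- a0))%:E)).
    by move=> t /set_mem ct; rewrite increment_cov_extend// inver powRN.
  apply: measurable_funTS.
  have md : measurable_fun setT (fun t => `|\det (increment_cov P (extend_field X) s t)|).
    apply: measurableT_comp => //.
    exact: (measurableT_comp (measurable_det_cov P mX) mpair).
  apply: measurable_fun_ifT => //.
  - by apply: measurable_fun_eqr => //; apply: (measurableT_comp (measurable_powR a0) md).
  - by apply/measurable_EFinP; apply: (measurableT_comp (measurable_powR (- a0)) md).
apply: (@le_trans _ _ (\int[leb]_(t in cube) (1 + ((`|\det (increment_cov P X s t)| `^ a0)%:E)^-1))%E).
  rewrite [leRHS]integral_mkcond; apply: ge0_le_integral => //.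
  - by move=> t _; rewrite lee_fin cov_weight_ge0.
  - apply/measurable_EFinP.
    exact: (measurableT_comp (measurable_cov_weight P mX a) mpair).
  - by apply/(measurable_restrictT _ mC); apply: emeasurable_funD.
  - move=> t _; rewrite patchE /cov_weight [X in (X * _)%R]mulrC.
    have [ct|nct] := boolP (t \in cube); last by rewrite indicE (negbTE nct) !mul0r.
    rewrite !indicE ct mem_set// !mul1r increment_cov_extend//; last exact: set_mem.
    exact: powRN_le.
rewrite ge0_integralD//; last first.
  by move=> t _; rewrite inve_ge0 lee_fin powR_ge0.
have -> : (\int[leb]_(_ in cube) 1 = 1)%E.
  by rewrite (integral_cst leb mC 1) mul1e; exact: lebesgue_unit_cube.
by rewrite EFinD; apply: leeD => //; exact: hs.
Qed.

End covariance_integral.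

(** * The Bessel kernel as a mixture of Gaussians *)

Section lebesgue_invariance.
Context (R : realType).
Local Notation leb := (@lebesgue_measure R).

Local Notation TR := (measurableTypeR R).

Lemma ge0_integral_lebesgue_image (h : TR -> TR) (f : TR -> \bar R) :
  measurable_fun setT h ->
  (forall a b, a <= b -> leb (h @^-1` `]a, b]%classic) = (b - a)%:E) ->
  measurable_fun setT f -> (forall x, (0 <= f x)%E) ->
  (\int[leb]_x f (h x) = \int[leb]_x f x)%E.
Proof.
move=> mh hE mf f0.
have := @ge0_integral_pushforward _ _ _ _ R h mh leb setT f measurableT mf (fun x _ => f0 x).
rewrite preimage_setT => <-.
apply: eq_measure_integral => A mA _ /=.
apply/esym.
apply: (@lebesgue_measure_unique R
  (measure_function_pushforward__canonical__measure_function_Measure leb mh)) => // _ [[a b] /= ab <-].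
rewrite /pushforward; have [/hE abE|ba] := leP a b.
  rewrite -[RHS]/(leb (h @^-1` `]a, b]%classic)) abE.
  rewrite lebesgue_measure_itv/= lte_fin; case: ltP => [//|ba].
  apply/esym/eqP; move: abE; have -> : `]a, b]%classic = set0 :> set R.
    by apply/seteqP; split => // x /=; rewrite in_itv/= => /andP[/lt_le_trans h1 /h1]; lra.
  by rewrite preimage_set0 measure0 => <-.
by rewrite set_itv_ge ?bnd_simp -?leNgt ?(ltW ba)// preimage_set0 !measure0.
Qed.

Lemma ge0_integral_lebesgue_shift (f : R -> \bar R) c :
  measurable_fun setT f -> (forall x, (0 <= f x)%E) ->
  (\int[leb]_x f ((x : R) + c)%R = \int[leb]_x f x)%E.
Proof.
apply: (@ge0_integral_lebesgue_image (fun x => x + c)); first exact: measurable_funD.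
move=> a b ab.
have -> : (fun x => x + c) @^-1` `]a, b] = `]a - c, b - c]%classic.
  by apply/seteqP; split=> x /=; rewrite !in_itv/= ltrBlDr lerBrDr.
rewrite lebesgue_measure_itv/= lte_fin ltrD2r.
case: ltP => [_|ba]; first by congr EFin; ring.
by rewrite (@le_anti _ _ a b) ?ab ?ba// subrr.
Qed.

Lemma ge0_integral_lebesgue_opp (f : R -> \bar R) :
  measurable_fun setT f -> (forall x, (0 <= f x)%E) ->
  (\int[leb]_x f (- (x : R))%R = \int[leb]_x f x)%E.
Proof.
apply: (@ge0_integral_lebesgue_image -%R); first exact: oppr_measurable.
move=> a b ab.
have -> : (-%R) @^-1` `]a, b] = `[- b, - a[%classic.
  by apply/seteqP; split=> x /=; rewrite !in_itv/= ltrNr lerNl andbC.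
rewrite lebesgue_measure_itv/= lte_fin ltrN2.
case: ltP => [_|ba]; first by congr EFin; ring.
by rewrite (@le_anti _ _ a b) ?ab ?ba// subrr.
Qed.

End lebesgue_invariance.

Section gamma_mixture.
Context (R : realType).
Local Notation leb := (@lebesgue_measure R).

Lemma measurable_exp_mixture (a s : R) :
  measurable_fun setT (fun u : R => expR (a * u - expR u * s)).
Proof.
apply: measurableT_comp => //; apply: measurable_funB => //.
  exact: measurable_funM.
Qed.

Lemma measurable_gamma_density (a : R) :
  measurable_fun setT (fun u : R => (expR (a * u - expR u))%:E).
Proof.
apply/measurable_EFinP.
by under eq_fun do rewrite -[expR _ in X in expR X]mulr1; exact: measurable_exp_mixture.
Qed.

(* Substituting [x = exp u] in Euler's integral, this is [Gamma a]. *)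
Lemma gamma_integral_fin (a : R) : 0 < a -> exists2 c : R, 0 < c &
  (\int[leb]_u (expR (a * u - expR u))%:E = c%:E)%E.
Proof.
move=> a0.
have mf : measurable_fun setT (fun u : R => expR (a * u - expR u)).
  by apply/measurable_EFinP; exact: measurable_gamma_density.
pose K := expR ((a + 1) ^+ 2 / 2).
have K0 : 0 < K by exact: expR_gt0.
have me r : measurable_fun setT (fun x => (exponential_pdf r x)%:E : \bar R).
  by apply/measurable_EFinP; exact: measurable_exponential_pdf.
have e0 r x : 0 < r -> 0 <= exponential_pdf r x :> R.
  by move=> r0; rewrite exponential_pdf_ge0// ltW.
have bnd u : expR (a * u - expR u) <=
    a^-1 * exponential_pdf a (- u) + K * exponential_pdf 1 u.
  have [u0|u0] := leP u 0.
    rewrite -[leLHS]addr0; apply: lerD; last by rewrite mulr_ge0 ?e0// ltW.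
    rewrite /exponential_pdf patchE mem_set/=; last by rewrite in_itv/= andbT oppr_ge0.
    rewrite mulrA mulVf ?gt_eqF// mul1r mulrNN ler_expR gerDl oppr_le0.
    exact: expR_ge0.
  rewrite -[leLHS]add0r; apply: lerD; first by rewrite mulr_ge0 ?e0// invr_ge0 ltW.
  rewrite /exponential_pdf patchE mem_set/=; last by rewrite in_itv/= andbT ltW.
  rewrite mul1r mulN1r -expRD ler_expR.
  have := expR_ge1Dxn 1 (ltW u0); rewrite (_ : 2`! = 2)%N//.
  have := sqr_ge0 (u - (a + 1)).
  set e := expR u; move: e => e; nra.
have foo : (\int[leb]_u (expR (a * u - expR u))%:E < +oo)%E.
  apply: (@le_lt_trans _ _ (\int[leb]_u (a^-1%:E * (exponential_pdf a (- u))%:E + K%:E * (exponential_pdf 1 u)%:E))%E).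
    apply: ge0_le_integral => //.
    - exact/measurable_EFinP.
    - apply: emeasurable_funD; apply: measurable_funeM => //.
        exact: (measurableT_comp (me a) (@oppr_measurable R setT)).
      exact: me.
    - by move=> u _; rewrite -!EFinM -EFinD lee_fin.
  rewrite ge0_integralD//; last 4 first.
  - by move=> u _; rewrite mule_ge0// lee_fin ?e0// invr_ge0 ltW.
  - by apply: measurable_funeM; exact: (measurableT_comp (me a) (@oppr_measurable R setT)).
  - by move=> u _; rewrite mule_ge0// lee_fin ?e0// ltW.
  - by apply: measurable_funeM; exact: me.
  rewrite !ge0_integralZl_EFin//; last 6 first.
  - by move=> u _; rewrite lee_fin e0.
  - exact: me.
  - exact: ltW.
  - by move=> u _; rewrite lee_fin e0.
  - exact: (measurableT_comp (me a) (@oppr_measurable R setT)).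
  - by rewrite invr_ge0 ltW.
  rewrite (@ge0_integral_lebesgue_opp _ (fun u => (exponential_pdf a u)%:E))//; last first.
    by move=> u; rewrite lee_fin e0.
  by rewrite !integral_exponential_pdf// !mule1 -EFinD ltry.
have f0 u : (0 <= (expR (a * u - expR u))%:E)%E by rewrite lee_fin expR_ge0.
have I0 : (0 <= \int[leb]_u (expR (a * u - expR u))%:E)%E by exact: integral_ge0.
exists (fine (\int[leb]_u (expR (a * u - expR u))%:E)%E); last first.
  by rewrite fineK// ge0_fin_numE.
rewrite fine_gt0// foo andbT.
pose m : R := expR (- expR 1).
have m0 : 0 < m by exact: expR_gt0.
have mE : (\int[leb]_(u in `[0%R, 1%R]%classic) m%:E = m%:E)%E.
  by rewrite integral_cst//= lebesgue_measure_itv/= lte_fin ltr01 oppr0 adde0 mule1.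
have m1 : (m%:E <= \int[leb]_(u in `[0%R, 1%R]%classic) (expR (a * u - expR u))%:E)%E.
  rewrite -mE; apply: ge0_le_integral => //.
  - by move=> u _; rewrite lee_fin ltW.
  - by apply/measurable_EFinP; exact: measurable_funTS.
  move=> u /=; rewrite in_itv/= => /andP[u0 u1].
  rewrite lee_fin ler_expR.
  have : expR u <= expR 1 by rewrite ler_expR.
  have : 0 <= a * u by rewrite mulr_ge0// ltW.
  by lra.
have m2 : (m%:E <= \int[leb]_u (expR (a * u - expR u))%:E)%E.
  apply: (le_trans m1); apply: ge0_subset_integral => //; exact/measurable_EFinP.
by apply: lt_le_trans m2; rewrite lte_fin.
Qed.

Lemma gamma_mixture (a c s : R) : 0 < s ->
  (\int[leb]_u (expR (a * u - expR u))%:E = c%:E)%E ->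
  (\int[leb]_u (expR (a * u - expR u * s))%:E = (c * s `^ (- a))%:E)%E.
Proof.
move=> s0 cE.
have mf := measurable_gamma_density a.
rewrite EFinM muleC -cE.
rewrite -(@ge0_integral_lebesgue_shift _ (fun u => (expR (a * u - expR u))%:E) (ln s))//.
rewrite -ge0_integralZl_EFin ?powR_ge0//; last first.
  apply/measurable_EFinP; apply: measurableT_comp => //; apply: measurable_funB => //.
    by apply: measurable_funM => //; exact: measurable_funD.
  by apply: measurableT_comp => //; exact: measurable_funD.
apply: eq_integral => u _; rewrite -EFinM; congr EFin.
rewrite [expR (u + _)]expRD lnK ?posrE// /powR gt_eqF// -expRD; congr expR; ring.
Qed.

End gamma_mixture.

Section gauss_weight.
Local Open Scope ereal_scope.
Context d (T : measurableType d) (R : realType).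
Variables (mu nu : {sigma_finite_measure set T -> \bar R}) (h : T -> R) (rho : R).
Hypothesis mh : measurable_fun setT h.
Hypothesis h0 : forall x, (0 <= h x)%R.
Hypothesis rho0 : (0 <= rho)%R.
Hypothesis dens : forall f : T -> \bar R, measurable_fun setT f -> (forall x, 0 <= f x) ->
  \int[mu]_x (f x * (h x)%:E) = rho%:E * \int[nu]_x f x.

Lemma ge0_integral_tuple_density n (f : n.-tuple T -> \bar R) :
  measurable_fun setT f -> (forall t, 0 <= f t) ->
  \int[tuple_measure mu n]_t (f t * (\prod_(i < n) h (tnth t i))%:E) =
  (rho ^+ n)%:E * \int[tuple_measure nu n]_t f t.
Proof.
have mp m : measurable_fun setT (fun t : m.-tuple T => (\prod_(i < m) h (tnth t i))%:E).
  apply/measurable_EFinP; apply: measurable_prod => i _.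
  exact: (measurableT_comp mh (measurable_tnth i)).
have p0 m (t : m.-tuple T) : 0 <= (\prod_(i < m) h (tnth t i))%:E.
  by rewrite lee_fin; apply: prodr_ge0 => i _; exact: h0.
elim: n f => [|n IH] f mf f0.
  rewrite (ge0_integral_tuple0 _ (emeasurable_funM mf (mp 0%N))) (ge0_integral_tuple0 _ mf).
  by rewrite big_ord0 mule1 expr0 mul1e.
rewrite ge0_integral_tupleS//; last 2 first.
- by apply: emeasurable_funM => //; exact: mp.
- by move=> t; rewrite mule_ge0// p0.
have E x : \int[tuple_measure mu n]_t (f [tuple of x :: t] *
    (\prod_(i < n.+1) h (tnth [tuple of x :: t] i))%:E) =
    (rho ^+ n)%:E * \int[tuple_measure nu n]_t f [tuple of x :: t] * (h x)%:E.
  rewrite -IH//; last exact: (measurableT_comp mf (measurable_cons_fixed x)).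
  rewrite -ge0_integralZr//; last 3 first.
  - apply: emeasurable_funM => //.
    exact: (measurableT_comp mf (measurable_cons_fixed x)).
    exact: mp.
  - by move=> t; rewrite mule_ge0// p0.
  - by rewrite lee_fin.
  apply: eq_integral => t _; rewrite big_ord_recl EFinM tnth0.
  rewrite -[RHS]muleA [in RHS](muleC _ (h x)%:E); congr (_ * (_ * EFin _)).
  by apply: eq_bigr => i _; rewrite tnthS.
under eq_integral do rewrite E.
rewrite dens; last 2 first.
- by apply: measurable_funeM; exact: measurable_integral_tuple_behead.
- by move=> x; rewrite mule_ge0 ?lee_fin ?exprn_ge0//; exact: integral_ge0.
rewrite ge0_integralZl_EFin ?exprn_ge0//; last 2 first.
- by move=> x _; exact: integral_ge0.
- exact: measurable_integral_tuple_behead.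
by rewrite muleA -EFinM -exprS (ge0_integral_tupleS _ mf).
Qed.

End gauss_weight.

Section gauss_damped.
Context (R : realType).

Lemma integral_gauss_1cos_damped n (a : 'I_n -> R) (c : R) : 0 <= c ->
  (\int[gauss R n]_t ((1 + cos (\sum_i a i * tnth t i))%:E *
     (expR (- c * \sum_i (tnth t i : R) ^+ 2))%:E) =
   ((1 + 2 * c) `^ (- (n%:R / 2)) *
    (1 + expR (- (\sum_i a i ^+ 2) / (2 * (1 + 2 * c)))))%:E)%E.
Proof.
move=> c0.
pose v := 1 + 2 * c; have v0 : 0 < v by rewrite /v; lra.
pose rho := Num.sqrt v^-1.
have rho0 : 0 < rho by rewrite sqrtr_gt0 invr_gt0.
have rho2 : rho ^+ 2 = v^-1 by rewrite sqr_sqrtr// invr_ge0 ltW.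
pose h (x : R) := expR (- c * x ^+ 2).
have mh : measurable_fun setT h.
  by apply: measurableT_comp => //; apply: measurable_funM => //; exact: exprn_measurable.
have dens (f : R -> \bar R) : measurable_fun setT f -> (forall x, (0 <= f x)%E) ->
    (\int[normal_prob 0 1]_x (f x * (h x)%:E) = rho%:E * \int[normal_prob 0 rho]_x f x)%E.
  move=> mf f0.
  have r00 : rho != 0 by rewrite gt_eqF.
  rewrite (@ge0_integral_density _ _ _ lebesgue_measure (normal_prob 0 1) (normal_pdf 0 1)
    (measurable_normal_pdf 0 1) (normal_pdf_ge0 0 1)) //; first last.
  - by move=> x; rewrite mule_ge0// lee_fin expR_ge0.
  - by apply: emeasurable_funM => //; exact/measurable_EFinP.
  rewrite (@ge0_integral_density _ _ _ lebesgue_measure (normal_prob 0 rho) (normal_pdf 0 rho)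
    (measurable_normal_pdf 0 rho) (normal_pdf_ge0 0 rho)) //.
  rewrite -ge0_integralZl_EFin ?(ltW rho0)//; first last.
  - by apply: emeasurable_funM => //; apply/measurable_EFinP; exact: measurable_normal_pdf.
  - by move=> x _; rewrite mule_ge0// lee_fin normal_pdf_ge0.
  apply: eq_integral => x _; rewrite muleCA -muleA -!EFinM; congr (_ * _%:E)%E.
  rewrite !normal_pdf0E ?oner_neq0// /h.
  have -> : normal_peak rho = rho^-1 * normal_peak 1.
    by rewrite -[X in normal_peak X = _]invrK normal_peakV ?invr_gt0.
  rewrite mulrCA -expRD -[rho^-1 * _ * _]mulrA mulVKf//.
  congr (_ * expR _); rewrite rho2 /v.
  have : 1 + 2 * c != 0 by rewrite gt_eqF.
  by move=> ?; field.
under eq_integral do rewrite mulr_sumr expR_sum.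
rewrite (@ge0_integral_tuple_density _ _ _ (normal_prob 0 1) (normal_prob 0 rho) h rho)//; first last.
- apply: measurable_1cos; apply: measurable_sum => i.
  by apply: measurable_funM => //; exact: measurable_tnth.
- exact: ltW.
- by move=> x; exact: expR_ge0.
under eq_integral do rewrite -[X in cos X]addr0.
rewrite (@integral_1cos_tuple _ _ _ (normal_prob 0 rho) _ n (fun i x => a i * x)
  (fun i => expR (- ((rho * a i) ^+ 2) / 2))).
- rewrite cos0 mul1r -EFinM; congr EFin; congr (_ * (1 + _)).
    rewrite /rho -powR12_sqrt ?invr_ge0 ?(ltW v0)// -powR_mulrn ?powR_ge0// -powRrM.
    rewrite -powR_inv1 ?(ltW v0)// -powRrM -/v; congr (_ `^ _); ring.
  rewrite -expR_sum -sumrN mulr_suml; congr expR; apply: eq_bigr => i _.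
  by rewrite exprMn rho2 -/v; field; rewrite gt_eqF.
- exact: probability_setT.
- by move=> i; apply: measurable_funM.
- by move=> i; rewrite expR_ge0/= expR_half_le1// sqr_ge0.
- by move=> i b; rewrite integral_1cos_normal_prob ?gt_eqF.
Qed.

End gauss_damped.

Section smoothed_kernel.
Context (R : realType) (n : nat).
Local Notation leb := (@lebesgue_measure R).
Local Notation lebn := (lebesgue_Rn R n).
Local Notation gam := (gauss R n).

Definition bump (e : R) (z : 'cV[R]_n) (y : Rn R n) : R :=
  expR (- (\sum_i (z i 0 - tnth y i) ^+ 2) / (2 * e ^+ 2)).

Lemma bump_ge0 e z y : 0 <= bump e z y.
Proof. exact: expR_ge0. Qed.

Lemma measurable_bump e z : measurable_fun setT (bump e z).
Proof.
apply: measurableT_comp => //; apply: measurable_funM => //.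
apply: measurableT_comp => //; apply: measurable_sum => i.
apply: measurable_funX; apply: measurable_funB => //; exact: measurable_tnth.
Qed.

Variables (p : Rn R n -> R) (a : R).
Hypothesis p0 : forall y, 0 <= p y.
Hypothesis ip : lebn.-integrable setT (EFin \o p).
Hypothesis hcos : forall xi : 'cV[R]_n,
  (\int[lebn]_x (cos (dotv (colv x) xi) * p x)%:E
   = ((1 + enorm xi ^+ 2) `^ (- a))%:E)%E.
Hypothesis hsin : forall xi : 'cV[R]_n,
  (\int[lebn]_x (sin (dotv (colv x) xi) * p x)%:E = 0)%E.

Let mp : measurable_fun setT p.
Proof. by apply/measurable_EFinP; exact: measurable_int ip. Qed.

Let mdot xi : measurable_fun setT (fun x : Rn R n => dotv (colv x) xi).
Proof.
by apply: measurable_sum => i; apply: measurable_funM => //; exact: measurable_colv.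
Qed.

Let ibounded (b : Rn R n -> R) : measurable_fun setT b -> (forall x, `|b x| <= 1) ->
  lebn.-integrable setT (fun x => (b x * p x)%:E).
Proof.
move=> mb b1; apply: le_integrable ip => //.
  by apply/measurable_EFinP; exact: measurable_funM.
by move=> x _ /=; rewrite lee_fin normrM (ger0_norm (p0 x)) ler_piMl.
Qed.

Lemma integral_kernel : (\int[lebn]_x (p x)%:E = 1)%E.
Proof.
have := hcos 0; rewrite (_ : enorm 0 = 0); last first.
  by rewrite /enorm big1 ?sqrtr0// => i _; rewrite mxE expr0n.
rewrite expr0n addr0 powR1 => <-; apply: eq_integral => x _.
by rewrite (_ : dotv _ 0 = 0) ?cos0 ?mul1r// /dotv big1// => i _; rewrite [X in _ * X]mxE mulr0.
Qed.

Lemma integral_1cos_kernel (b : R) xi :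
  (\int[lebn]_x ((1 + cos (b - dotv (colv x) xi)) * p x)%:E
   = (1 + cos b * (1 + enorm xi ^+ 2) `^ (- a))%:E)%E.
Proof.
have ic := @ibounded (fun x => cos (dotv (colv x) xi)).
have is_ := @ibounded (fun x => sin (dotv (colv x) xi)).
have {}ic : lebn.-integrable setT (fun x => (cos (dotv (colv x) xi) * p x)%:E).
  by apply: ic => [|x]; [exact: (measurableT_comp (continuous_measurable_fun (@continuous_cos R)) (mdot xi))|exact: cos_max].
have {}is_ : lebn.-integrable setT (fun x => (sin (dotv (colv x) xi) * p x)%:E).
  by apply: is_ => [|x]; [exact: (measurableT_comp (continuous_measurable_fun (@continuous_sin R)) (mdot xi))|exact: sin_max].
have E x : (((1 + cos (b - dotv (colv x) xi)) * p x)%:E = (p x)%:E +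
    ((cos b)%:E * (cos (dotv (colv x) xi) * p x)%:E +
     (sin b)%:E * (sin (dotv (colv x) xi) * p x)%:E))%E.
  by rewrite -!EFinM -!EFinD cosB; congr EFin; ring.
under eq_integral do rewrite E.
rewrite integralD//=; last first.
  by apply: integrableD => //; exact: integrableZl.
rewrite integralD//=; [|exact: integrableZl|exact: integrableZl].
by rewrite !integralZl// hcos hsin integral_kernel mule0 adde0 -EFinM -EFinD.
Qed.

Variable c : R.
Hypothesis cE : (\int[leb]_u (expR (a * u - expR u))%:E = c%:E)%E.
Hypothesis c0 : 0 < c.
Hypothesis a0 : 0 < a.

Let sqn (t : Rn R n) : R := \sum_i (tnth t i : R) ^+ 2.

Let sqn_ge0 t : 0 <= sqn t.
Proof. by apply: sumr_ge0 => i _; exact: sqr_ge0. Qed.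

Let msqn : measurable_fun setT sqn.
Proof. by apply: measurable_sum => i; apply: measurable_funX; exact: measurable_tnth. Qed.

Variables (e : R) (e0 : 0 < e).

Let e2 : 0 < e ^+ 2. Proof. exact: exprn_gt0. Qed.

Let W (t : Rn R n) := (1 + sqn t / e ^+ 2) `^ (- a).

Let W_ge0 t : 0 <= W t. Proof. exact: powR_ge0. Qed.

Let W_le1 t : W t <= 1.
Proof.
have h : 1 <= 1 + sqn t / e ^+ 2 by rewrite lerDl divr_ge0// ltW.
have q : 1 <= (1 + sqn t / e ^+ 2) `^ a.
  by rewrite -[leLHS](powRr0 (1 + sqn t / e ^+ 2)) ler_powR// ltW.
by rewrite /W powRN invf_le1// (lt_le_trans ltr01 q).
Qed.

Let mW : measurable_fun setT W.
Proof.
apply: (measurableT_comp (measurable_powR (- a))).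
by apply: measurable_funD => //; apply: measurable_funM.
Qed.

Let v (u : R) := e ^+ 2 + 2 * expR u.

Let v_gt0 u : 0 < v u. Proof. by rewrite addr_gt0// mulr_gt0// expR_gt0. Qed.

Definition kernel_mix (b : R) (u : R) : R :=
  expR (a * u - expR u) *
  ((e ^+ 2 + 2 * expR u) `^ (- (n%:R / 2)) * expR (- b / (2 * (e ^+ 2 + 2 * expR u)))).

Lemma kernel_mix_ge0 b u : 0 <= kernel_mix b u.
Proof. by rewrite !mulr_ge0 ?expR_ge0 ?powR_ge0. Qed.

Lemma measurable_kernel_mix b : measurable_fun setT (kernel_mix b).
Proof.
have me : measurable_fun setT (fun u => e ^+ 2 + 2 * expR u).
  by apply: measurable_funD => //; apply: measurable_funM.
apply: measurable_funM.
  by apply/measurable_EFinP; exact: measurable_gamma_density.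
apply: measurable_funM; first exact: (measurableT_comp (measurable_powR _) me).
apply: measurableT_comp => //; apply: measurable_funM => //.
have -> : (fun u => (2 * (e ^+ 2 + 2 * expR u))^-1) =
    (fun u => (2 * (e ^+ 2 + 2 * expR u)) `^ (-1)).
  by apply/funext => u; rewrite powR_inv1// mulr_ge0// ltW// v_gt0.
by apply: (measurableT_comp (measurable_powR _)); apply: measurable_funM.
Qed.

Let A (z : 'cV[R]_n) (t : Rn R n) := \sum_i z i 0 / e * tnth t i.

Let mA z : measurable_fun setT (A z).
Proof. by apply: measurable_sum => i; apply: measurable_funM => //; exact: measurable_tnth. Qed.

Let sqz (z : 'cV[R]_n) := \sum_i z i 0 ^+ 2.

Lemma integral_gauss_mixture z :
  (\int[gam]_t ((1 + cos (A z t)) * W t)%:E =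
   (c^-1 * e ^+ n)%:E * \int[leb]_u (kernel_mix 0 u + kernel_mix (sqz z) u)%:E)%E.
Proof.
pose F (q : Rn R n * measurableTypeR R) : R := (1 + cos (A z q.1)) *
  expR (a * (q.2 : R) - expR (q.2 : R) * (1 + sqn q.1 / e ^+ 2)).
have F0 q : 0 <= F q by rewrite mulr_ge0 ?cos1_ge0 ?expR_ge0.
have mF : measurable_fun setT (fun q => (F q)%:E).
  apply/measurable_EFinP; apply: measurable_funM.
    by apply/measurable_EFinP; apply: measurable_1cos; exact: (measurableT_comp (mA z) measurable_fst).
  apply: measurableT_comp => //; apply: measurable_funB.
    by apply: measurable_funM => //; exact: measurable_snd.
  apply: measurable_funM; first by apply: measurableT_comp => //; exact: measurable_snd.
  apply: measurable_funD => //; apply: measurable_funM => //.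
  exact: (measurableT_comp msqn measurable_fst).
have E1 t : (((1 + cos (A z t)) * W t)%:E = (c^-1)%:E * \int[leb]_u (F (t, u))%:E)%E.
  have s0 : 0 < 1 + sqn t / e ^+ 2 by rewrite ltr_wpDr// divr_ge0// ltW.
  under eq_integral do rewrite /F/= EFinM.
  rewrite ge0_integralZl_EFin ?cos1_ge0//; last first.
    by apply/measurable_EFinP; exact: measurable_exp_mixture.
  rewrite (gamma_mixture s0 cE) -!EFinM; congr EFin.
  by rewrite -/(W t); field; rewrite gt_eqF.
under eq_integral do rewrite E1.
rewrite ge0_integralZl_EFin ?invr_ge0 ?(ltW c0)//; last first.
  - by apply: (@measurable_fun_fubini_tonelli_F _ _ _ _ _ leb (fun q => (F q)%:E) mF) => q; rewrite lee_fin.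
  - by move=> t _; apply: integral_ge0 => u _; rewrite lee_fin.
rewrite EFinM -muleA; congr (_ * _)%E.
rewrite (@fubini_tonelli _ _ _ _ _ gam leb (fun q => (F q)%:E) mF); last first.
  by move=> q; rewrite lee_fin.
rewrite -ge0_integralZl_EFin ?exprn_ge0 ?(ltW e0)//; last first.
  - by apply/measurable_EFinP; apply: measurable_funD; exact: measurable_kernel_mix.
  - by move=> u _; rewrite lee_fin addr_ge0 ?kernel_mix_ge0.
apply: eq_integral => u _.
pose k := expR u / e ^+ 2.
have k0 : 0 <= k by rewrite divr_ge0 ?expR_ge0// ltW.
have E2 t : ((F (t, u))%:E = (expR (a * u - expR u))%:E *
    ((1 + cos (\sum_i z i 0 / e * tnth t i))%:E * (expR (- k * \sum_i (tnth t i : R) ^+ 2))%:E))%E.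
  rewrite -!EFinM /F/= mulrCA -expRD -/(A z t) -/(sqn t); congr (_ * expR _)%:E.
  by rewrite /k; field; rewrite gt_eqF.
under eq_integral do rewrite E2.
rewrite ge0_integralZl_EFin ?expR_ge0//; last first.
  apply: emeasurable_funM; first exact: measurable_1cos (mA z).
  by apply/measurable_EFinP; apply: measurableT_comp => //; apply: measurable_funM.
rewrite (@integral_gauss_1cos_damped R n (fun i => z i 0 / e) k k0) -!EFinM; congr EFin.
have kv : 1 + 2 * k = v u / e ^+ 2 by rewrite /k /v; field; rewrite gt_eqF.
rewrite kv /kernel_mix -/(v u) -mulrDr -mulrDr [RHS]mulrCA; congr (_ * _).
rewrite oppr0 mul0r expR0 [RHS]mulrA; congr (_ * (_ + expR _)); last first.
  rewrite !mulNr; congr (- _); rewrite /sqz mulr_suml mulr_suml; apply: eq_bigr => i _.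
  by field; rewrite !gt_eqF// v_gt0.
rewrite powRM ?invr_ge0 ?ltW// mulrC; congr (_ * _).
rewrite -powR_inv1 ?ltW// -powRrM -powR_mulrn ?ltW// -powRrM -powR_mulrn ?ltW//.
congr (_ `^ _); field.
by [].
Qed.

Lemma integral_bump_kernel z :
  (\int[lebn]_y (p y * bump e z y)%:E =
   (c^-1 * e ^+ n)%:E * \int[leb]_u (kernel_mix (sqz z) u)%:E)%E.
Proof.
have mk b : measurable_fun setT (fun u => (kernel_mix b u)%:E).
  by apply/measurable_EFinP; exact: measurable_kernel_mix.
have k0 b u : (0 <= (kernel_mix b u)%:E)%E by rewrite lee_fin kernel_mix_ge0.
pose I b := ((c^-1 * e ^+ n)%:E * \int[leb]_u (kernel_mix b u)%:E)%E.
have I0 b : (0 <= I b)%E.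
  by rewrite mule_ge0 ?integral_ge0// lee_fin mulr_ge0 ?invr_ge0 ?exprn_ge0// ltW.
have mix z' : (\int[gam]_t ((1 + cos (A z' t)) * W t)%:E = I 0%R + I (sqz z'))%E.
  rewrite integral_gauss_mixture; under eq_integral do rewrite EFinD.
  rewrite ge0_integralD//; [by rewrite ge0_muleDr//; exact: integral_ge0|exact: mk|exact: mk].
have mcW z' : measurable_fun setT (fun t => ((1 + cos (A z' t)) * W t)%:E).
  by apply/measurable_EFinP; apply: measurable_funM => //; apply/measurable_EFinP; exact: measurable_1cos.
have cW0 z' t : (0 <= ((1 + cos (A z' t)) * W t)%:E)%E by rewrite lee_fin mulr_ge0 ?cos1_ge0.
have fin z' : (I 0%R + I (sqz z') <= 2%:E)%E.
  rewrite -mix; apply: (@le_trans _ _ (\int[gam]_t (2%:E))%E).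
    apply: ge0_le_integral => // t _; rewrite lee_fin.
    have := W_le1 t; have := W_ge0 t; have := cos_max (A z' t); have := cos1_ge0 (A z' t).
    by move=> h1 /ler_normlP[h2 h3] h4 h5; nra.
  by rewrite integral_cst// [X in (_ * X)%E](gauss_setT R n) mule1.
have If b : (I b <= 2%:E)%E -> exists2 r : R, 0 <= r & I b = r%:E.
  move=> hb; exists (fine (I b)); first exact: fine_ge0.
  by rewrite fineK// ge0_fin_numE// (le_lt_trans hb)// ltry.
have [r0 r00 Ir0] : exists2 r : R, 0 <= r & I 0%R = r%:E.
  by apply: If; apply: le_trans (fin 0); rewrite leeDl.
have [rz rz0 Irz] : exists2 r : R, 0 <= r & I (sqz z) = r%:E.
  by apply: If; apply: le_trans (fin z); rewrite leeDr.
pose L := (\int[gam]_t (1 + cos (A z t) * W t)%:E)%E.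
have mW' : measurable_fun setT (fun t => (W t)%:E) by exact/measurable_EFinP.
have l0 t : 0 <= 1 + cos (A z t) * W t.
  have := W_le1 t; have := W_ge0 t; have := cos1_ge0 (A z t); nra.
have ml : measurable_fun setT (fun t => (1 + cos (A z t) * W t)%:E).
  apply/measurable_EFinP; apply: measurable_funD => //; apply: measurable_funM => //.
  exact: (measurableT_comp (continuous_measurable_fun (@continuous_cos R)) (mA z)).
have LE : L = (1 + rz)%:E.
  have Wr0 : (\int[gam]_t (W t)%:E = r0%:E)%E.
    have := mix 0; rewrite (_ : sqz 0 = 0); last first.
      by rewrite /sqz big1// => i _; rewrite mxE expr0n.
    have E0 t : (((1 + cos (A 0 t)) * W t)%:E = 2%:E * (W t)%:E)%E.
      rewrite (_ : A 0 t = 0) ?cos0 -?EFinM//.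
      by rewrite /A big1// => i _; rewrite mxE mul0r mul0r.
    under eq_integral do rewrite E0.
    have -> : (\int[gam]_t (2%:E * (W t)%:E) = 2%:E * \int[gam]_t (W t)%:E)%E.
      by apply: ge0_integralZl_EFin => // t _; rewrite lee_fin.
    rewrite Ir0 -EFinD.
    have : (\int[gam]_t (W t)%:E <= 1)%E.
      apply: (@le_trans _ _ (\int[gam]_t (1))%E).
        by apply: ge0_le_integral => // t _; rewrite lee_fin.
      by rewrite integral_cst// [X in (_ * X)%E](gauss_setT R n) mule1.
    have : (0 <= \int[gam]_t (W t)%:E)%E by apply: integral_ge0 => t _; rewrite lee_fin.
    case: (\int[gam]_t (W t)%:E)%E => // w _ _; rewrite -EFinM => -[h].
    by congr EFin; lra.
  have LW : (L + r0%:E = 1 + (r0%:E + rz%:E))%E.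
    rewrite -Wr0 -ge0_integralD//; last first.
    - by move=> t _; rewrite lee_fin.
    - by move=> t _; rewrite lee_fin.
    rewrite Wr0 -Ir0 -Irz -mix.
    transitivity (\int[gam]_t (1 + ((1 + cos (A z t)) * W t)%:E))%E.
      by apply: eq_integral => t _; rewrite -!EFinD; congr EFin; ring.
    rewrite ge0_integralD// integral_cst// mul1e; congr (_ + _)%E.
    exact: (gauss_setT R n).
  have : (0 <= L)%E by apply: integral_ge0 => t _; rewrite lee_fin.
  by case: L LW => // l; rewrite -!EFinD => -[h] _; congr EFin; lra.
have LM : (L = 1 + \int[lebn]_y (p y * bump e z y)%:E)%E.
  pose F (q : Rn R n * Rn R n) : R :=
    (1 + cos (\sum_i (z i 0 - tnth q.1 i) / e * tnth q.2 i)) * p q.1.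
  have F0 q : 0 <= F q by rewrite mulr_ge0 ?cos1_ge0.
  have mF : measurable_fun setT (fun q => (F q)%:E).
    apply/measurable_EFinP; apply: measurable_funM; last first.
      exact: (measurableT_comp mp measurable_fst).
    apply/measurable_EFinP; apply: measurable_1cos; apply: measurable_sum => i.
    apply: measurable_funM; last exact: (measurableT_comp (measurable_tnth i) measurable_snd).
    apply: measurable_funM => //; apply: measurable_funB => //.
    exact: (measurableT_comp (measurable_tnth i) measurable_fst).
  transitivity (\int[gam]_t \int[lebn]_y (F (y, t))%:E)%E.
    apply: eq_integral => t _; pose xi : 'cV[R]_n := \col_i (tnth t i / e).
    have -> : W t = (1 + enorm xi ^+ 2) `^ (- a).
      rewrite enorm_sqr /W /sqn mulr_suml; congr ((1 + _) `^ _).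
      by apply: eq_bigr => i _; rewrite mxE exprMn exprVn.
    rewrite -integral_1cos_kernel; apply: eq_integral => y _.
    rewrite /F/= /A /dotv -sumrB; congr ((1 + cos _) * _)%:E.
    by apply: eq_bigr => i _; rewrite !mxE; field; rewrite gt_eqF.
  rewrite -(@fubini_tonelli _ _ _ _ _ lebn gam (fun q => (F q)%:E) mF); last first.
    by move=> q; rewrite lee_fin.
  rewrite -integral_kernel -ge0_integralD//; last first.
  - by apply/measurable_EFinP; apply: measurable_funM => //; exact: measurable_bump.
  - by move=> y _; rewrite lee_fin mulr_ge0 ?bump_ge0.
  - exact/measurable_EFinP.
  - by move=> y _; rewrite lee_fin.
  apply: eq_integral => y _; rewrite /F/=.
  under eq_integral do rewrite mulrC EFinM.
  rewrite ge0_integralZl_EFin//; last first.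
    apply: measurable_1cos; apply: measurable_sum => i.
    by apply: measurable_funM => //; exact: measurable_tnth.
  under eq_integral do rewrite -[X in cos X]addr0.
  rewrite integral_1cos_gauss cos0 mul1r -EFinM -EFinD mulrDr mulr1; congr (_ + _ * expR _)%:E.
  rewrite !mulNr mulr_suml mulr_suml; congr (- _).
  by apply: eq_bigr => i _; field; rewrite gt_eqF.
have : (0 <= \int[lebn]_y (p y * bump e z y)%:E)%E.
  by apply: integral_ge0 => y _; rewrite lee_fin mulr_ge0 ?bump_ge0.
rewrite -[RHS]/(I (sqz z)) Irz; move: LM; rewrite LE.
by case: (\int[lebn]_y (p y * bump e z y)%:E)%E => // r; rewrite -EFinD => -[h] _; congr EFin; lra.
Qed.

End smoothed_kernel.

Section euclidean_norm.
Context (R : realType).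

Lemma sqr_sum_mul (I : finType) (u v : I -> R) :
  (\sum_i u i * v i) ^+ 2 <= (\sum_i u i ^+ 2) * (\sum_i v i ^+ 2).
Proof.
set S := \sum_i u i * v i; set A := \sum_i u i ^+ 2; set B := \sum_i v i ^+ 2.
have B0 : 0 <= B by apply: sumr_ge0 => i _; exact: sqr_ge0.
have E t : 0 <= A - 2 * t * S + t ^+ 2 * B.
  have -> : A - 2 * t * S + t ^+ 2 * B = \sum_i (u i - t * v i) ^+ 2.
    rewrite /A /S /B !mulr_sumr -sumrB -big_split/=.
    by apply: eq_bigr => i _; ring.
  by apply: sumr_ge0 => i _; exact: sqr_ge0.
have [B_eq0|B_neq0] := eqVneq B 0.
  have v0 i : v i = 0.
    move/eqP: B_eq0; rewrite psumr_eq0; last by move=> j _; exact: sqr_ge0.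
    by move=> /allP/(_ i); rewrite mem_index_enum sqrf_eq0 => /(_ isT)/eqP.
  by rewrite /S big1 ?expr0n ?B_eq0 ?mulr0// => i _; rewrite v0 mulr0.
have B_gt0 : 0 < B by rewrite lt_neqAle eq_sym B_neq0.
have := E (S / B).
have -> : A - 2 * (S / B) * S + (S / B) ^+ 2 * B = A - S ^+ 2 / B by field.
by rewrite subr_ge0 ler_pdivrMr.
Qed.

Lemma enorm_ge0 m (u : 'cV[R]_m) : 0 <= enorm u.
Proof. exact: sqrtr_ge0. Qed.

Lemma enorm_le_add m (u v : 'cV[R]_m) : enorm u <= enorm (u - v) + enorm v.
Proof.
rewrite -(@ler_pXn2r _ 2)// ?nnegrE ?addr_ge0 ?enorm_ge0// sqrrD.
rewrite !enorm_sqr; set w := u - v.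
have uE i : u i 0 = w i 0 + v i 0 by rewrite !mxE subrK.
have -> : \sum_i u i 0 ^+ 2 =
    \sum_i w i 0 ^+ 2 + (\sum_i w i 0 * v i 0) *+ 2 + \sum_i v i 0 ^+ 2.
  by rewrite -sumrMnl -!big_split; apply: eq_bigr => i _; rewrite uE sqrrD.
rewrite lerD2r lerD2l lerMn2r/=.
apply: (le_trans (ler_norm _)).
rewrite -(@ler_pXn2r _ 2)// ?nnegrE ?mulr_ge0 ?enorm_ge0// real_normK ?num_real//.
by rewrite exprMn !enorm_sqr; exact: sqr_sum_mul.
Qed.

Lemma enorm_sub_sym m (u v : 'cV[R]_m) : enorm (u - v) = enorm (v - u).
Proof.
by rewrite /enorm; congr Num.sqrt; apply: eq_bigr => i _; rewrite !mxE -sqrrN opprB.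
Qed.

Lemma dist_enorm m (u v : 'cV[R]_m) : `|enorm u - enorm v| <= enorm (u - v).
Proof.
rewrite ler_norml lerBlDr enorm_le_add andbT.
by rewrite lerBrDl lerBlDr addrC enorm_sub_sym enorm_le_add.
Qed.

End euclidean_norm.

(** * Estimates for the Bessel kernel *)

Section real_estimates.
Context (R : realType).

Lemma expRN_powR_le (p : R) : 0 < p -> exists2 C : R, 0 < C &
  forall x, 0 < x -> expR (- x / 4) <= C * x `^ (- p).
Proof.
move=> p0; exists (expR (p * ln (4 * p))); first exact: expR_gt0.
move=> x x0; rewrite /powR gt_eqF// -expRD ler_expR.
have p40 : 0 < 4 * p by rewrite mulr_gt0.
have y0 : 0 < x / (4 * p) by rewrite divr_gt0.
have := expR_ge1Dx (ln (x / (4 * p))); rewrite lnK ?posrE// ln_div ?posrE//.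
rewrite -(ler_pM2l p0) (_ : p * (x / (4 * p)) = x / 4); last by field; rewrite gt_eqF.
by lra.
Qed.

Lemma powR_neg_le (w v q : R) : 0 < w <= v -> q <= 0 -> v `^ q <= w `^ q.
Proof.
move=> /andP[w0 wv] q0; have v0 := lt_le_trans w0 wv.
by rewrite /powR !gt_eqF// ler_expR ler_wnM2l// ler_ln.
Qed.

Lemma gauss_holder (x y gm : R) : 0 <= x -> 0 <= y -> 0 < gm <= 1 ->
  expR (- x ^+ 2 / 2) <= expR (- y ^+ 2 / 2) + 2 * `|x - y| `^ gm * expR (- x ^+ 2 / 4).
Proof.
move=> x0 y0 /andP[gm0 gm1].
have F0 : 0 <= 2 * `|x - y| `^ gm * expR (- x ^+ 2 / 4).
  by rewrite !mulr_ge0 ?powR_ge0 ?expR_ge0.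
have [yx|xy] := leP y x.
  rewrite -[leLHS]addr0 lerD// ler_expR !mulNr lerN2 ler_pM2r//.
  by rewrite ler_pXn2r.
set h := y - x; have h0 : 0 < h by rewrite subr_gt0.
have -> : `|x - y| = h by rewrite distrC gtr0_norm.
set E := expR (- x ^+ 2 / 4).
have EE : expR (- x ^+ 2 / 2) = E * E by rewrite -expRD; congr expR; field.
have E0 : 0 < E by exact: expR_gt0.
have E1 : E <= 1 by rewrite -expR0 ler_expR mulNr oppr_le0 divr_ge0// sqr_ge0.
have [h1|h1] := leP 1 h.
  have hg : 1 <= h `^ gm by rewrite -(powRr0 h) ler_powR// ltW.
  have F1 : 0 <= expR (- y ^+ 2 / 2) by exact: expR_ge0.
  rewrite EE; nra.
have hg : h <= h `^ gm.
  by rewrite /powR gt_eqF// -[leLHS]lnK ?posrE// ler_expR; have := ln_le0 (ltW h1); nra.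
have Ex : E * (x + 2^-1) <= 2.
  have := expR_ge1Dx (x ^+ 2 / 4).
  have EV : E * expR (x ^+ 2 / 4) = 1 by rewrite -expRD mulNr addNr expR0.
  have := sqr_ge0 (x - 1); nra.
have yE : expR (- y ^+ 2 / 2) = E * E * expR (- (h * (x + h / 2))).
  by rewrite -EE -expRD /h; congr expR; field.
have := expR_ge1Dx (- (h * (x + h / 2))); rewrite yE EE.
set e := expR (- (h * _)) => h2.
have h3 : E * E - E * E * e <= E * E * (h * (x + h / 2)).
  rewrite -{1}[E * E]mulr1 -mulrBr ler_wpM2l ?mulr_ge0 ?(ltW E0)//; lra.
have h4 : E * E * (h * (x + h / 2)) <= 2 * h * E.
  have : E * (x + h / 2) <= 2 by nra.
  have hE : 0 < h * E by rewrite mulr_gt0.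
  by rewrite -(ler_pM2r hE); nra.
have : 2 * h * E <= 2 * h `^ gm * E by rewrite ler_wpM2r ?ler_wpM2l// ltW.
by lra.
Qed.

Lemma gauss_tail_small (D eta : R) m : 0 < D -> 0 < eta ->
  exists2 e : R, 0 < e <= 1 & expR (- (D / e ^+ 2)) <= eta * e ^+ m.
Proof.
move=> D0 eta0.
pose K := (m.+1)`!%:R / D ^+ m.+1.
have K0 : 0 < K by rewrite divr_gt0 ?exprn_gt0// ltr0n fact_gt0.
pose e := Num.min 1 (eta / K); have e0 : 0 < e by rewrite lt_min ltr01 divr_gt0.
have e1 : e <= 1 by rewrite ge_min lexx.
exists e; first by rewrite e0.
have z0 : 0 <= D / e ^+ 2 by rewrite divr_ge0 ?exprn_ge0// ltW.
have eK : K * e <= eta.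
  by rewrite mulrC -ler_pdivlMr// ge_min lexx orbT.
have z1 : (D / e ^+ 2) ^+ m.+1 / (m.+1)`!%:R <= expR (D / e ^+ 2).
  by apply: le_trans (expR_ge1Dxn m z0); rewrite lerDr.
have zp : 0 < (D / e ^+ 2) ^+ m.+1 / (m.+1)`!%:R.
  by rewrite divr_gt0 ?exprn_gt0 ?divr_gt0 ?exprn_gt0// ltr0n fact_gt0.
rewrite expRN; apply: (@le_trans _ _ (((D / e ^+ 2) ^+ m.+1 / (m.+1)`!%:R)^-1)).
  by rewrite lef_pV2 ?posrE ?expR_gt0.
have -> : ((D / e ^+ 2) ^+ m.+1 / (m.+1)`!%:R)^-1 = K * e * (e ^+ m * e ^+ m.+1).
  transitivity (K * e ^+ m.+1 * e ^+ m.+1); last by rewrite mulrA -[K * e * _]mulrA -exprS.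
  rewrite /K exprMn exprVn -exprM mulnC exprM; set E := e ^+ m.+1; set D' := D ^+ m.+1.
  have E0 : 0 < E by rewrite exprn_gt0.
  have D'0 : 0 < D' by rewrite exprn_gt0.
  by field; rewrite !gt_eqF// ?exprn_gt0 ?ltr0n ?fact_gt0.
apply: ler_pM => //; first by rewrite mulr_ge0 ?ltW.
  by rewrite mulr_ge0 ?exprn_ge0// ltW.
by rewrite ler_piMr ?exprn_ge0 ?exprn_ile1// ltW.
Qed.

End real_estimates.

Section kernel_mix_bounds.
Context (R : realType) (n : nat) (a : R).

Lemma kernel_mix_le (p : R) : 0 < p <= n%:R / 2 -> exists2 K : R, 0 < K &
  forall e b u, 0 < b ->
    kernel_mix n a e b u <= K * b `^ (- p) * expR ((a + p - n%:R / 2) * u - expR u).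
Proof.
move=> /andP[p0 pn]; have [C C0 H] := expRN_powR_le p0.
exists (C * 2 `^ (p - n%:R / 2)); first by rewrite mulr_gt0// powR_gt0.
move=> e b u b0; rewrite /kernel_mix.
set v := e ^+ 2 + 2 * expR u; set w := 2 * expR u.
have w0 : 0 < w by rewrite mulr_gt0// expR_gt0.
have wv : w <= v by rewrite lerDr sqr_ge0.
have v0 := lt_le_trans w0 wv.
have bv : 0 < b / v by rewrite divr_gt0.
have h1 : expR (- b / (2 * v)) <= C * (b `^ (- p) * v `^ p).
  have -> : b `^ (- p) * v `^ p = (b / v) `^ (- p).
    by rewrite powRM ?invr_ge0 ?(ltW b0) ?(ltW v0)// -powR_inv1 ?(ltW v0)// -powRrM mulN1r opprK.
  apply: le_trans (H _ bv); rewrite ler_expR !mulNr lerN2.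
  have -> : b / (2 * v) = 2 * (b / v / 4) by field; rewrite gt_eqF.
  by have : 0 < b / v / 4 by [rewrite divr_gt0]; lra.
have h2 : v `^ (p - n%:R / 2) <= w `^ (p - n%:R / 2).
  by apply: powR_neg_le; rewrite ?w0// subr_le0.
have wE : w `^ (p - n%:R / 2) = 2 `^ (p - n%:R / 2) * expR ((p - n%:R / 2) * u).
  rewrite powRM ?expR_ge0//; congr (_ * _).
  by rewrite /powR gt_eqF ?expR_gt0// expRK.
rewrite -[leRHS](_ : expR (a * u - expR u) * (C * b `^ (- p) * (2 `^ (p - n%:R / 2) * expR ((p - n%:R / 2) * u))) = _); last first.
  rewrite (_ : (a + p - n%:R / 2) * u - expR u = (a * u - expR u) + (p - n%:R / 2) * u); last by ring.
  by rewrite [in RHS]expRD; ring.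
rewrite ler_wpM2l ?expR_ge0// -wE.
apply: (@le_trans _ _ (v `^ (- (n%:R / 2)) * (C * (b `^ (- p) * v `^ p)))).
  by rewrite ler_wpM2l ?powR_ge0.
have -> : v `^ (- (n%:R / 2)) * (C * (b `^ (- p) * v `^ p)) =
    C * b `^ (- p) * v `^ (p - n%:R / 2).
  by rewrite powRD ?(gt_eqF v0) ?implybT//; ring.
by rewrite ler_wpM2l// mulr_ge0 ?powR_ge0 ?ltW.
Qed.

Lemma kernel_mix_holder (p gm : R) : 0 < gm <= 1 -> 0 < p <= (n%:R + gm) / 2 ->
  exists2 K : R, 0 < K & forall e r r' u, 0 < r -> 0 <= r' ->
    kernel_mix n a e (r ^+ 2) u <= kernel_mix n a e (r' ^+ 2) u +
      K * `|r - r'| `^ gm * (r ^+ 2) `^ (- p) *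
        expR ((a + p - (n%:R + gm) / 2) * u - expR u).
Proof.
move=> gm01 /andP[p0 pn]; have [C C0 H] := expRN_powR_le p0.
exists (2 * C * 2 `^ (p - (n%:R + gm) / 2)).
  by rewrite !mulr_gt0// powR_gt0.
move=> e r r' u r0 r'0; rewrite /kernel_mix.
set v := e ^+ 2 + 2 * expR u; set w := 2 * expR u.
have w0 : 0 < w by rewrite mulr_gt0// expR_gt0.
have wv : w <= v by rewrite lerDr sqr_ge0.
have v0 := lt_le_trans w0 wv.
have b0 : 0 < r ^+ 2 by rewrite exprn_gt0.
have bv : 0 < r ^+ 2 / v by rewrite divr_gt0.
set q := Num.sqrt v.
have q0 : 0 < q by rewrite sqrtr_gt0.
have q2 : q ^+ 2 = v by rewrite sqr_sqrtr// ltW.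
have G := @gauss_holder R (r / q) (r' / q) gm (divr_ge0 (ltW r0) (ltW q0)) (divr_ge0 r'0 (ltW q0)) gm01.
rewrite -mulrBl normrM normfV (gtr0_norm q0) !exprMn !exprVn q2 in G.
have E2 s : - (s / v) / 2 = - s / (2 * v) by field; rewrite gt_eqF.
rewrite !E2 in G.
have h1 : expR (- (r ^+ 2 / v) / 4) <= C * ((r ^+ 2) `^ (- p) * v `^ p).
  have -> : (r ^+ 2) `^ (- p) * v `^ p = (r ^+ 2 / v) `^ (- p).
    by rewrite [RHS]powRM ?invr_ge0 ?(ltW b0) ?(ltW v0)// -powR_inv1 ?(ltW v0)// -[in RHS]powRrM mulN1r opprK.
  exact: H.
have dE : (`|r - r'| / q) `^ gm = `|r - r'| `^ gm * v `^ (- (gm / 2)).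
  rewrite powRM ?invr_ge0 ?normr_ge0 ?(ltW q0)//; congr (_ * _).
  have -> : q^-1 = v `^ (- 2^-1) by rewrite /q -powR12_sqrt ?(ltW v0)// powRN.
  by rewrite -powRrM; congr (_ `^ _); field.
rewrite dE in G.
set s := (n%:R + gm) / 2.
have h2 : v `^ (p - s) <= w `^ (p - s).
  by apply: powR_neg_le; rewrite ?w0// subr_le0.
have wE : w `^ (p - s) = 2 `^ (p - s) * expR ((p - s) * u).
  rewrite powRM ?expR_ge0//; congr (_ * _).
  by rewrite /powR gt_eqF ?expR_gt0// expRK.
have rhsE : 2 * C * 2 `^ (p - s) * `|r - r'| `^ gm * (r ^+ 2) `^ (- p) *
    expR ((a + p - s) * u - expR u) =
    expR (a * u - expR u) * (2 * `|r - r'| `^ gm * (C * (r ^+ 2) `^ (- p) * w `^ (p - s))).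
  rewrite wE (_ : (a + p - s) * u - expR u = (a * u - expR u) + (p - s) * u); last by ring.
  by rewrite [expR (_ + (p - s) * u)]expRD; ring.
rewrite rhsE -mulrDr ler_wpM2l ?expR_ge0//.
apply: (@le_trans _ _ (v `^ (- (n%:R / 2)) * (expR (- r' ^+ 2 / (2 * v)) +
  2 * (`|r - r'| `^ gm * v `^ (- (gm / 2))) * (C * ((r ^+ 2) `^ (- p) * v `^ p))))).
  rewrite ler_wpM2l ?powR_ge0//; apply: (le_trans G); rewrite lerD2l.
  by rewrite ler_wpM2l// !mulr_ge0 ?powR_ge0.
rewrite mulrDr lerD2l.
have -> : v `^ (- (n%:R / 2)) * (2 * (`|r - r'| `^ gm * v `^ (- (gm / 2))) *
    (C * ((r ^+ 2) `^ (- p) * v `^ p))) =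
    2 * `|r - r'| `^ gm * (C * (r ^+ 2) `^ (- p) * v `^ (p - s)).
  rewrite (_ : p - s = - (n%:R / 2) + (- (gm / 2) + p)); last by rewrite /s; field.
  by rewrite !powRD ?(gt_eqF v0) ?implybT//; ring.
by rewrite ler_wpM2l ?mulr_ge0 ?powR_ge0// ler_wpM2l// mulr_ge0 ?powR_ge0 ?ltW.
Qed.

End kernel_mix_bounds.

Section bessel_kernel.
Context (R : realType) (n : nat).
Local Notation leb := (@lebesgue_measure R).
Local Notation lebn := (lebesgue_Rn R n).

Let kap : R := (normal_peak 1)^-1.

Let kap_gt0 : 0 < kap.
Proof. by rewrite invr_gt0 normal_peak_gt0// oner_neq0. Qed.

Lemma integral_bump (e : R) (z : 'cV[R]_n) : 0 < e ->
  (\int[lebn]_y (bump e z y)%:E = ((kap * e) ^+ n)%:E)%E.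
Proof.
move=> e0; have e_neq0 : e != 0 by rewrite gt_eqF.
pose f (i : 'I_n) (x : measurableTypeR R) : R := normal_fun (z i 0) e x.
have E y : (bump e z y)%:E = (\prod_(i < n) f i (tnth y i))%:E.
  rewrite /bump /f /normal_fun -expR_sum; congr (expR _)%:E.
  rewrite -sumrN mulr_suml; apply: eq_bigr => i _.
  by rewrite -[e ^+ 2 *+ 2]mulr_natl -[(tnth y i - _) ^+ 2]sqrrN opprB.
under eq_integral do rewrite E.
apply: (etrans (@ge0_integral_tuple_prodR _ _ R leb n f (fun=> kap * e) _ _ _)).
- by move=> i; exact: measurable_normal_fun.
- by move=> i x; exact: expR_ge0.
- move=> i; have pk0 : 0 < normal_peak e by rewrite normal_peak_gt0.
  have pkE : normal_peak e = e^-1 * normal_peak 1.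
    by rewrite -[X in normal_peak X = _]invrK normal_peakV ?invr_gt0.
  have F x : (f i x)%:E = ((kap * e)%:E * (normal_pdf (z i 0) e x)%:E)%E.
    rewrite -EFinM normal_pdfE//; congr EFin.
    rewrite -[RHS]/(kap * e * (normal_peak e * f i x)) pkE /kap.
    by field; rewrite !gt_eqF// normal_peak_gt0// oner_neq0.
  under eq_integral do rewrite F.
  rewrite ge0_integralZl_EFin; first by rewrite integral_normal_pdf mule1.
  - by [].
  - by move=> x _; rewrite lee_fin normal_pdf_ge0.
  - by apply/measurable_EFinP; exact: measurable_normal_pdf.
  - by rewrite mulr_ge0// ltW.
by rewrite prodr_const card_ord.
Qed.

(* Away from [z] a bump is exponentially small compared with one of twice the
   width, so no tail of a Gaussian integral has to be estimated. *)
Lemma bump_far (e dl : R) (z : 'cV[R]_n) (y : Rn R n) : 0 < e -> dl ^+ 2 <= \sum_i (z i 0 - tnth y i) ^+ 2 ->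
  bump e z y <= expR (- (dl ^+ 2 / 4 / e ^+ 2)) * bump (2 * e) z y.
Proof.
move=> e0; rewrite /bump -expRD ler_expR; set Q := \sum_i _; move=> h.
have e2 : 0 < e ^+ 2 by rewrite exprn_gt0.
rewrite (_ : - Q / (2 * e ^+ 2) = - (3 * Q / 8 / e ^+ 2) + - Q / (2 * (2 * e) ^+ 2)); last first.
  by field; rewrite gt_eqF.
rewrite lerD2r lerN2 ler_pM2r ?invr_gt0//.
have := sqr_ge0 dl; lra.
Qed.

Lemma bump_le1 (e : R) (z : 'cV[R]_n) y : bump e z y <= 1.
Proof.
rewrite /bump -expR0 ler_expR mulNr oppr_le0 divr_ge0//.
  by apply: sumr_ge0 => i _; exact: sqr_ge0.
by rewrite mulr_ge0// sqr_ge0.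
Qed.

Variables (alpha : R) (g : 'cV[R]_n -> \bar R).
Hypothesis gB : is_bessel_kernel alpha g.
Hypothesis alpha_itv : 0 < alpha < n%:R.

Let p (y : Rn R n) := fine (g (colv y)).

Let g0 x : (0 <= g x)%E. Proof. by have [_ + _ _ _] := gB. Qed.

Let p0 y : 0 <= p y. Proof. exact: fine_ge0. Qed.

Let ig : lebn.-integrable setT (g \o @colv R n). Proof. by have [_ _ + _ _] := gB. Qed.

Let mg : measurable_fun setT (g \o @colv R n). Proof. exact: measurable_int ig. Qed.

Let mp : measurable_fun setT p.
Proof. exact: (measurableT_comp (fine_measurable _) mg). Qed.

Let ae_p : {ae lebn, forall y, g (colv y) = (p y)%:E}.
Proof.
by apply: filterS (integrable_ae measurableT ig) => y /(_ I) /= gy; rewrite fineK.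
Qed.

Let ip : lebn.-integrable setT (EFin \o p).
Proof.
apply: le_integrable ig => //; first exact/measurable_EFinP.
move=> y _ /=; rewrite (gee0_abs (g0 _)) ger0_norm//.
by rewrite /p; case: (g (colv y)) (g0 (colv y)).
Qed.

Let p_integral (b : Rn R n -> R) : measurable_fun setT b ->
  (\int[lebn]_y ((b y)%:E * g (colv y)) = \int[lebn]_y (b y * p y)%:E)%E.
Proof.
move=> mb; apply: ae_eq_integral => //.
- by apply: emeasurable_funM => //; exact/measurable_EFinP.
- by apply/measurable_EFinP; exact: measurable_funM.
- by apply: filterS ae_p => y gy _; rewrite gy EFinM.
Qed.

Let mdot xi : measurable_fun setT (fun x : Rn R n => dotv (colv x) xi).
Proof.
by apply: measurable_sum => i; apply: measurable_funM => //; exact: measurable_colv.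
Qed.

Let hcos xi : (\int[lebn]_x (cos (dotv (colv x) xi) * p x)%:E
   = ((1 + enorm xi ^+ 2) `^ (- (alpha / 2)))%:E)%E.
Proof.
have [_ _ _ <- _] := gB; rewrite -(p_integral (b := fun x => cos (dotv (colv x) xi)))//.
exact: (measurableT_comp (continuous_measurable_fun (@continuous_cos R)) (mdot xi)).
Qed.

Let hsin xi : (\int[lebn]_x (sin (dotv (colv x) xi) * p x)%:E = 0)%E.
Proof.
have [_ _ _ _ hs] := gB; rewrite -(hs xi) -(p_integral (b := fun x => sin (dotv (colv x) xi)))//.
exact: (measurableT_comp (continuous_measurable_fun (@continuous_sin R)) (mdot xi)).
Qed.

Local Notation N := (fun (e : R) (z : 'cV[R]_n) => \int[lebn]_y (p y * bump e z y)%:E)%E.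

Let near_kernel (z : 'cV[R]_n) (U : set (\bar R)) : nbhs (g z) U ->
  exists2 dl : R, 0 < dl & forall y : Rn R n,
    \sum_i (z i 0 - tnth y i) ^+ 2 < dl ^+ 2 -> U (g (colv y)).
Proof.
move=> Uz; have [gc _ _ _ _] := gB.
have /nbhs_ballP[dl /= dl0 H] := gc z U Uz.
exists dl => // y hy; apply: H; split => // i j; rewrite (ord1 j) /ball/= !mxE.
rewrite -(@ltr_pXn2r _ 2)// ?nnegrE ?(ltW dl0)// real_normK ?num_real//.
apply: le_lt_trans hy; rewrite (bigD1 i)//= lerDl.
by apply: sumr_ge0 => k _; exact: sqr_ge0.
Qed.

Lemma smoothed_ge (z : 'cV[R]_n) (s : R) : 0 <= s -> (s%:E < g z)%E ->
  exists2 D : R, 0 < D & forall e, 0 < e ->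
    ((s * (kap * e) ^+ n)%:E <=
     N e z + (s * expR (- (D / e ^+ 2)) * (kap * (2 * e)) ^+ n)%:E)%E.
Proof.
move=> s0 sg.
have [dl dl0 H] : exists2 dl : R, 0 < dl & forall y : Rn R n,
    \sum_i (z i 0 - tnth y i) ^+ 2 < dl ^+ 2 -> (s%:E < g (colv y))%E.
  apply: (near_kernel (U := [set x | (s%:E < x)%E])).
  by apply: open_nbhs_nbhs; split => //; exact: open_ereal_gt_ereal.
exists (dl ^+ 2 / 4) => [|e e0]; first by rewrite divr_gt0// exprn_gt0.
set T := expR _; have T0 : 0 <= T by exact: expR_ge0.
have mb e' : measurable_fun setT (fun y => (bump e' z y)%:E : \bar R).
  by apply/measurable_EFinP; exact: measurable_bump.
have b0 e' y : (0 <= (bump e' z y)%:E)%E by rewrite lee_fin bump_ge0.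
rewrite EFinM -(integral_bump z e0) -ge0_integralZl_EFin//.
rewrite [(s * T * _)%:E]EFinM -(@integral_bump (2 * e) z) ?mulr_gt0//.
rewrite -[(_ * \int[_]_y _)%E in leRHS]ge0_integralZl_EFin ?mulr_ge0//.
rewrite -ge0_integralD//; first last.
- exact: measurable_funeM.
- by move=> y _; rewrite mule_ge0 ?lee_fin ?bump_ge0 ?mulr_ge0.
- by apply/measurable_EFinP; apply: measurable_funM => //; exact: measurable_bump.
- by move=> y _; rewrite lee_fin mulr_ge0// bump_ge0.
apply: ae_ge0_le_integral => //.
- by move=> y _; rewrite mule_ge0 ?lee_fin ?bump_ge0.
- exact: measurable_funeM.
- move=> y _; apply: adde_ge0; first by rewrite lee_fin mulr_ge0// bump_ge0.
  by apply: (mule_ge0 _ (b0 _ _)); rewrite lee_fin; exact: mulr_ge0.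
- apply: emeasurable_funD; last exact: measurable_funeM.
  by apply/measurable_EFinP; apply: measurable_funM => //; exact: measurable_bump.
apply: filterS ae_p => y gy _; rewrite -!EFinM -EFinD lee_fin.
have [yn|yf] := ltP (\sum_i (z i 0 - tnth y i) ^+ 2) (dl ^+ 2).
  have := H y yn; rewrite gy lte_fin => sp.
  rewrite -[leLHS]addr0; apply: lerD; last by rewrite !mulr_ge0// bump_ge0.
  by rewrite ler_wpM2r ?bump_ge0// ltW.
rewrite -[leLHS]add0r; apply: lerD; first by rewrite mulr_ge0// bump_ge0.
by rewrite -mulrA ler_wpM2l// bump_far.
Qed.

Lemma smoothed_le (z : 'cV[R]_n) (s : R) : 0 <= s -> (g z < s%:E)%E ->
  exists2 D : R, 0 < D & forall e, 0 < e ->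
    (N e z <= (s * (kap * e) ^+ n + expR (- (D / e ^+ 2)))%:E)%E.
Proof.
move=> s0 sg.
have [dl dl0 H] : exists2 dl : R, 0 < dl & forall y : Rn R n,
    \sum_i (z i 0 - tnth y i) ^+ 2 < dl ^+ 2 -> (g (colv y) < s%:E)%E.
  apply: (near_kernel (U := [set x | (x < s%:E)%E])).
  by apply: open_nbhs_nbhs; split => //; exact: open_ereal_lt_ereal.
exists (dl ^+ 2 / 4) => [|e e0]; first by rewrite divr_gt0// exprn_gt0.
set T := expR _; have T0 : 0 <= T by exact: expR_ge0.
have mb e' : measurable_fun setT (fun y => (bump e' z y)%:E : \bar R).
  by apply/measurable_EFinP; exact: measurable_bump.
have b0 e' y : (0 <= (bump e' z y)%:E)%E by rewrite lee_fin bump_ge0.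
have mpE : measurable_fun setT (fun y => (p y)%:E) by exact/measurable_EFinP.
rewrite EFinD EFinM -(integral_bump z e0) -[T%:E]mule1 -(integral_kernel hcos).
rewrite -!ge0_integralZl_EFin//; last first.
  by move=> y _; rewrite lee_fin.
rewrite -ge0_integralD//; last 4 first.
- by move=> y _; rewrite mule_ge0 ?lee_fin ?bump_ge0.
- exact: measurable_funeM.
- by move=> y _; rewrite mule_ge0 ?lee_fin.
- exact: measurable_funeM.
apply: ae_ge0_le_integral => //.
- by move=> y _; rewrite lee_fin mulr_ge0 ?bump_ge0.
- by apply/measurable_EFinP; apply: measurable_funM => //; exact: measurable_bump.
- move=> y _; apply: adde_ge0; first by apply: (mule_ge0 _ (b0 _ _)); rewrite lee_fin.
  by apply: mule_ge0; rewrite lee_fin.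
- by apply: emeasurable_funD; exact: measurable_funeM.
apply: filterS ae_p => y gy _; rewrite -!EFinM -EFinD lee_fin.
have [yn|yf] := ltP (\sum_i (z i 0 - tnth y i) ^+ 2) (dl ^+ 2).
  have := H y yn; rewrite gy lte_fin => sp.
  rewrite -[leLHS]addr0; apply: lerD; last by rewrite mulr_ge0.
  by rewrite ler_wpM2r ?bump_ge0// ltW.
rewrite -[leLHS]add0r; apply: lerD; first by rewrite mulr_ge0// bump_ge0.
rewrite mulrC ler_wpM2r//; apply: (le_trans (bump_far e0 yf)).
by rewrite ler_piMr// bump_le1.
Qed.

Let a_gt0 : 0 < alpha / 2.
Proof. by have /andP[? _] := alpha_itv; rewrite divr_gt0. Qed.

Let mk e b : 0 < e -> measurable_fun setT (fun u => (kernel_mix n (alpha / 2) e b u)%:E).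
Proof. by move=> e0; apply/measurable_EFinP; exact: measurable_kernel_mix. Qed.

Let k0 e b u : (0 <= (kernel_mix n (alpha / 2) e b u)%:E)%E.
Proof. by rewrite lee_fin kernel_mix_ge0. Qed.

Lemma bessel_kernel_le (q : R) : n%:R - alpha < q <= n%:R ->
  exists2 K : R, 0 < K & forall z, 0 < enorm z -> (g z <= (K * enorm z `^ (- q))%:E)%E.
Proof.
move=> /andP[q1 q2].
have q0 : 0 < q / 2 by have /andP[? ?] := alpha_itv; rewrite divr_gt0//; lra.
have qn : 0 < q / 2 <= n%:R / 2 by rewrite q0 ler_pM2r.
have [c c0 cE] := gamma_integral_fin a_gt0.
have [K K0 HK] := kernel_mix_le (alpha / 2) qn.
have a'0 : 0 < alpha / 2 + q / 2 - n%:R / 2 by lra.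
have [c1 c10 c1E] := gamma_integral_fin a'0.
exists (2 * kap ^- n * c^-1 * K * c1).
  by rewrite !mulr_gt0 ?invr_gt0 ?exprn_gt0.
move=> z z0; set r := enorm z in z0 *.
have rE : (r ^+ 2) `^ (- (q / 2)) = r `^ (- q).
  by rewrite -powR_mulrn ?(ltW z0)// -powRrM; congr (_ `^ _); field.
set Q := r `^ (- q); have Q0 : 0 < Q by exact: powR_gt0.
have U e : 0 < e -> (N e z <= (c^-1 * e ^+ n * (K * Q * c1))%:E)%E.
  move=> e0; have mke b := mk b e0; rewrite (integral_bump_kernel p0 ip hcos hsin cE c0 a_gt0 e0).
  rewrite [leRHS]EFinM; apply: lee_wpmul2l.
    by rewrite lee_fin mulr_ge0 ?invr_ge0 ?exprn_ge0// ltW.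
  have KQ0 : 0 <= K * Q by rewrite mulr_ge0// ltW.
  rewrite [leRHS]EFinM -c1E -ge0_integralZl_EFin//; last exact: measurable_gamma_density.
  apply: ge0_le_integral => //.
    exact: mke.
    by apply: measurable_funeM; exact: measurable_gamma_density.
  move=> u _; rewrite -EFinM lee_fin -enorm_sqr /Q -rE; apply: HK.
  by rewrite exprn_gt0.
rewrite leNgt; apply/negP => gB'.
set B := 2 * kap ^- n * c^-1 * K * c1 * Q in gB'.
have B0 : 0 < B by rewrite /B !mulr_gt0 ?invr_gt0 ?exprn_gt0.
have [s Bs sg] : exists2 s : R, B < s & (s%:E < g z)%E.
  case: (g z) gB' => [r'||]//.
    rewrite lte_fin => Br; exists ((B + r') / 2); [lra|rewrite lte_fin; lra].
  by move=> _; exists (B + 1); [lra|exact: ltry].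
have s0 : 0 < s by exact: lt_trans Bs.
have [D D0 HD] := smoothed_ge (ltW s0) sg.
have eta0 : 0 < (2 * 2 ^+ n)^-1 :> R by rewrite invr_gt0 mulr_gt0// exprn_gt0.
have [e /andP[e0 e1] he] := gauss_tail_small n D0 eta0.
have := le_trans (HD e e0) (leeD (U e e0) (lexx _)).
rewrite -EFinD lee_fin leNgt => /negP; apply.
set T := expR _ in he *.
have en : 0 < e ^+ n by rewrite exprn_gt0.
have en1 : e ^+ n <= 1 by rewrite exprn_ile1// ltW.
have kn : 0 < kap ^+ n by rewrite exprn_gt0.
have tn : 0 < 2 ^+ n :> R by rewrite exprn_gt0.
have T1 : T * 2 ^+ n <= 2^-1.
  have : T <= (2 * 2 ^+ n)^-1 by apply: le_trans he _; rewrite ler_piMr// ltW.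
  rewrite invfM -(ler_pM2r tn) => /le_trans; apply.
  by rewrite -mulrA mulVf ?mulr1// gt_eqF.
have BE : c^-1 * e ^+ n * (K * Q * c1) = B / 2 * (kap ^+ n * e ^+ n).
  by rewrite /B; field; rewrite ?gt_eqF.
rewrite BE !exprMn.
have -> : s * T * (kap ^+ n * (2 ^+ n * e ^+ n)) = s * (T * 2 ^+ n) * (kap ^+ n * e ^+ n) by ring.
have ke : 0 < kap ^+ n * e ^+ n by rewrite mulr_gt0.
rewrite -mulrDl ltr_pM2r//.
have : s * (T * 2 ^+ n) <= s * 2^-1 by rewrite ler_wpM2l// ltW.
lra.
Qed.

Lemma bessel_kernel_holder (q gm : R) : 0 < gm <= 1 ->
  n%:R - alpha + gm < q <= n%:R + gm ->
  exists2 K : R, 0 < K & forall z z', 0 < enorm z -> 0 < enorm z' ->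
    fine (g z) <= fine (g z') + K * enorm (z - z') `^ gm * enorm z `^ (- q).
Proof.
move=> gm01 /andP[q1 q2]; have /andP[gm0 gm1] := gm01.
have /andP[al0 aln] := alpha_itv.
have fing z : 0 < enorm z -> g z \is a fin_num.
  have [q' /bessel_kernel_le[K K0 HK]] : exists q', n%:R - alpha < q' <= n%:R.
    by exists n%:R; rewrite lexx andbT; lra.
  by move=> /HK h; rewrite ge0_fin_numE// (le_lt_trans h)// ltry.
have q0 : 0 < q / 2 by rewrite divr_gt0//; lra.
have qn : 0 < q / 2 <= (n%:R + gm) / 2 by rewrite q0 ler_pM2r.
have [c c0 cE] := gamma_integral_fin a_gt0.
have [K K0 HK] := kernel_mix_holder (alpha / 2) gm01 qn.
have a'0 : 0 < alpha / 2 + q / 2 - (n%:R + gm) / 2 by lra.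
have [c1 c10 c1E] := gamma_integral_fin a'0.
exists (kap ^- n * c^-1 * K * c1).
  by rewrite !mulr_gt0 ?invr_gt0 ?exprn_gt0.
move=> z z' z0 z'0; set r := enorm z in z0 *.
have rE : (r ^+ 2) `^ (- (q / 2)) = r `^ (- q).
  by rewrite -powR_mulrn ?(ltW z0)// -powRrM; congr (_ `^ _); field.
set Q := enorm (z - z') `^ gm * r `^ (- q).
have Q0 : 0 <= Q by rewrite mulr_ge0 ?powR_ge0.
have U e : 0 < e -> (N e z <= N e z' + (c^-1 * e ^+ n * (K * Q * c1))%:E)%E.
  move=> e0; have mke b := mk b e0; rewrite !(integral_bump_kernel p0 ip hcos hsin cE c0 a_gt0 e0).
  have KQ0 : 0 <= K * Q by rewrite mulr_ge0// ltW.
  have ce0 : 0 <= c^-1 * e ^+ n by rewrite mulr_ge0 ?invr_ge0 ?exprn_ge0// ltW.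
  have mE := @measurable_gamma_density R (alpha / 2 + q / 2 - (n%:R + gm) / 2).
  rewrite [(_ * (K * Q * c1))%:E]EFinM -ge0_muleDr; last 2 first.
  - by apply: integral_ge0 => u _.
  - by rewrite lee_fin mulr_ge0// ltW.
  apply: lee_wpmul2l; first by rewrite lee_fin.
  rewrite [(K * Q * c1)%:E]EFinM -c1E -ge0_integralZl_EFin//.
  rewrite -ge0_integralD//; last 3 first.
  - exact: mke.
  - by move=> u _; rewrite mule_ge0 ?lee_fin ?expR_ge0.
  - exact: measurable_funeM.
  apply: ge0_le_integral => //.
    exact: mke.
    by apply: emeasurable_funD; [exact: mke|exact: measurable_funeM].
  move=> u _; rewrite -EFinM -EFinD lee_fin -!enorm_sqr -/r.
  apply: (le_trans (HK e r (enorm z') u z0 (ltW z'0))); rewrite lerD2l.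
  rewrite ler_wpM2r ?expR_ge0// rE -mulrA ler_wpM2l ?(ltW K0)// /Q ler_wpM2r ?powR_ge0//.
  by rewrite ge0_ler_powR ?nnegrE ?(ltW gm0) ?enorm_ge0// dist_enorm.
have gE := fineK (fing z z0); have gE' := fineK (fing z' z'0).
set G := fine (g z) in gE *; set G' := fine (g z') in gE' *.
have G'0 : 0 <= G' by exact: fine_ge0.
rewrite -!mulrA -/Q; set B := kap ^- n * _.
have B0 : 0 <= B.
  apply: mulr_ge0; first by rewrite invr_ge0 exprn_ge0// ltW.
  apply: mulr_ge0; first by rewrite invr_ge0 ltW.
  by apply: mulr_ge0; [exact: ltW|apply: mulr_ge0 => //; exact: ltW].
apply/ler_addgt0Pr => eps eps0.
have [Ge|eG] := leP G (eps / 3); first by lra.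
pose s := G - eps / 3; have s0 : 0 < s by rewrite subr_gt0.
have sg : (s%:E < g z)%E by rewrite -gE lte_fin /s; lra.
have sg' : (g z' < (G' + eps / 3)%:E)%E by rewrite -gE' lte_fin; lra.
have [D1 D10 H1] := smoothed_ge (ltW s0) sg.
have s'0 : 0 <= G' + eps / 3 by lra.
have [D2 D20 H2] := smoothed_le s'0 sg'.
have D0 : 0 < Num.min D1 D2 by rewrite lt_min D10.
have kn : 0 < kap ^+ n by rewrite exprn_gt0.
have tn : 0 < 2 ^+ n :> R by rewrite exprn_gt0.
pose w := s * 2 ^+ n + kap ^- n.
have w0 : 0 < w by rewrite addr_gt0 ?mulr_gt0// invr_gt0.
have eta0 : 0 < eps / 3 / w by rewrite !divr_gt0.
have [e /andP[e0 e1] he] := gauss_tail_small n D0 eta0.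
have en : 0 < e ^+ n by rewrite exprn_gt0.
have en1 : e ^+ n <= 1 by rewrite exprn_ile1// ltW.
have Tle D : Num.min D1 D2 <= D -> expR (- (D / e ^+ 2)) <= eps / 3 / w * e ^+ n.
  by move=> h; apply: le_trans he; rewrite ler_expR lerN2 ler_pM2r ?invr_gt0 ?exprn_gt0.
have := le_trans (H1 e e0) (leeD (le_trans (U e e0) (leeD (H2 e e0) (lexx _))) (lexx _)).
rewrite -!EFinD lee_fin.
have T1 := Tle D1 (ltac:(by rewrite ge_min lexx)).
have T2 := Tle D2 (ltac:(by rewrite ge_min lexx orbT)).
set t1 := expR _ in T1 *; set t2 := expR _ in T2 *.
have t10 : 0 <= t1 by exact: expR_ge0.
rewrite !exprMn; set kn' := kap ^+ n in kn *; set E := e ^+ n in en en1 T1 T2 *.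
have BE : c^-1 * E * (K * Q * c1) = B * (kn' * E).
  by rewrite /B -/kn'; field; rewrite ?gt_eqF.
rewrite BE => main.
have kE : 0 < kn' * E by rewrite mulr_gt0.
have m1 : s * t1 * (kn' * (2 ^+ n * E)) <= (s * 2 ^+ n * (eps / 3 / w)) * (kn' * E).
  have : t1 <= eps / 3 / w by apply: (le_trans T1); rewrite ler_piMr// ltW.
  move=> ht; rewrite (_ : s * t1 * _ = s * 2 ^+ n * t1 * (kn' * E)); last by ring.
  by rewrite ler_wpM2r ?(ltW kE)// ler_wpM2l// mulr_ge0 ?ltW.
have m2 : t2 <= kn'^-1 * (eps / 3 / w) * (kn' * E).
  rewrite (_ : kn'^-1 * (eps / 3 / w) * (kn' * E) = eps / 3 / w * E)//.
  by field; rewrite !gt_eqF.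
have m3 : s * 2 ^+ n * (eps / 3 / w) + kn'^-1 * (eps / 3 / w) = eps / 3.
  by rewrite -mulrDl -/w mulrC divfK// gt_eqF.
have : s * (kn' * E) <= (G' + eps / 3 + B + eps / 3) * (kn' * E).
  move: m1 m2 m3 main kE; set A1 := s * 2 ^+ n * _; set A2 := kn'^-1 * _.
  move: (kn' * E) (s * t1 * _) (eps / 3) A1 A2 => k t3 e3 A1 A2 m1 m2 <- main kE.
  by move: main; rewrite !mulrDl; lra.
rewrite ler_pM2r// /s; lra.
Qed.

End bessel_kernel.

(** * Hoelder continuity of the potential *)

Lemma powR_half_exprn (R : realType) (q : R) N :
  (2^-1 ^+ N) `^ q = (2 `^ (- q)) ^+ N.
Proof.
by rewrite powR_expr ?invr_ge0// -(powR_inv1 (ler0n R 2)) -powRrM mulN1r.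
Qed.

Section potential_of_occupation.
Context (R : realType) (k n : nat).
Local Notation cube := (unit_cube R k).
Local Notation leb := (lebesgue_Rn R k).
Variable Y : Rn R k -> Rn R n.
Hypothesis mY : forall i, measurable_fun setT (fun t => tnth (Y t) i : R).

Let mC : measurable cube. Proof. exact: measurable_unit_cube. Qed.

Let mYt : measurable_fun setT Y. Proof. exact/measurable_fun_tnthP. Qed.

Lemma integral_occupation_measure (f : Rn R n -> \bar R) :
  measurable_fun setT f -> (forall y, (0 <= f y)%E) ->
  (\int[occupation_measure Y]_y f y = \int[leb]_(t in cube) f (Y t))%E.
Proof.
move=> mf f0.
have -> : occupation_measure Y = pushforward (mrestr leb mC) Y.
  by apply/funext => B; rewrite /occupation_measure /pushforward /mrestr setIC.
rewrite ge0_integral_pushforward// preimage_setT.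
rewrite (@ge0_integral_density _ _ _ leb (mrestr leb mC) (\1_cube)) //=; first last.
- exact: measurableT_comp mf mYt.
- by move=> A mA; rewrite integral_indic//= /mrestr setIC.
rewrite [RHS]integral_mkcond; apply: eq_integral => t _; rewrite patchE indicE.
by case: ifP => _; rewrite ?mule1 ?mule0.
Qed.

Definition hit_ball (x : 'cV[R]_n) (r : R) : set (Rn R k) :=
  [set t | cube t /\ forall i, `|(tnth (Y t) i : R) - x i 0| <= r].

Lemma measurable_hit_ball x r : measurable (hit_ball x r).
Proof.
have -> : hit_ball x r = cube `&` \bigcap_(i : 'I_n)
    [set t | `|(tnth (Y t) i : R) - x i 0| <= r].
  by apply/seteqP; split=> t [ct h]; split => // i; [move=> _; exact: h|exact: (h i I)].
apply: measurableI => //; apply: fin_bigcap_measurable => [|i _]; first exact: finite_finset.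
apply: (@measurable_le_set _ _ _ (fun t => `|(tnth (Y t) i : R) - x i 0|)).
by apply: measurableT_comp => //; exact: measurable_funB.
Qed.

(* In Rocq [0 `^ (- q)] is not infinite, hence the case distinction. *)
Definition riesz (q : R) (z : 'cV[R]_n) : \bar R :=
  if enorm z == 0 then +oo%E else (enorm z `^ (- q))%:E.

Lemma riesz_ge0 q z : (0 <= riesz q z)%E.
Proof. by rewrite /riesz; case: ifP => // _; rewrite lee_fin powR_ge0. Qed.

Let menorm (x : 'cV[R]_n) : measurable_fun setT (fun t => enorm (x - colv (Y t))).
Proof.
under eq_fun do rewrite -[enorm _]ger0_norm ?enorm_ge0// -sqrtr_sqr -powR12_sqrt ?sqr_ge0//.
apply: (measurableT_comp (measurable_powR _)).
apply: measurable_enorm_sqr => i; under eq_fun do rewrite !mxE.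
exact: measurable_funB.
Qed.

Lemma measurable_riesz q x : measurable_fun setT (fun t => riesz q (x - colv (Y t))).
Proof.
apply: measurable_fun_ifT => //.
  by apply: measurable_fun_eqr => //; exact: menorm.
by apply/measurable_EFinP; apply: (measurableT_comp (measurable_powR _)); exact: menorm.
Qed.

Let abs_le_enorm (z : 'cV[R]_n) i : `|z i 0| <= enorm z.
Proof.
rewrite -(@ler_pXn2r _ 2)// ?nnegrE ?enorm_ge0// real_normK ?num_real// enorm_sqr.
rewrite (bigD1 i)//= lerDl; apply: sumr_ge0 => j _; exact: sqr_ge0.
Qed.

Lemma riesz_dyadic (q : R) x t : 0 <= q -> cube t ->
  (riesz q (x - colv (Y t)) <= 1 + \sum_(0 <= N <oo)
     ((2 `^ q) ^+ N.+1 * \1_(hit_ball x (2^-1 ^+ N)) t)%:E)%E.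
Proof.
move=> q0 ct; pose u N : \bar R := ((2 `^ q) ^+ N.+1 * \1_(hit_ball x (2^-1 ^+ N)) t)%:E.
rewrite -[X in (_ <= 1 + X)%E]/(\sum_(0 <= N <oo) u N)%E.
have two1 : 1 <= 2 `^ q :> R.
  by rewrite -[leLHS](powRr0 2) ler_powR// ler1n.
have u0 N : (0 <= u N)%E by rewrite lee_fin mulr_ge0 ?exprn_ge0 ?powR_ge0.
have uge m : (\sum_(0 <= i < m) u i <= \sum_(0 <= i <oo) u i)%E.
  by apply: nneseries_lim_ge.
have su0 : (0 <= \sum_(0 <= i <oo) u i)%E by exact: nneseries_ge0.
set z := x - colv (Y t); have z0 := enorm_ge0 z.
have hit N : enorm z <= 2^-1 ^+ N -> hit_ball x (2^-1 ^+ N) t.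
  move=> h; split => // i; rewrite distrC; apply: le_trans h.
  by have := abs_le_enorm z i; rewrite !mxE.
have uN N : enorm z <= 2^-1 ^+ N -> u N = ((2 `^ q) ^+ N.+1)%:E.
  by move=> /hit h; rewrite /u indicE mem_set// mulr1.
rewrite /riesz; case: ifPn => [/eqP zE|zN].
  suff -> : (\sum_(0 <= i <oo) u i = +oo)%E by rewrite addey.
  apply: eq_infty => r; pose m := (Num.truncn `|r|).+1.
  have rm : r <= m%:R.
    have /andP[_ h] := truncn_itv (normr_ge0 r).
    exact: le_trans (ler_norm r) (ltW h).
  apply: le_trans (uge m); apply: (@le_trans _ _ (\sum_(0 <= i < m) 1)%E).
    by rewrite big_mkord sumEFin lee_fin sumr_const card_ord.
  apply: lee_sum => i _; rewrite uN ?zE ?exprn_ge0// lee_fin.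
  by rewrite exprn_ege1.
have {}z0 : 0 < enorm z by rewrite lt_neqAle eq_sym zN.
have [z1|z1] := leP 1 (enorm z).
  apply: (@le_trans _ _ 1%E); last by rewrite leeDl.
  rewrite lee_fin powRN invf_le1 ?powR_gt0// -(powRr0 (enorm z)) ler_powR//.
have exN : exists N : nat, 2^-1 ^+ N < enorm z.
  have [N hN] : exists N : nat, (enorm z)^-1 < N%:R.
    by have /andP[_ h] := @truncn_itv R (enorm z)^-1 (ltac:(by rewrite invr_ge0 ltW)); eexists; exact: h.
  exists N; rewrite exprVn invf_plt ?posrE ?exprn_gt0//.
  by apply: (lt_trans hN); rewrite -natrX ltr_nat ltn_expl.
have [[|N] hN minN] := ex_minnP exN.
  by move: hN; rewrite expr0 ltNge (ltW z1).
have zN' : enorm z <= 2^-1 ^+ N.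
  by rewrite leNgt; apply/negP => /minN; rewrite ltnn.
apply: (@le_trans _ _ (u N)); last first.
  apply: (@le_trans _ _ (\sum_(0 <= i <oo) u i)%E); last by rewrite leeDr.
  apply: le_trans (uge N.+1); rewrite big_nat_recr//= leeDr//.
  by apply: sume_ge0 => i _.
rewrite uN// lee_fin powRN -[leRHS]invrK lef_pV2 ?posrE ?invr_gt0 ?exprn_gt0 ?powR_gt0//.
rewrite -exprVn -powRN.
rewrite -powR_half_exprn.
by rewrite ge0_ler_powR ?nnegrE ?exprn_ge0 ?invr_ge0 ?(ltW z0)// ltW.
Qed.

Variables (q q1 : R).
Hypotheses (q_ge0 : 0 <= q) (qq1 : q < q1).
Hypothesis frost : forall M : nat, exists2 C : R, 0 <= C &
  forall N (x : 'cV[R]_n), (forall i, `|x i 0| <= M%:R) ->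
    (\int[leb]_t (\1_(hit_ball x (2^-1 ^+ N)) t)%:E <= (C * (2^-1 ^+ N) `^ q1)%:E)%E.

Lemma integral_riesz_bound (M : nat) : exists2 C : R, 0 < C &
  forall x : 'cV[R]_n, (forall i, `|x i 0| <= M%:R) ->
    (\int[leb]_(t in cube) riesz q (x - colv (Y t)) <= C%:E)%E.
Proof.
have [C C0 HC] := frost M.
pose b : R := 2 `^ (q - q1).
have b0 : 0 < b by exact: powR_gt0.
have b1 : b < 1.
  rewrite /b /powR gt_eqF// -[ltRHS]expR0 ltr_expR.
  have l2 : 0 < ln 2 :> R by rewrite ln_gt0// ltr1n.
  by rewrite pmulr_llt0// subr_lt0.
pose B := C * 2 `^ q / (1 - b).
have B0 : 0 <= B by rewrite divr_ge0 ?mulr_ge0 ?powR_ge0// subr_ge0 ltW.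
exists (1 + B); first by lra.
move=> x xM.
pose u N (t : Rn R k) := ((2 `^ q) ^+ N.+1 * \1_(hit_ball x (2^-1 ^+ N)) t)%:E.
have mi N : measurable_fun setT (fun t => (\1_(hit_ball x (2^-1 ^+ N)) t : R)).
  exact: measurable_indic (measurable_hit_ball _ _).
have mu N : measurable_fun cube (u N).
  by apply: measurable_funTS; apply/measurable_EFinP; apply: measurable_funM.
have u0 N t : (0 <= u N t)%E by rewrite lee_fin mulr_ge0 ?exprn_ge0 ?powR_ge0.
apply: (@le_trans _ _ (\int[leb]_(t in cube) (1 + \sum_(0 <= N <oo) u N t))%E).
  apply: ge0_le_integral => //.
  - by move=> t _; exact: riesz_ge0.
  - by apply: measurable_funTS; exact: measurable_riesz.
  - apply: emeasurable_funD => //; apply: ge0_emeasurable_sum => //.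
  - by move=> t ct; exact: riesz_dyadic.
rewrite ge0_integralD//; last 2 first.
- by move=> t _; apply: nneseries_ge0.
- by apply: ge0_emeasurable_sum.
rewrite EFinD; apply: leeD.
  by rewrite (integral_cst leb mC 1) mul1e [leLHS](lebesgue_unit_cube R k).
rewrite integral_nneseries//; apply: lime_le.
  by apply: is_cvg_nneseries => N _ _; apply: integral_ge0.
apply: nearW => m.
apply: (@le_trans _ _ (\sum_(0 <= N < m) (C * 2 `^ q * b ^+ N)%:E)%E).
  apply: lee_sum => N _.
  apply: (@le_trans _ _ (\int[leb]_t u N t)%E).
    by apply: ge0_subset_integral => //; apply/measurable_EFinP; apply: measurable_funM.
  under eq_integral do rewrite /u EFinM.
  rewrite ge0_integralZl_EFin ?exprn_ge0 ?powR_ge0//; last exact/measurable_EFinP.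
  apply: (@le_trans _ _ (((2 `^ q) ^+ N.+1)%:E * (C * (2^-1 ^+ N) `^ q1)%:E)%E).
    by apply: lee_wpmul2l; [rewrite lee_fin exprn_ge0 ?powR_ge0|exact: HC].
  rewrite -EFinM lee_fin le_eqVlt; apply/orP; left; apply/eqP.
  rewrite powR_half_exprn.
  have bE : b = 2 `^ q * 2 `^ (- q1) by rewrite /b powRD// pnatr_eq0 implybT.
  by rewrite bE exprMn exprS; ring.
rewrite sumEFin lee_fin -mulr_sumr ler_pdivlMr ?subr_gt0// -mulrA.
rewrite ler_piMr ?mulr_ge0 ?powR_ge0// big_mkord mulrC.
have -> : (1 - b) * (\sum_(i < m) b ^+ i) = 1 - b ^+ m.
  by rewrite -[RHS]opprB subrX1 -mulNr opprB.
by rewrite lerBlDr lerDl exprn_ge0 ?ltW.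
Qed.

Variables (g : 'cV[R]_n -> \bar R) (gm K : R).
Hypothesis g0 : forall z, (0 <= g z)%E.
Hypothesis mg : measurable_fun setT (g \o @colv R n).
Hypothesis gm01 : 0 < gm <= 1.
Hypothesis K_gt0 : 0 < K.
Hypothesis gle : forall z, 0 < enorm z -> (g z <= (K * enorm z `^ (- q))%:E)%E.
Hypothesis ghol : forall z z', 0 < enorm z -> 0 < enorm z' ->
  fine (g z) <= fine (g z') + K * enorm (z - z') `^ gm * enorm z `^ (- q).

Let K0 : 0 <= K. Proof. exact: ltW. Qed.

Let mgx x : measurable_fun setT (fun y : Rn R n => g (x - colv y)).
Proof.
have -> : (fun y : Rn R n => g (x - colv y)) =
    (g \o @colv R n) \o (fun y : Rn R n => [tuple x i 0 - tnth y i | i < n]).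
  apply/funext => y /=; congr g; apply/matrixP => i j.
  by rewrite (ord1 j) !mxE tnth_mktuple.
apply: (measurableT_comp mg); apply/measurable_fun_tnthP => i.
rewrite [X in measurable_fun _ X](_ : _ = fun y : Rn R n => x i 0 - (tnth y i : R)); last first.
  by apply/funext => y /=; rewrite tnth_mktuple.
by apply: measurable_funB => //; exact: measurable_tnth.
Qed.

Let mgY x : measurable_fun setT (fun t => g (x - colv (Y t))).
Proof. exact: (measurableT_comp (mgx x) mYt). Qed.

Let potentialE x : potential g (occupation_measure Y) x =
  (\int[leb]_(t in cube) g (x - colv (Y t)))%E.
Proof. by rewrite /potential (integral_occupation_measure (mgx x)). Qed.

Let g_riesz z : (g z <= K%:E * riesz q z)%E.
Proof.
rewrite /riesz; case: ifPn => [_|z0]; first by rewrite gt0_muley ?leey// lte_fin.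
by rewrite -EFinM gle// lt_neqAle eq_sym z0 enorm_ge0.
Qed.

Let riesz_enorm z : enorm z != 0 -> riesz q z = (enorm z `^ (- q))%:E.
Proof. by rewrite /riesz => /negbTE ->. Qed.

Let g_diff z z' : 0 < enorm (z - z') ->
  (g z <= g z' + (K * enorm (z - z') `^ gm)%:E * (riesz q z + riesz q z'))%E.
Proof.
move=> zz'; have c0 : 0 < K * enorm (z - z') `^ gm by rewrite mulr_gt0// powR_gt0.
have [zE|z0] := eqVneq (enorm z) 0.
  rewrite [in X in (_ <= _ + _ * (X + _))%E]/riesz zE eqxx addye; last first.
    by rewrite gt_eqF// (lt_le_trans _ (riesz_ge0 _ _))// ltNyr.
  by rewrite gt0_muley ?lte_fin// addey ?leey// gt_eqF// (lt_le_trans _ (g0 _))// ltNyr.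
have [zE'|z0'] := eqVneq (enorm z') 0.
  rewrite [in X in (_ <= _ + _ * (_ + X))%E]/riesz zE' eqxx addey; last first.
    by rewrite gt_eqF// (lt_le_trans _ (riesz_ge0 _ _))// ltNyr.
  by rewrite gt0_muley ?lte_fin// addey ?leey// gt_eqF// (lt_le_trans _ (g0 _))// ltNyr.
have pos (y : 'cV[R]_n) : enorm y != 0 -> 0 < enorm y.
  by move=> y0; rewrite lt_neqAle eq_sym y0 enorm_ge0.
have fing y : enorm y != 0 -> g y \is a fin_num.
  by move=> /pos y0; rewrite ge0_fin_numE// (le_lt_trans (gle y0))// ltry.
rewrite -[X in (X <= _)%E](fineK (fing z z0)) -[X in (_ <= X + _)%E](fineK (fing z' z0')).
rewrite (riesz_enorm z0) (riesz_enorm z0') -[X in (_ * X)%E]EFinD -EFinM -EFinD lee_fin.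
apply: (le_trans (ghol (pos z z0) (pos z' z0'))).
by rewrite lerD2l ler_wpM2l ?(ltW c0)// lerDl powR_ge0.
Qed.

Lemma potential_hoelder : locally_hoelder (potential g (occupation_measure Y)).
Proof.
have mgC x : measurable_fun cube (fun t => g (x - colv (Y t))) by exact: measurable_funTS.
have mr x : measurable_fun cube (fun t => riesz q (x - colv (Y t))).
  by apply: measurable_funTS; exact: measurable_riesz.
have fin x : potential g (occupation_measure Y) x \is a fin_num.
  pose M := (Num.truncn (enorm x)).+1.
  have xM i : `|x i 0| <= M%:R.
    have /andP[_ h] := truncn_itv (enorm_ge0 x).
    exact: le_trans (abs_le_enorm x i) (ltW h).
  have [C C0 HC] := integral_riesz_bound M.
  rewrite potentialE ge0_fin_numE; last by apply: integral_ge0.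
  apply: (@le_lt_trans _ _ (K%:E * C%:E)%E); last by rewrite -EFinM ltry.
  apply: (@le_trans _ _ (\int[leb]_(t in cube) (K%:E * riesz q (x - colv (Y t))))%E).
    by apply: ge0_le_integral => //; exact: measurable_funeM.
  rewrite ge0_integralZl_EFin//; last by move=> t _; exact: riesz_ge0.
  by apply: lee_wpmul2l; [rewrite lee_fin|exact: HC].
split => //; exists gm => // A /compact_bounded[M0 [_ HM]].
pose M := (Num.truncn `|M0|).+1.
have AM x : A x -> forall i, `|x i 0| <= M%:R.
  move=> Ax i; have M0M : M0 < M%:R.
    have /andP[_ h] := truncn_itv (normr_ge0 M0).
    exact: le_lt_trans (ler_norm M0) h.
  have := HM _ M0M x Ax; apply: le_trans.
  by rewrite -[leRHS]/(mx_norm x) mx_normrE; exact: (le_bigmax _ (fun ij => `|x ij.1 ij.2|) (i, 0)).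
have [C C0 HC] := integral_riesz_bound M.
exists (2 * K * C) => x x' Ax Ax'.
have one z z' : A z -> A z' -> 0 < enorm (z - z') ->
    fine (potential g (occupation_measure Y) z) <=
    fine (potential g (occupation_measure Y) z') + 2 * K * C * enorm (z - z') `^ gm.
  move=> Az Az' zz'; rewrite -lee_fin EFinD !fineK// !potentialE.
  set c := enorm _ `^ gm; have c0 : 0 <= c by exact: powR_ge0.
  have -> : 2 * K * C * c = K * c * (C + C) by ring.
  apply: (@le_trans _ _ (\int[leb]_(t in cube) (g (z' - colv (Y t)) +
      (K * c)%:E * (riesz q (z - colv (Y t)) + riesz q (z' - colv (Y t)))))%E).
    apply: ge0_le_integral => //.
    - apply: emeasurable_funD => //; apply: measurable_funeM; exact: emeasurable_funD.
    - move=> t _; have E : z - z' = (z - colv (Y t)) - (z' - colv (Y t)).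
        by rewrite opprB addrA subrK.
      by rewrite /c E; apply: g_diff; rewrite -E.
  have r0 y t : (0 <= riesz q (y - colv (Y t)))%E by exact: riesz_ge0.
  rewrite ge0_integralD//; last 2 first.
  - by move=> t _; rewrite mule_ge0 ?adde_ge0// lee_fin mulr_ge0.
  - by apply: measurable_funeM; exact: emeasurable_funD.
  apply: leeD => //; rewrite ge0_integralZl_EFin ?mulr_ge0//; last 2 first.
  - by move=> t _; rewrite adde_ge0.
  - exact: emeasurable_funD.
  rewrite [leRHS]EFinM; apply: lee_wpmul2l; first by rewrite lee_fin mulr_ge0.
  by rewrite ge0_integralD// EFinD; apply: leeD; apply: HC; exact: AM.
have [xx'|xx'] := eqVneq (enorm (x - x')) 0.
  have : x = x'.
    apply/matrixP => i j; rewrite (ord1 j); apply/eqP; rewrite -subr_eq0 -normr_le0.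
    by have := abs_le_enorm (x - x') i; rewrite !mxE xx'.
  move=> <-; rewrite subrr normr0; apply: mulr_ge0; last exact: powR_ge0.
  by apply: mulr_ge0; [exact: mulr_ge0|exact: ltW].
have {}xx' : 0 < enorm (x - x') by rewrite lt_neqAle eq_sym xx' enorm_ge0.
rewrite ler_norml; apply/andP; split.
  have := one x' x Ax' Ax; rewrite enorm_sub_sym => /(_ xx'); lra.
by have := one x x' Ax Ax' xx'; lra.
Qed.

End potential_of_occupation.

Theorem theorem5p7 (R : realType) (d : measure_display)
    (Omega : measurableType d) (P : probability Omega R) (k n : nat)
    (X : Rn R k -> Omega -> Rn R n) (phi : Rn R k -> Rn R n)
    (alpha delta : R) (g : 'cV[R]_n -> \bar R) :
  (0 < k)%N ->
  measurable_fun (unit_cube R k `*` [set: Omega]) (fun p => X p.1 p.2) ->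
  centered_gaussian_field P X ->
  {ae P, forall w, X (origin R k) w = origin R n} ->
  measurable_fun (unit_cube R k) phi ->
  (exists M : R, forall t, unit_cube R k t -> enorm (colv (phi t)) <= M) ->
  {ae (lebesgue_Rn R k \x lebesgue_Rn R k)%E, forall p,
     unit_cube R k p.1 -> unit_cube R k p.2 ->
     0 < \det (increment_cov P X p.1 p.2)} ->
  locally_nondeterministic P X ->
  0 < alpha < n%:R ->
  0 < delta ->
  (ess_sup (mrestr (lebesgue_Rn R k) (measurable_unit_cube R k))
     (fun s => \int[lebesgue_Rn R k]_(t in unit_cube R k)
        ((`|\det (increment_cov P X s t)|
            `^ ((n%:R - alpha) / (2 * n%:R) + delta))%:E)^-1) < +oo)%E ->
  is_bessel_kernel alpha g ->
  {ae P, forall w, locally_hoelder (potential g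
     (occupation_measure (fun t =>
        [tuple (tnth (X t w) i : R) + tnth (phi t) i | i < n])))}.
Proof.
move=> k0 mX gX X0 mphi _ _ lnd alpha_itv delta0 ess gB.
have /andP[al0 aln] := alpha_itv.
have n0 : 0 < n%:R :> R by exact: lt_trans aln.
pose q0 : R := Num.min n%:R (n%:R - alpha + 2 * n%:R * delta).
have nd0 : 0 < 2 * n%:R * delta by rewrite !mulr_gt0.
have q0_gt : n%:R - alpha < q0.
  by rewrite lt_min; apply/andP; split; lra.
have q0n : q0 <= n%:R by rewrite ge_min lexx.
have q0d : q0 <= n%:R - alpha + 2 * n%:R * delta by rewrite ge_min lexx orbT.
have q0_gt0 : 0 < q0 by lra.
pose th := q0 / n%:R.
have th01 : 0 <= th <= 1 by rewrite divr_ge0 ?(ltW q0_gt0)//= ler_pdivrMr// mul1r.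
have nth : n%:R * th = q0 by rewrite mulrC divfK// gt_eqF.
have a_le : 0 < th / 2 <= (n%:R - alpha) / (2 * n%:R) + delta.
  rewrite !divr_gt0//=.
  rewrite (_ : th / 2 = q0 / (2 * n%:R)); last by rewrite /th; field; rewrite gt_eqF.
  rewrite ler_pdivrMr ?mulr_gt0// mulrDl divfK ?mulf_neq0 ?gt_eqF//.
  by rewrite [delta * _]mulrC.
have [K K0 HK] := cov_weight_integral_bound mX a_le ess.
pose D := q0 - (n%:R - alpha).
have D0 : 0 < D by rewrite subr_gt0.
pose q := n%:R - alpha + D / 2.
pose q1 := n%:R - alpha + 3 * D / 4.
pose gm : R := Num.min 1 (D / 4).
have gm1 : gm <= 1 by rewrite ge_min lexx.
have gmD : gm <= D / 4 by rewrite ge_min lexx orbT.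
have gm0 : 0 < gm by rewrite lt_min ltr01 divr_gt0.
have gm01 : 0 < gm <= 1 by rewrite gm0.
have qE : q0 = n%:R - alpha + D by rewrite /D; ring.
have q1th : q1 < n%:R * th by rewrite nth /q1; lra.
have [K1 K10 H1] := @bessel_kernel_le R n alpha g gB alpha_itv q
  (ltac:(rewrite /q; apply/andP; split; lra)).
have [K2 K20 H2] := @bessel_kernel_holder R n alpha g gB alpha_itv q gm gm01
  (ltac:(rewrite /q; apply/andP; split; lra)).
have [_ g0 ig _ _] := gB.
apply: filterS (ae_frostman mX gX X0 mphi lnd th01 K0 HK q1th) => w hw.
pose Y (t : Rn R k) : Rn R n :=
  [tuple (tnth (extend_field X t w) i : R) + tnth (extend_fun phi t) i | i < n].
have -> : occupation_measure (fun t =>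
    [tuple (tnth (X t w) i : R) + tnth (phi t) i | i < n]) = occupation_measure Y.
  apply/funext => B; congr (lebesgue_Rn R k _); apply/seteqP.
  by split=> t [ct Bt]; split => //; move: Bt; rewrite /Y/= extend_fieldE// extend_funE.
have mY i : measurable_fun setT (fun t => tnth (Y t) i : R).
  under eq_fun do rewrite tnth_mktuple.
  apply: measurable_funD; last exact: measurable_extend_fun.
  exact: (measurableT_comp (measurable_extend_field mX i)
    (measurable_fun_pair (@measurable_id _ _ setT) (measurable_cst w))).
apply: (@potential_hoelder R k n Y mY q q1 _ _ _ g gm (K1 + K2)) => //.
- by rewrite /q; lra.
- by rewrite /q /q1; lra.
- move=> M; have [C C0 HC] := hw M; exists C => // N x xM.
  have := HC N (fun i => x i 0) xM; rewrite /sojourn.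
  congr (_ <= _)%E; apply: eq_integral => t _; congr EFin.
  rewrite !indicE; congr (_%:R); congr nat_of_bool.
  have YE i : tnth (Y t) i = (tnth (extend_field X t w) i : R) + tnth (extend_fun phi t) i.
    by rewrite tnth_mktuple.
  by apply/idP/idP => /set_mem[ct h]; apply/mem_set; split => // i; move: (h i); rewrite YE.
- exact: measurable_int ig.
- by rewrite addr_gt0.
- move=> z z0; apply: (le_trans (H1 z z0)).
  by rewrite lee_fin ler_wpM2r ?powR_ge0// lerDl ltW.
- move=> z z' z0 z'0; apply: (le_trans (H2 z z' z0 z'0)).
  by rewrite lerD2l ler_wpM2r ?powR_ge0// ler_wpM2r ?powR_ge0// lerDr ltW.
Qed.
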